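(* There exist a compact complex manifold $X$ equipped with an area form $\omega$, a nonconstant entire holomorphic curve $f:\mathbb{C}\to X$, and two Ahlfors currents $T_1,T_2$ associated to $f$ (with respect to $\omega$) which are cohomologically different, i.e. the closed currents $T_1$ and $T_2$ define different de Rham cohomology classes on $X$.
   Context: Let $X$ be a compact complex manifold equipped with an area form $\omega$ (the positive $(1,1)$-form of a hermitian metric on $X$), and let $f:\mathbb{C}\to X$ be a nonconstant holomorphic map (an entire curve). Write $\mathbb{D}_r=\{z\in\mathbb{C}:|z|<r\}$, let $[f(\mathbb{D}_r)]=f_*[\mathbb{D}_r]$ be the current of integration $\eta\mapsto\int_{\mathbb{D}_r}f^*\eta$ acting on smooth 2-forms $\eta$, let $\mathrm{Area}_\omega(f(\mathbb{D}_r))=\int_{\mathbb{D}_r}f^*\omega$, and let $\mathrm{Length}_\omega(f(\partial\mathbb{D}_r))$ be the length of the boundary curve $f|_{\partial\mathbb{D}_r}$ for the metric $\omega$. An Ahlfors current associated to $f$ is a positive closed current $T$ of bidimension $(1,1)$ on $X$ which is the weak limit of a sequence $$\frac{[f(\mathbb{D}_{r_n})]}{\mathrm{Area}_\omega(f(\mathbb{D}_{r_n}))},\qquad n\to\infty,$$ for some sequence of radii $r_n\nearrow\infty$ satisfying $$\lim_{n\to\infty}\frac{\mathrm{Length}_\omega(f(\partial\mathbb{D}_{r_n}))}{\mathrm{Area}_\omega(f(\mathbb{D}_{r_n}))}=0.$$ *)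

(* Defs.v *)
From HB Require Import structures.
From mathcomp Require Import all_boot all_order all_algebra.
From mathcomp Require Import all_classical all_reals all_analysis.
From mathcomp Require Import complex.
Set Implicit Arguments.
Unset Strict Implicit.
Unset Printing Implicit Defensive.
Import Order.TTheory GRing.Theory Num.Theory numFieldNormedType.Exports.
Local Open Scope classical_set_scope.
Local Open Scope ring_scope.
Local Open Scope complex_scope.

(* As a [numFieldType], the complex field carries its norm topology, and
   differentiability over it is complex differentiability. *)
Definition Cplx (R : realType) : numFieldType := R[i].

Definition iC {R : realType} : Cplx R := 0 +i* 1.

Section RealDerivatives.
Context {R : realType} {n : nat}.
Local Notation C := (Cplx R).
Local Notation V := 'rV[C]_n.

Definition real_diffquot (f : V -> C) (z v : V) : R -> C :=
  fun h => (h^-1)%:C * (f (h%:C *: v + z) - f z).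

Definition real_derive (v : V) (f : V -> C) : V -> C :=
  fun z => lim (real_diffquot f z v h @[h --> 0^']).

Definition real_derives (ds : seq V) (f : V -> C) : V -> C :=
  foldr real_derive f ds.

Definition smooth_on (U : set V) (f : V -> C) : Prop :=
  forall (ds : seq V) (z : V), U z ->
    {for z, continuous (real_derives ds f)} /\
    forall v, cvg (real_diffquot (real_derives ds f) z v h @[h --> 0^']).

(* C^oo(U)-convergence to 0: every iterated derivative tends to 0 uniformly on
   every compact subset of U. *)
Definition smooth_cvg0 (U : set V) (u : nat -> V -> C) : Prop :=
  forall (ds : seq V) (K : set V), compact K -> K `<=` U ->
    {uniform K, (fun m => real_derives ds (u m)) @ \oo --> (cst 0 : V -> C)}.

End RealDerivatives.

(* Second countability follows from compactness and the local charts, and is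
   therefore not a field.  Connectedness is not assumed. *)
Record compactComplexManifold (R : realType) (n : nat) := CompactComplexManifold {
  mcarrier :> topologicalType;
  chart_index : Type;
  chart_dom : chart_index -> set mcarrier;
  chart : chart_index -> mcarrier -> 'rV[Cplx R]_n;
  chart_inv : chart_index -> 'rV[Cplx R]_n -> mcarrier;
  chart_at : mcarrier -> chart_index;
  _ : hausdorff_space mcarrier;
  _ : compact [set: mcarrier];
  _ : forall x, chart_dom (chart_at x) x;
  _ : forall i, open (chart_dom i);
  _ : forall i, open (chart i @` chart_dom i);
  _ : forall i x, chart_dom i x -> chart_inv i (chart i x) = x;
  _ : forall i x, chart_dom i x -> {for x, continuous (chart i)};
  _ : forall i z, (chart i @` chart_dom i) z -> {for z, continuous (chart_inv i)};
  _ : forall i j z, (chart i @` (chart_dom i `&` chart_dom j)) z ->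
        differentiable (chart j \o chart_inv i) z
}.

Section Forms.
Context {R : realType} {n : nat} (X : compactComplexManifold R n).
Local Notation C := (Cplx R).
Local Notation V := 'rV[C]_n.

Definition chart_img (i : chart_index X) : set V := chart i @` chart_dom i.

Definition transition (i j : chart_index X) : V -> V := chart j \o chart_inv i.

(* A complex-valued k-form is given by its expressions in all charts; its values
   at points outside [chart_img i] are junk.  [is_form] singles out the
   genuine smooth forms, and functionals on [preform k] (such as currents) are
   only ever constrained and used on those. *)
Definition preform (k : nat) : Type :=
  chart_index X -> V -> ('I_k -> V) -> C.

Definition real_multilinear k (w : ('I_k -> V) -> C) : Prop :=
  forall (v : 'I_k -> V) (a : 'I_k) (c : R) (x y : V),
    w (dfwith v a (c%:C *: x + y)) =
    c%:C * w (dfwith v a x) + w (dfwith v a y).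

Definition alternating k (w : ('I_k -> V) -> C) : Prop :=
  forall (v : 'I_k -> V) (a b : 'I_k), a != b -> v a = v b -> w v = 0.

Definition is_form k (eta : preform k) : Prop :=
  [/\ forall i z, chart_img i z ->
        real_multilinear (eta i z) /\ alternating (eta i z),
      forall i v, smooth_on (chart_img i) (fun z => eta i z v)
    & forall i j z v, (chart i @` (chart_dom i `&` chart_dom j)) z ->
        eta i z v = eta j (transition i j z)
                          (fun a => 'd (transition i j) z (v a))].

(* (d eta)(v_0, .., v_k) is the alternating sum of the derivatives along v_a of
   eta(v_0, .., v_(a-1), v_(a+1), .., v_k), for constant vectors v_a. *)
Definition ext_deriv k (eta : preform k) : preform k.+1 :=
  fun i z v => \sum_(a < k.+1)
    (-1) ^+ a * real_derive (v a) (fun z' => eta i z' (v \o lift a)) z.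

(* Forms of bidegree (p, q), as the weight space of the scalar action of C on
   tangent vectors: dz_I /\ d(conj z)_J with |I| = p, |J| = q is multiplied by
   lam^p (conj lam)^q when all its arguments are multiplied by lam. *)
Definition of_bidegree k (p q : nat) (eta : preform k) : Prop :=
  forall i z (v : 'I_k -> V) (lam : C), chart_img i z ->
    eta i z (fun a => lam *: v a) =
    lam ^+ p * (conjc (lam : R[i]) : C) ^+ q * eta i z v.

Definition vec2 (u v : V) : 'I_2 -> V := fun a => if a == ord0 then u else v.

(* In [0 <= x] and [0 < x] over the complex numbers, x is in particular real. *)
Definition positive_form (eta : preform 2) : Prop :=
  [/\ is_form eta, of_bidegree 1 1 eta &
      forall i z (v : V), chart_img i z -> 0 <= eta i z (vec2 v (iC *: v))].

Definition area_form (omega : preform 2) : Prop :=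
  [/\ is_form omega, of_bidegree 1 1 omega &
      forall i z (v : V), chart_img i z -> v != 0 ->
        0 < omega i z (vec2 v (iC *: v))].

(* Linear functionals on smooth k-forms, continuous for the C^oo topology;
   as that topology is metrizable, sequential continuity at 0 is enough. *)
Definition is_current k (T : preform k -> C) : Prop :=
  (forall (c : C) (eta theta : preform k), is_form eta -> is_form theta ->
     T (c *: eta + theta) = c * T eta + T theta) /\
  (forall u : nat -> preform k, (forall m, is_form (u m)) ->
     (forall i v, smooth_cvg0 (chart_img i) (fun m z => u m i z v)) ->
     T (u m) @[m --> \oo] --> (0 : C)).

Definition closed_current k (T : preform k.+1 -> C) : Prop :=
  forall alpha : preform k, is_form alpha -> T (ext_deriv alpha) = 0.

Definition bidimension11 (T : preform 2 -> C) : Prop :=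
  forall eta, is_form eta -> of_bidegree 2 0 eta \/ of_bidegree 0 2 eta ->
    T eta = 0.

Definition positive_current (T : preform 2 -> C) : Prop :=
  forall eta, positive_form eta -> 0 <= T eta.

(* Equality of the classes of T1 and T2 in the cohomology of the complex of
   currents, i.e. in de Rham cohomology: T1 - T2 = dS for a current S. *)
Definition cohomologous k (T1 T2 : preform k -> C) : Prop :=
  exists S : preform k.+1 -> C, is_current S /\
    forall eta, is_form eta -> T1 eta - T2 eta = S (ext_deriv eta).

Definition holomorphic_curve (f : C -> X) : Prop :=
  continuous f /\
  forall i z, chart_dom i (f z) -> differentiable (chart i \o f) z.

Definition velocity (f : C -> X) (z : C) : V :=
  'D_1 (chart (chart_at (f z)) \o f) z.

Definition eval2 (eta : preform 2) (x : X) (u v : V) : C :=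
  eta (chart_at x) (chart (chart_at x) x) (vec2 u v).

(* The coefficient g of f^* eta = g dx /\ dy, for holomorphic f: the partial
   derivatives of f along x and y are f' and i f'. *)
Definition pullback2 (f : C -> X) (eta : preform 2) (z : C) : C :=
  eval2 eta (f z) (velocity f z) (iC *: velocity f z).

Definition disc (r : R) : set (R * R) := [set p | p.1 ^+ 2 + p.2 ^+ 2 < r ^+ 2].

Definition leb2 := (@lebesgue_measure R \x @lebesgue_measure R)%E.

Definition disc_current (f : C -> X) (r : R) (eta : preform 2) : C :=
  (\int[leb2]_(p in disc r) complex.Re (pullback2 f eta (p.1 +i* p.2))) +i*
  (\int[leb2]_(p in disc r) complex.Im (pullback2 f eta (p.1 +i* p.2))).

Definition area (omega : preform 2) (f : C -> X) (r : R) : R :=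
  complex.Re (disc_current f r omega).

Definition tangent_norm (omega : preform 2) (x : X) (v : V) : R :=
  Num.sqrt (complex.Re (eval2 omega x v (iC *: v))).

(* The curve t |-> f(z), z = r e^(it), has velocity i z f'(z). *)
Definition boundary_length (omega : preform 2) (f : C -> X) (r : R) : R :=
  \int[lebesgue_measure]_(t in `[0, 2 * pi])
    let z : C := (r * cos t) +i* (r * sin t) in
    tangent_norm omega (f z) ((iC * z) *: velocity f z).

Definition ahlfors_current (omega : preform 2) (f : C -> X)
    (T : preform 2 -> C) : Prop :=
  [/\ is_current T, bidimension11 T, positive_current T, closed_current T &
      exists r : nat -> R,
        [/\ forall m, 0 < r m,
            increasing_seq r,
            r m @[m --> \oo] --> +oo,
            boundary_length omega f (r m) / area omega f (r m)
              @[m --> \oo] --> 0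
          & forall eta, is_form eta ->
              disc_current f (r m) eta / (area omega f (r m))%:C
                @[m --> \oo] --> T eta]].

End Forms.

(* Main.v *)
Require Import Defs.
From HB Require Import structures.
From mathcomp Require Import all_boot all_order all_algebra.
From mathcomp Require Import all_classical all_reals all_analysis.
From mathcomp Require Import complex.
From mathcomp Require Import measurable_realfun.
From mathcomp Require Import ring lra zify.
Set Implicit Arguments.
Unset Strict Implicit.
Unset Printing Implicit Defensive.
Import Order.TTheory GRing.Theory Num.Theory numFieldNormedType.Exports.
Local Open Scope classical_set_scope.
Local Open Scope ring_scope.
Local Open Scope complex_scope.
Local Notation Re := complex.Re.
Local Notation Im := complex.Im.

(** Take for [X] the torus C^2 / Z[i]^2 with its flat metric, and let [f] be
    the projection of the curve z |-> (P_0(z), P_1(z)), where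
      P_b(z) = sum over the k of parity b of (z / rho^k)^(4^k),  rho = 256.
    The exponents grow so fast that on the disc of radius r_k = rho^(k+1) the
    k-th term outweighs all the others together. With u = 2^(4^k) one finds, on
    that disc, that r_k |P_b'| is at most 2 u^6 when b is not the parity of k
    ([lac_deriv_small]), whereas for b the parity of k it is at most u^9
    everywhere and at least u^7 outside the disc of radius r_k / 2
    ([lac_deriv_large], [lac_deriv_lower]). Hence nearly all the area of f(D_(r_k))
    comes from the factor whose index is the parity of k. The form dx_0 /\ dy_0, which is
    closed, measures the share of the first factor, so every limit of the
    normalized currents along even k gives it the value 1, and every limit along
    odd k the value 0 ([example_current]). If the two limits differed by dS they
    would agree on closed forms ([not_cohomologous]).

    It remains that Ahlfors currents exist along both sequences of radii; this
    holds for every holomorphic curve on the torus that lifts to C^2 and for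
    which r sup|f'| / Area tends to 0 ([ahlfors_subsequence]). Here is why.

    Subsequences. In the coordinates of C^2 a 2-form is a combination of sixteen
    periodic functions h, and the current of integration is a sum of integrals of
    h(f) times a density that is bounded by the density of the area. A continuous
    periodic h is uniformly close to a function that is constant on the cells of
    a grid, so convergence for all h follows from convergence for the countably
    many pairs of a cell and a density, which one diagonal extraction provides
    ([weak_limit]).

    Closedness. The integral of f^*(d alpha) over the disc of radius r is a
    combination of integrals of partial derivatives of functions of size at most
    a constant times sup|f'|; integrated along chords of the disc first, each of
    them is at most a constant times r sup|f'| ([stokes_bound]). The length of
    the boundary curve obeys the same bound. Dividing by the area shows both that
    the limit is closed and that length over area tends to 0.

    The other properties of the limit (continuity, bidimension and positivity)
    hold for each normalized current, with bounds that do not depend on the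
    radius. *)

(** * Complex numbers through their real and imaginary parts *)

Section ComplexTopology.
Context {R : realType}.
Local Notation C := (Cplx R).

(** The norm of [Cplx R] takes values in [Cplx R] itself; this is the same
    modulus as a real number, so that real analysis applies to it. *)
Definition cabs (z : C) : R := Num.sqrt (Re z ^+ 2 + Im z ^+ 2).

Lemma normCE (z : C) : `|z| = (cabs z)%:C :> C.
Proof. exact: normc_def. Qed.

Lemma cabs_ge0 z : 0 <= cabs z. Proof. exact: sqrtr_ge0. Qed.

Lemma ReD (z w : C) : Re (z + w) = Re z + Re w. Proof. by case: z w => a b [c d]. Qed.
Lemma ImD (z w : C) : Im (z + w) = Im z + Im w. Proof. by case: z w => a b [c d]. Qed.
Lemma ReN (z : C) : Re (- z) = - Re z. Proof. by case: z. Qed.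
Lemma ImN (z : C) : Im (- z) = - Im z. Proof. by case: z. Qed.
Lemma ReB (z w : C) : Re (z - w) = Re z - Re w. Proof. by rewrite ReD ReN. Qed.
Lemma ImB (z w : C) : Im (z - w) = Im z - Im w. Proof. by rewrite ImD ImN. Qed.
Lemma Re_mulc (z w : C) : Re (z * w) = Re z * Re w - Im z * Im w.
Proof. by case: z w => a b [c d]. Qed.
Lemma Im_mulc (z w : C) : Im (z * w) = Re z * Im w + Im z * Re w.
Proof. by case: z w => a b [c d]. Qed.
Lemma ReZ (a : R) (w : C) : Re ((a%:C : C) * w) = a * Re w.
Proof. by rewrite Re_mulc /= mul0r subr0. Qed.
Lemma ImZ (a : R) (w : C) : Im ((a%:C : C) * w) = a * Im w.
Proof. by rewrite Im_mulc /= mul0r addr0. Qed.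
Lemma C_ext (z w : C) : Re z = Re w -> Im z = Im w -> z = w.
Proof. by case: z w => a b [c d] /= -> ->. Qed.

Lemma ltC_real (a b : R) : ((a%:C : C) < b%:C) = (a < b).
Proof. exact: ltcR. Qed.
Lemma leC_real (a b : R) : ((a%:C : C) <= b%:C) = (a <= b).
Proof. exact: lecR. Qed.

Lemma gt0_real (e : C) : 0 < e -> exists2 d : R, 0 < d & e = d%:C.
Proof.
case: e => a b; rewrite ltcE /= => /andP[/eqP -> a0]; by exists a.
Qed.

Lemma cabsM z w : cabs (z * w) = cabs z * cabs w.
Proof.
have := normrM z w; rewrite !normCE -[X in _ = X]rmorphM => /complexI; exact.
Qed.
Lemma cabsX z n : cabs (z ^+ n) = cabs z ^+ n.
Proof. by have := normrX n z; rewrite !normCE -rmorphXn => /complexI. Qed.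
Lemma cabsD z w : cabs (z + w) <= cabs z + cabs w.
Proof. by rewrite -leC_real rmorphD /= -!normCE ler_normD. Qed.
Lemma cabsN z : cabs (- z) = cabs z.
Proof. by have := normrN z; rewrite !normCE => /complexI. Qed.
Lemma cabsBC z w : cabs (z - w) = cabs (w - z).
Proof. by rewrite -cabsN opprB. Qed.
Lemma cabs_real (a : R) : cabs (a%:C) = `|a|.
Proof. by rewrite /cabs /= expr0n addr0 sqrtr_sqr. Qed.
Lemma cabs0 : cabs 0 = 0. Proof. by rewrite (cabs_real 0) normr0. Qed.
Lemma cabs_eq0 z : (cabs z == 0) = (z == 0).
Proof. by rewrite -[RHS]normr_eq0 normCE; apply/eqP/eqP => [->//|/complexI]. Qed.
Lemma cabs_sqr z : cabs z ^+ 2 = Re z ^+ 2 + Im z ^+ 2.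
Proof. by rewrite sqr_sqrtr // addr_ge0 ?sqr_ge0. Qed.
Lemma Re_le_cabs z : `|Re z| <= cabs z.
Proof. by rewrite -sqrtr_sqr ler_wsqrtr // lerDl sqr_ge0. Qed.
Lemma Im_le_cabs z : `|Im z| <= cabs z.
Proof. by rewrite -sqrtr_sqr ler_wsqrtr // lerDr sqr_ge0. Qed.
Lemma cabs_le z : cabs z <= `|Re z| + `|Im z|.
Proof.
have h : 0 <= `|Re z| + `|Im z| by rewrite addr_ge0.
rewrite -[leRHS](ger0_norm h) -(sqrtr_sqr (_ + _)) /cabs ler_wsqrtr //.
rewrite sqrrD !real_normK ?num_real // lerD2r lerDl.
by rewrite mulrn_wge0 // mulr_ge0.
Qed.

Lemma cvgC0 (T : Type) (F : set_system T) {FF : Filter F} (f : T -> C) (l : C) :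
  (f @ F --> l) <-> ((fun t => cabs (f t - l)) @ F --> (0 : R)).
Proof.
split=> [/cvgrPdist_lt h | /cvgrPdist_lt h]; apply/cvgrPdist_lt => e e0.
  have := h e%:C; rewrite ltC_real => /(_ e0); apply: filterS => t.
  by rewrite normCE ltC_real sub0r normrN ger0_norm ?cabs_ge0 // cabsBC.
have [d d0 ->] := gt0_real e0.
apply: filterS (h _ d0) => t.
by rewrite normCE ltC_real sub0r normrN ger0_norm ?cabs_ge0 // cabsBC.
Qed.

Lemma cvgC (T : Type) (F : set_system T) {FF : Filter F} (f : T -> C) (l : C) :
  (f @ F --> l) <->
  ((fun t => Re (f t)) @ F --> Re l) /\ ((fun t => Im (f t)) @ F --> Im l).
Proof.
rewrite cvgC0; split=> [h | [hr hi]].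
  split; apply/cvgrPdist_lt => e e0; move/cvgrPdist_lt: h => /(_ _ e0);
  apply: filterS => t; rewrite sub0r normrN ger0_norm ?cabs_ge0 //; apply: le_lt_trans.
  - by rewrite distrC -ReB Re_le_cabs.
  - by rewrite distrC -ImB Im_le_cabs.
apply: (@squeeze_cvgr _ _ _ _ (cst 0) (fun t => `|Re (f t) - Re l| + `|Im (f t) - Im l|)).
- by near=> t; rewrite /= cabs_ge0 -ReB -ImB cabs_le.
- exact: cvg_cst.
- have h0 (g : T -> R) a : (g @ F --> a) -> (fun t => `|g t - a|) @ F --> (0 : R).
    move=> h; rewrite -(normr0 R); apply: cvg_norm; rewrite -(subrr a).
    by apply: cvgB => //; exact: cvg_cst.
  by rewrite -(addr0 (0 : R)); apply: cvgD; exact: h0.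
Unshelve. all: by end_near. Qed.

Lemma continuous_Re : continuous (@Re R : C -> R).
Proof.
move=> z; have [h1 h2] := (@cvgC C (nbhs z) _ (fun t : C => t) z).1 (@cvg_id _ _).
exact: h1.
Qed.
Lemma continuous_Im : continuous (@Im R : C -> R).
Proof.
move=> z; have [h1 h2] := (@cvgC C (nbhs z) _ (fun t : C => t) z).1 (@cvg_id _ _).
exact: h2.
Qed.

Lemma continuous_mkC : continuous (fun p : R * R => (p.1 +i* p.2 : C)).
Proof.
move=> p; apply/cvgC; split => /=; [exact: cvg_fst | exact: cvg_snd].
Qed.
End ComplexTopology.

(** * Entire power series with nonnegative coefficients *)

Section PowerSeries.
Context {R : realType}.
Local Notation C := (Cplx R).

Lemma cvg_cabs (T : Type) (F : set_system T) {FF : Filter F} (f : T -> C) (l : C) :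
  (f @ F --> l) -> ((fun t => cabs (f t)) @ F --> cabs l).
Proof.
move=> /cvgC0/cvgrPdist_lt fl; apply/cvgrPdist_lt => e e0.
apply: filterS (fl _ e0) => t; rewrite sub0r normrN ger0_norm ?cabs_ge0 //.
rewrite cabsBC; apply: le_lt_trans.
have h1 := cabsD (l - f t) (f t); have h2 := cabsD (f t - l) l.
rewrite !subrK in h1 h2; rewrite ler_norml; rewrite cabsBC in h2; lra.
Qed.

Lemma cabs_lim_le (T : Type) (F : set_system T) {FF : ProperFilter F} (f : T -> C) (l : C) (B : R) :
  (f @ F --> l) -> (forall t, cabs (f t) <= B) -> cabs l <= B.
Proof.
move=> /cvg_cabs fl fB; apply: (cvgr_to_le fl).
exact: nearW.
Qed.

(** Summing real and imaginary parts separately makes this total and reduces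
    convergence to series of real numbers. *)
Definition csum (a : nat -> C) : C :=
  limn (series (fun j => Re (a j))) +i* limn (series (fun j => Im (a j))).

Lemma Re_sum (I : Type) (r : seq I) (P : pred I) (a : I -> C) :
  Re (\sum_(i <- r | P i) a i) = \sum_(i <- r | P i) Re (a i).
Proof. by apply: (big_morph (@Re R : C -> R)) => //; exact: ReD. Qed.
Lemma Im_sum (I : Type) (r : seq I) (P : pred I) (a : I -> C) :
  Im (\sum_(i <- r | P i) a i) = \sum_(i <- r | P i) Im (a i).
Proof. by apply: (big_morph (@Im R : C -> R)) => //; exact: ImD. Qed.

Lemma csum_cvg (a : nat -> C) (b : nat -> R) :
  (forall j, cabs (a j) <= b j) -> cvgn (series b) ->
  (fun n => \sum_(0 <= j < n) a j) @ \oo --> csum a.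
Proof.
move=> ab cb.
have h (u : nat -> R) : (forall j, `|u j| <= b j) -> cvgn (series u).
  move=> ub; apply: normed_cvg; apply: (@series_le_cvg _ _ b _ _ _ cb) => // j.
    exact: normr_ge0.
  exact: le_trans (normr_ge0 _) (ub j).
have hr : cvgn (series (fun j => Re (a j))).
  by apply: h => j; exact: le_trans (Re_le_cabs _) (ab j).
have hi : cvgn (series (fun j => Im (a j))).
  by apply: h => j; exact: le_trans (Im_le_cabs _) (ab j).
apply/cvgC; split=> /=.
  by under eq_fun do rewrite Re_sum.
by under eq_fun do rewrite Im_sum.
Qed.

Lemma cvgC_unique (u : nat -> C) (l m : C) : (u @ \oo --> l) -> (u @ \oo --> m) -> l = m.
Proof. by move=> ul um; apply: (cvg_unique _ ul um); exact: norm_hausdorff. Qed.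

Lemma cabs_sum (n : nat) (a : nat -> C) :
  cabs (\sum_(0 <= j < n) a j) <= \sum_(0 <= j < n) cabs (a j).
Proof.
elim: n => [|n IH]; first by rewrite !big_nil cabs0.
by rewrite !big_nat_recr //=; apply: le_trans (cabsD _ _) _; rewrite lerD2r.
Qed.

Lemma series_le_lim (b : nat -> R) n : (forall j, 0 <= b j) -> cvgn (series b) ->
  \sum_(0 <= j < n) b j <= limn (series b).
Proof.
move=> b0 cb; apply: (@nondecreasing_cvgn_le _ (series b)) => //.
apply/nondecreasing_seqP => k.
by rewrite /series /= big_nat_recr //= lerDl.
Qed.

Lemma cabs_csum_le (a : nat -> C) (b : nat -> R) :
  (forall j, cabs (a j) <= b j) -> cvgn (series b) ->
  cabs (csum a) <= limn (series b).
Proof.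
move=> ab cb; apply: (cabs_lim_le (csum_cvg ab cb)) => n.
apply: le_trans (cabs_sum _ _) _.
apply: le_trans (series_le_lim n _ cb); first exact: ler_sum.
by move=> j; exact: le_trans (cabs_ge0 _) (ab j).
Qed.

Lemma csum_lin (a a' : nat -> C) (b b' : nat -> R) (l : C) :
  (forall j, cabs (a j) <= b j) -> cvgn (series b) ->
  (forall j, cabs (a' j) <= b' j) -> cvgn (series b') ->
  csum (fun j => a j + l * a' j) = csum a + l * csum a'.
Proof.
move=> ab cb ab' cb'.
have c : cvgn (series (fun j => b j + cabs l * b' j)).
  rewrite (_ : series _ = series b + (fun n => cabs l * series b' n)).
    by apply: is_cvgD => //; apply: is_cvgM => //; exact: is_cvg_cst.
  by apply/funext => n; rewrite /series /= fctE /= big_split mulr_sumr.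
have d j : cabs (a j + l * a' j) <= b j + cabs l * b' j.
  apply: le_trans (cabsD _ _) _; rewrite cabsM; apply: lerD; first exact: ab.
  by rewrite ler_wpM2l // cabs_ge0.
apply: (cvgC_unique (csum_cvg d c)).
rewrite (_ : (fun n => _) = (fun n => \sum_(0 <= j < n) a j + l * \sum_(0 <= j < n) a' j)).
  apply: cvgD; first exact: (csum_cvg ab cb).
  by apply: cvgM; [exact: cvg_cst | exact: (csum_cvg ab' cb')].
by apply/funext => n; rewrite big_split mulr_sumr.
Qed.

(** [c] and [n] list the nonzero terms c_j z^(n_j) of a power series; the
    nonnegative coefficients make convergence on the positive axis imply absolute
    convergence everywhere. *)
Definition entire (c : nat -> R) (n : nat -> nat) : Prop :=
  (forall j, 0 <= c j) /\
  forall x : R, 0 <= x -> cvgn (series (fun j => c j * x ^+ n j)).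

Definition gap (c : nat -> R) (n : nat -> nat) (z : C) : C :=
  csum (fun j => (c j)%:C * z ^+ n j).

Definition dcoef (c : nat -> R) (n : nat -> nat) (j : nat) : R := c j * (n j)%:R.
Definition dexp (n : nat -> nat) (j : nat) : nat := (n j).-1.

Lemma cabs_term (c : nat -> R) (n : nat -> nat) (j : nat) (z : C) (x : R) :
  0 <= c j -> cabs z <= x -> cabs ((c j)%:C * z ^+ n j) <= c j * x ^+ n j.
Proof.
move=> c0 zx; rewrite cabsM cabs_real ger0_norm // ler_wpM2l // cabsX.
by apply: lerXn2r => //; rewrite nnegrE; [exact: cabs_ge0 | exact: le_trans (cabs_ge0 _) zx].
Qed.

Lemma natCE (m : nat) : (m%:R : C) = (m%:R : R)%:C.
Proof. exact: (esym (rmorph_nat (real_complex R) m)). Qed.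

Lemma ltn_2X n : (n < 2 ^ n)%N. Proof. exact: ltn_expl. Qed.

(** Since n is less than 2^n, n x^(n-1) is at most (2 (x + 1))^n, so the derived series at [x] is dominated
    by the original one at a larger point. *)
Lemma dterm_le (c : nat -> R) (n : nat -> nat) (j : nat) (x : R) :
  0 <= c j -> 0 <= x ->
  c j * (n j)%:R * x ^+ (n j).-1 <= c j * (2 * (x + 1)) ^+ n j.
Proof.
move=> c0 x0; rewrite -mulrA ler_wpM2l // exprMn; apply: ler_pM.
- exact: ler0n.
- exact: exprn_ge0.
- by rewrite -natrX ler_nat ltnW // ltn_2X.
- apply: (@le_trans _ _ ((x + 1) ^+ (n j).-1)).
    by apply: lerXn2r; rewrite ?nnegrE ?lerDl //; lra.
  by apply: ler_weXn2l; [lra | exact: leq_pred].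
Qed.

Lemma entire_deriv c n : entire c n -> entire (dcoef c n) (dexp n).
Proof.
move=> [c0 cc]; split=> [j|x x0]; first by rewrite mulr_ge0 // ler0n.
have x1 : 0 <= 2 * (x + 1) by lra.
apply: (@series_le_cvg _ _ (fun j => c j * (2 * (x + 1)) ^+ n j)).
- by move=> j; rewrite /dcoef !mulr_ge0 // exprn_ge0.
- by move=> j; rewrite mulr_ge0 // exprn_ge0.
- by move=> j; exact: dterm_le.
- exact: cc.
Qed.

(** By induction from (z + h)^(n+1) = (z + h) (z + h)^n; a bound with n^2 x^n is
    all that the summation over the terms of a series needs. *)
Lemma monomial_taylor (z h : C) (x : R) (n : nat) :
  1 <= x -> cabs z + cabs h <= x ->
  cabs ((z + h) ^+ n - z ^+ n - h * (n%:R * z ^+ n.-1)) <=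
  cabs h ^+ 2 * (n%:R ^+ 2 * x ^+ n).
Proof.
move=> x1 zx; elim: n => [|n IH].
  by rewrite !expr0 subrr mul0r mulr0 subr0 cabs0 expr0n !mul0r mulr0.
have -> : (z + h) ^+ n.+1 - z ^+ n.+1 - h * (n.+1%:R * z ^+ n.+1.-1) =
  (z + h) * ((z + h) ^+ n - z ^+ n - h * (n%:R * z ^+ n.-1))
  + h ^+ 2 * (n%:R * z ^+ n.-1).
  case: n {IH} => [|n] /=; first by rewrite !expr0 expr1; ring.
  rewrite !exprS -[n.+2%:R]natr1 -[n.+1%:R]natr1; ring.
have x0 : 0 <= x by lra.
have zle : cabs z <= x by have := cabs_ge0 h; lra.
apply: le_trans (cabsD _ _) _; rewrite cabsM (cabsM (h ^+ 2)) (cabsM n%:R) !cabsX.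
have hn : cabs (n%:R : C) = n%:R :> R by rewrite natCE cabs_real ger0_norm.
rewrite hn.
have h1 : cabs (z + h) * cabs ((z + h) ^+ n - z ^+ n - h * (n%:R * z ^+ n.-1))
   <= x * (cabs h ^+ 2 * (n%:R ^+ 2 * x ^+ n)).
  by apply: ler_pM; rewrite ?cabs_ge0 //; apply: le_trans (cabsD _ _) zx.
have h2 : cabs z ^+ n.-1 <= x ^+ n.+1.
  apply: (@le_trans _ _ (x ^+ n.-1)); first by apply: lerXn2r; rewrite ?nnegrE ?cabs_ge0.
  by apply: ler_weXn2l => //; case: (n) => // m; rewrite leqW.
apply: le_trans (lerD h1 (_ : _ <= cabs h ^+ 2 * (n%:R * x ^+ n.+1))) _.
  by rewrite ler_wpM2l ?sqr_ge0 // ler_wpM2l.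
rewrite -[n.+1%:R]natr1 [x ^+ n.+1]exprS.
rewrite (_ : _ + _ = cabs h ^+ 2 * ((n%:R ^+ 2 + n%:R) * (x * x ^+ n))); last by ring.
rewrite ler_wpM2l ?sqr_ge0 // ler_wpM2r ?mulr_ge0 ?exprn_ge0 //.
have : 0 <= n%:R :> R by exact: ler0n.
nra.
Qed.

(** Summing [monomial_taylor] over the terms gives a second order expansion with a
    constant that depends on [z] only. This form of differentiability is the one
    used below: it yields complex derivatives, real partial derivatives and
    continuity alike. *)
Lemma gap_taylor c n (z : C) : entire c n ->
  exists2 M : R, 0 <= M & forall h : C, cabs h <= 1 ->
    cabs (gap c n (z + h) - gap c n z - h * gap (dcoef c n) (dexp n) z) <= M * cabs h ^+ 2.
Proof.
move=> ent; have [c0 cc] := ent; have [_ cd] := entire_deriv ent.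
set x := cabs z + 1.
have z0 := cabs_ge0 z.
have x0 : 0 <= x by rewrite /x; lra.
have x1 : 1 <= x by rewrite /x; lra.
have x4 : 0 <= 4 * x by lra.
set b := fun j => c j * (4 * x) ^+ n j.
have b0 j : 0 <= b j by rewrite /b mulr_ge0 // exprn_ge0.
(* b_j majorizes the constants of monomial_taylor, as n^2 x^n <= (4 x)^n. *)
exists (limn (series b)).
  by apply: le_trans (series_le_lim 0 b0 (cc _ x4)); rewrite big_nil.
move=> h h1.
have zhx : cabs z + cabs h <= x by rewrite /x lerD2l.
have zh : cabs (z + h) <= x by apply: le_trans (cabsD _ _) zhx.
have zx : cabs z <= x by have := cabs_ge0 h; lra.
have e1 : gap c n (z + h) - gap c n z - h * gap (dcoef c n) (dexp n) z =
  csum (fun j => ((c j)%:C * (z + h) ^+ n j + (-1) * ((c j)%:C * z ^+ n j))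
     + (- h) * ((dcoef c n j)%:C * z ^+ dexp n j)).
  rewrite (@csum_lin _ _ (fun j => c j * x ^+ n j + c j * x ^+ n j)
     (fun j => dcoef c n j * x ^+ dexp n j)).
  - rewrite (@csum_lin _ _ (fun j => c j * x ^+ n j) (fun j => c j * x ^+ n j)) ?mulN1r ?mulNr //.
    + by move=> j; exact: cabs_term.
    + exact: cc.
    + by move=> j; exact: cabs_term.
    + exact: cc.
  - move=> j; apply: le_trans (cabsD _ _) _; apply: lerD; first exact: cabs_term.
    by rewrite mulN1r cabsN; exact: cabs_term.
  - rewrite (_ : series _ = series (fun j => c j * x ^+ n j) + series (fun j => c j * x ^+ n j)).
      by apply: is_cvgD; exact: cc.
    by apply/funext => k; rewrite /series /= fctE /= big_split.
  - by move=> j; apply: (@cabs_term (dcoef c n) (dexp n)) => //; rewrite mulr_ge0 // ler0n.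
  - exact: cd.
rewrite {}e1; set a := fun j => _.
have c1 : cvgn (series (fun j => cabs h ^+ 2 * b j)).
  rewrite (_ : series _ = (fun k => cabs h ^+ 2 * series b k)).
    by apply: is_cvgM; [exact: is_cvg_cst | exact: cc].
  by apply/funext => k; rewrite /series /= mulr_sumr.
have a1 j : cabs (a j) <= cabs h ^+ 2 * b j.
  rewrite /a /dcoef [(_ * _)%:C]rmorphM /= -[(_%:R)%:C]natCE.
  rewrite (_ : _ + _ = (c j)%:C * ((z + h) ^+ n j - z ^+ n j - h * ((n j)%:R * z ^+ (n j).-1))).
    rewrite cabsM cabs_real ger0_norm // /b [leRHS]mulrCA ler_wpM2l //.
    apply: le_trans (monomial_taylor _ x1 zhx) _.
    rewrite ler_wpM2l ?sqr_ge0 // exprMn ler_wpM2r ?exprn_ge0 //.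
    have n2 : (n j)%:R <= 2 ^+ n j :> R by rewrite -natrX ler_nat ltnW // ltn_2X.
    have -> : (4 : R) = 2 ^+ 2 by rewrite expr2 -natrM.
    by rewrite exprAC; apply: lerXn2r; rewrite ?nnegrE ?exprn_ge0.
  rewrite /dexp; ring.
apply: le_trans (cabs_csum_le a1 c1) _.
have -> : series (fun j => cabs h ^+ 2 * b j) = (fun k => cabs h ^+ 2 * series b k).
  by apply/funext => k; rewrite /series /= mulr_sumr.
rewrite limM; [|exact: is_cvg_cst | exact: cc].
by rewrite lim_cst // mulrC.
Qed.
End PowerSeries.

(** * The two lacunary series *)

Section Lacunary.
Context {R : realType}.
Local Notation C := (Cplx R).

Definition rho : R := 16 ^+ 2.
Lemma rho_gt0 : 0 < rho. Proof. by rewrite exprn_gt0. Qed.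
Lemma rho_ge1 : 1 <= rho. Proof. by rewrite exprn_ege1 // ler1n. Qed.
Lemma rho_exp m : rho ^+ m = 16 ^+ (2 * m). Proof. by rewrite exprM. Qed.
Local Opaque rho.
Lemma rhoX_gt0 m : 0 < rho ^+ m. Proof. by rewrite exprn_gt0 // rho_gt0. Qed.
Lemma rhoX_ge0 m : 0 <= rho ^+ m. Proof. exact/ltW/rhoX_gt0. Qed.
Lemma rhoX_neq0 m : rho ^+ m != 0. Proof. exact/lt0r_neq0/rhoX_gt0. Qed.

(** The coefficient of (z / rho^j)^(4^j), kept only for [j] of parity [b]. *)
Definition lac_coef (b : bool) (j : nat) : R :=
  if odd j == b then (rho ^+ (j * 4 ^ j))^-1 else 0.
Definition lac_exp (j : nat) : nat := (4 ^ j)%N.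
Definition rad (k : nat) : R := rho ^+ k.+1.
Definition lac_sum (b : bool) : C -> C := gap (lac_coef b) lac_exp.
Definition lac_deriv (b : bool) : C -> C := gap (dcoef (lac_coef b) lac_exp) (dexp lac_exp).

Lemma lac_coef_ge0 b j : 0 <= lac_coef b j.
Proof. by rewrite /lac_coef; case: ifP => // _; rewrite invr_ge0 rhoX_ge0. Qed.

Lemma lac_coef_le b j : lac_coef b j <= (rho ^+ (j * 4 ^ j))^-1.
Proof. by rewrite /lac_coef; case: ifP => // _; rewrite invr_ge0 rhoX_ge0. Qed.

Lemma rad_gt0 k : 0 < rad k. Proof. exact: rhoX_gt0. Qed.

(** The supremum of |z c_j' z^(4^j - 1)| over the disc of radius [rad k], where
    c_j' is the coefficient of the derivative. It is computed for all [j]; the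
    parity only decides which of these terms are present. *)
Definition term_size (k j : nat) : R :=
  (rho ^+ (j * 4 ^ j))^-1 * (4 ^ j)%:R * rad k ^+ (4 ^ j).

Lemma term_size_diag k : term_size k k = (4 ^ k)%:R * rho ^+ (4 ^ k).
Proof.
rewrite /term_size /rad -exprM mulSn exprD; field.
exact: rhoX_neq0.
Qed.

Lemma expn_half k j : (j < k)%N -> (2 * ((k.+1 - j) * 4 ^ j) <= 4 ^ k)%N.
Proof.
move=> jk; rewrite -(subnK (ltnW jk)) addnC expnD mulnA [leqRHS]mulnC leq_mul2r.
apply/orP; right; rewrite -addnS addKn.
have : (0 < k - j)%N by rewrite subn_gt0.
elim: (k - j)%N => // -[|m] IH _ //; have := IH isT; rewrite [(4 ^ m.+2)%N]expnS; lia.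
Qed.

(** Below the diagonal the exponent (k + 1 - j) 4^j of rho is at most half of
    4^k, and the square root of rho is 16. *)
Lemma term_size_lt k j : (j < k)%N -> term_size k j <= 8 ^+ k.+1 * 16 ^+ (4 ^ k) / 2 ^+ j.
Proof.
move=> jk.
have -> : term_size k j = (4 ^ j)%:R * 16 ^+ (2 * ((k.+1 - j) * 4 ^ j)).
  rewrite -rho_exp /term_size /rad -exprM.
  have e : (k.+1 * 4 ^ j = j * 4 ^ j + (k.+1 - j) * 4 ^ j)%N.
    by rewrite -mulnDl subnKC // ltnW // ltnW.
  by rewrite e exprD mulrAC mulrA mulVf ?mul1r ?rhoX_neq0 // mulrC.
rewrite ler_pdivlMr ?exprn_gt0 // mulrAC -natrX -natrM -expnMn.
apply: ler_pM; rewrite ?ler0n ?exprn_ge0 //.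
  by rewrite -natrX ler_nat leq_exp2l // ltnW // ltnW.
by apply: ler_weXn2l; [rewrite ler1n | exact: expn_half].
Qed.

Lemma mulrho_le (m : nat) : m%:R / rho ^+ m <= (2 ^+ m)^-1 :> R.
Proof.
rewrite ler_pdivrMr ?rhoX_gt0 // mulrC -ler_pdivrMr ?invr_gt0 ?exprn_gt0 // invrK.
rewrite rho_exp -!natrX -natrM ler_nat.
apply: leq_trans (_ : 2 ^ m * 2 ^ m <= _)%N; first by rewrite leq_mul2r ltnW ?orbT // ltn_2X.
rewrite -expnMn; apply: leq_trans (_ : 16 ^ m <= _)%N.
  by case: m => // m; rewrite leq_exp2r.
by rewrite leq_exp2l // leq_pmull.
Qed.

(** Above the diagonal [rad k] is at most rho^j: for j = k + 1 the powers of rho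
    cancel and only the factor 4^j remains, and beyond that the term decays like
    4^j / rho^(4^j). *)
Lemma term_size_gt k j : (k < j)%N -> term_size k j <= 8 ^+ k.+1 * 16 ^+ (4 ^ k) / 2 ^+ j.
Proof.
rewrite leq_eqVlt => /orP[/eqP <-|kj].
  rewrite /term_size /rad -exprM mulrAC mulVf ?mul1r ?rhoX_neq0 //.
  rewrite ler_pdivlMr ?exprn_gt0 // -natrX -natrM -expnMn natrX ler_peMr ?exprn_ge0 //.
  by rewrite exprn_ege1 // ler1n.
apply: (@le_trans _ _ ((4 ^ j)%:R / rho ^+ (4 ^ j))).
  rewrite /term_size /rad -exprM mulrC mulrA [leRHS]mulrC.
  rewrite ler_wpM2r ?ler0n // ler_pdivrMr ?rhoX_gt0 //.
  rewrite mulrC ler_pdivlMr ?rhoX_gt0 // -exprD.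
  by apply: ler_weXn2l; [exact: rho_ge1 | rewrite -mulSnr leq_mul2r kj orbT].
apply: le_trans (mulrho_le _) _.
apply: (@le_trans _ _ ((2 ^+ j)^-1)).
  rewrite lef_pV2 ?posrE ?exprn_gt0 //.
  by apply: ler_weXn2l; [rewrite ler1n | rewrite ltnW // ltn_expl].
rewrite ler_peMl ?invr_ge0 ?exprn_ge0 //.
by rewrite mulr_ege1 // exprn_ege1 // ler1n.
Qed.

Lemma term_size_off k j : j != k -> term_size k j <= 8 ^+ k.+1 * 16 ^+ (4 ^ k) / 2 ^+ j.
Proof. by rewrite neq_ltn => /orP[/term_size_lt|/term_size_gt]. Qed.

Lemma term_size_all k j : term_size k j <= 8 ^+ k.+1 * rho ^+ (4 ^ k) / 2 ^+ j.
Proof.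
have [->|/term_size_off h] := eqVneq j k.
  rewrite term_size_diag ler_pdivlMr ?exprn_gt0 // mulrAC ler_wpM2r ?rhoX_ge0 //.
  by rewrite -natrX -natrM -expnMn -natrX ler_nat leq_exp2l.
apply: le_trans h _; rewrite ler_wpM2r ?invr_ge0 ?exprn_ge0 // ler_wpM2l ?exprn_ge0 //.
rewrite rho_exp; apply: ler_weXn2l; first by rewrite ler1n.
by rewrite leq_pmull.
Qed.

Lemma csum_near_term (a : nat -> C) (b : nat -> R) (k : nat) :
  (forall j, cabs (a j) <= b j) -> cvgn (series b) ->
  forall B, (forall n, \sum_(0 <= j < n | j != k) cabs (a j) <= B) ->
  cabs (csum a - a k) <= B.
Proof.
move=> ab cb B hB.
have h : (fun n => \sum_(0 <= j < n + k.+1) a j - a k) @ \oo --> csum a - a k.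
  apply: cvgB; last exact: cvg_cst.
  have := csum_cvg ab cb; rewrite -(cvg_shiftn k.+1); exact.
apply: (cabs_lim_le h) => n.
rewrite (bigD1_seq k) /= ?mem_index_iota ?iota_uniq ?addnS ?ltnS ?leq_addl //.
rewrite addrAC subrr add0r; apply: le_trans (hB (n + k).+1).
elim/big_rec2: _ => [|i x y _ h1]; first by rewrite cabs0.
by apply: le_trans (cabsD _ _) _; rewrite lerD2l.
Qed.

(** The j-th term, for j other than k, has size at most [off_size k / 2^j]; together
    these terms have size at most twice [off_size k]. *)
Definition off_size (k : nat) : R := 8 ^+ k.+1 * 16 ^+ (4 ^ k).

Lemma geo_cvg (c : R) : cvgn (series (fun j => c / 2 ^+ j)).
Proof.
rewrite (_ : (fun j => _) = geometric c 2^-1); last first.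
  by apply/funext => j; rewrite /= exprVn.
by apply: is_cvg_geometric_series; rewrite ger0_norm ?invr_ge0 // invf_lt1 // ltr1n.
Qed.

Lemma geo_lim (c : R) : limn (series (fun j => c / 2 ^+ j)) = 2 * c.
Proof.
rewrite (_ : (fun j => _) = geometric c 2^-1); last first.
  by apply/funext => j; rewrite /= exprVn.
have h : `|2^-1 : R| < 1 by rewrite ger0_norm ?invr_ge0 // invf_lt1 // ltr1n.
rewrite (cvg_lim _ (cvg_geometric_series h)) //; by field.
Qed.

Lemma lac_coef_term_le b k j (x : R) : 0 <= x <= rad k ->
  lac_coef b j * (4 ^ j)%:R * x ^+ (4 ^ j) <= term_size k j.
Proof.
move=> /andP[x0 xr]; rewrite /term_size; apply: ler_pM.
- by rewrite mulr_ge0 // ?ler0n // lac_coef_ge0.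
- exact: exprn_ge0.
- by rewrite ler_wpM2r ?ler0n // lac_coef_le.
- by apply: lerXn2r; rewrite ?nnegrE // (le_trans x0).
Qed.

Lemma rad_large (x : R) : exists k, x <= rad k.
Proof.
exists (Num.truncn x); apply: (@le_trans _ _ ((Num.truncn x).+1%:R)).
  exact/ltW/truncnS_gt.
apply: (@le_trans _ _ (2 ^+ (Num.truncn x).+1)).
  by rewrite -natrX ler_nat ltnW // ltn_2X.
rewrite /rad rho_exp exprM; apply: lerXn2r; rewrite ?nnegrE ?exprn_ge0 //.
by rewrite expr2 -natrM ler_nat.
Qed.

Lemma lac_entire b : entire (lac_coef b) lac_exp.
Proof.
split=> [j|x x0]; first exact: lac_coef_ge0.
have [k xk] := rad_large x.
apply: (@series_le_cvg _ _ (fun j => 8 ^+ k.+1 * rho ^+ (4 ^ k) / 2 ^+ j)).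
- by move=> j; rewrite mulr_ge0 ?lac_coef_ge0 ?exprn_ge0.
- by move=> j; rewrite !mulr_ge0 ?invr_ge0 ?rhoX_ge0 ?exprn_ge0.
- move=> j; apply: le_trans (term_size_all k j).
  apply: le_trans (@lac_coef_term_le b k j x _); last by rewrite x0.
  rewrite ler_wpM2r ?exprn_ge0 // ler_peMr ?lac_coef_ge0 // ler1n expn_gt0 //.
- exact: geo_cvg.
Qed.

Lemma lac_deriv_term b k j (z : C) : cabs z <= rad k ->
  rad k * cabs ((dcoef (lac_coef b) lac_exp j)%:C * z ^+ dexp lac_exp j) <= term_size k j.
Proof.
move=> zr; have z0 := cabs_ge0 z.
have d0 : 0 <= dcoef (lac_coef b) lac_exp j by rewrite mulr_ge0 ?lac_coef_ge0 ?ler0n.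
have r0 := rad_gt0 k.
apply: le_trans (_ : rad k * (dcoef (lac_coef b) lac_exp j * rad k ^+ dexp lac_exp j) <= _).
  by rewrite ler_pM2l //; exact: (@cabs_term _ (dcoef (lac_coef b) lac_exp)).
apply: le_trans (@lac_coef_term_le b k j (rad k) _); last by rewrite lexx ltW.
rewrite mulrCA -exprS /dexp prednK ?expn_gt0 // /dcoef.
Qed.

(** On the disc of radius [rad k] the derivative differs from its k-th term by no
    more than the sum of the sizes of the other terms. *)
Lemma lac_deriv_near b k (z : C) : cabs z <= rad k ->
  rad k * cabs (lac_deriv b z - (dcoef (lac_coef b) lac_exp k)%:C * z ^+ dexp lac_exp k) <= 2 * off_size k.
Proof.
move=> zr; have r0 := rad_gt0 k; have z0 := cabs_ge0 z.
have [c0 cc] := entire_deriv (lac_entire b).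
rewrite mulrC -ler_pdivlMr //.
apply: (@csum_near_term _ (fun j => dcoef (lac_coef b) lac_exp j * cabs z ^+ dexp lac_exp j)).
- by move=> j; exact: (@cabs_term _ (dcoef (lac_coef b) lac_exp)).
- exact: cc.
move=> n; rewrite ler_pdivlMr // mulrC mulr_sumr.
apply: (@le_trans _ _ (\sum_(0 <= j < n | j != k) off_size k / 2 ^+ j)).
  apply: ler_sum => j jk; apply: le_trans (lac_deriv_term _ _ zr) _; exact: term_size_off.
rewrite -geo_lim; have g0 : forall j, 0 <= off_size k / 2 ^+ j.
  by move=> j; rewrite !mulr_ge0 ?invr_ge0 ?exprn_ge0.
apply: (le_trans _ (series_le_lim n g0 (@geo_cvg _))).
by rewrite [leRHS](bigID (fun j => j != k)) /= lerDl sumr_ge0.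
Qed.

Lemma e16 : (16 : R) = 2 ^+ 4. Proof. by rewrite -natrX. Qed.
Lemma e8 : (8 : R) = 2 ^+ 3. Proof. by rewrite -natrX. Qed.

Lemma off_size_le k : (0 < k)%N -> 2 * off_size k <= 2 * (2 ^+ (4 ^ k)) ^+ 6.
Proof.
move=> k0; rewrite ler_pM2l // /off_size e8 e16 -(exprM 2 3) -(exprM 2 4) -(exprM 2 _ 6) -exprD.
apply: ler_weXn2l; first by rewrite ler1n.
case: k k0 => // k _; elim: k => // k IH.
rewrite [(4 ^ k.+2)%N]expnS; lia.
Qed.

(** For this parity the k-th term is absent. *)
Lemma lac_deriv_small k (z : C) : (0 < k)%N -> cabs z <= rad k ->
  rad k * cabs (lac_deriv (~~ odd k) z) <= 2 * (2 ^+ (4 ^ k)) ^+ 6.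
Proof.
move=> k0 zr; apply: le_trans (off_size_le k0).
have := @lac_deriv_near (~~ odd k) k z zr.
have -> : dcoef (lac_coef (~~ odd k)) lac_exp k = 0.
  by rewrite /dcoef /lac_coef; case: (odd k) => /=; rewrite mul0r.
by rewrite mul0r subr0.
Qed.

Lemma lac_coef_diag k : lac_coef (odd k) k = (rho ^+ (k * 4 ^ k))^-1.
Proof. by rewrite /lac_coef eqxx. Qed.

(** The k-th term has size 4^k rho^(4^k) = 4^k u^8 with u = 2^(4^k), and 4^k is
    absorbed by half a factor u. *)
Lemma lac_deriv_large k (z : C) : (0 < k)%N -> cabs z <= rad k ->
  rad k * cabs (lac_deriv (odd k) z) <= (2 ^+ (4 ^ k)) ^+ 9.
Proof.
move=> k0 zr; have h1 := le_trans (@lac_deriv_near (odd k) k z zr) (off_size_le k0).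
have h2 := @lac_deriv_term (odd k) k k z zr.
set t : C := (dcoef _ _ _)%:C * _ in h1 h2.
have h3 : rad k * cabs (lac_deriv (odd k) z) <= rad k * cabs (lac_deriv (odd k) z - t) + rad k * cabs t.
  rewrite -mulrDr ler_pM2l ?rad_gt0 //; apply: le_trans (cabsD _ _); by rewrite subrK.
rewrite term_size_diag rho_exp in h2.
set u := 2 ^+ (4 ^ k) in h1 *.
have u2 : 2 <= u.
  by rewrite -[X in X <= _]expr1; apply: ler_weXn2l; rewrite ?ler1n // expn_gt0.
have e : (16 : R) ^+ (2 * 4 ^ k) = u ^+ 8.
  rewrite /u e16 -(exprM 2 4) -(exprM 2 _ 8).
  by congr (_ ^+ _); lia.
have n2 : (4 ^ k)%:R * 2 <= u.
  rewrite /u -[(4 ^ k)%N]prednK ?expn_gt0 // exprS mulrC ler_pM2l // -natrX ler_nat.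
  exact: ltn_2X.
rewrite {}e in h2; apply: le_trans h3 _.
have u6 : 0 <= u ^+ 6 by apply: exprn_ge0; lra.
have u8 : 0 <= u ^+ 8 by apply: exprn_ge0; lra.
have -> : u ^+ 9 = u / 2 * u ^+ 8 + u ^+ 6 * (u ^+ 3 / 2).
  by field.
have u3 : 4 <= u ^+ 3.
  by rewrite !exprS expr0; nra.
have h4 : (4 ^ k)%:R * u ^+ 8 <= u / 2 * u ^+ 8 by apply: ler_wpM2r => //; lra.
have h5 : u ^+ 6 * 2 <= u ^+ 6 * (u ^+ 3 / 2) by apply: ler_wpM2l => //; lra.
lra.
Qed.

(** At radius at least [rad k / 2] the k-th term is still 4^k rho^(4^k) / 2^(4^k),
    that is 4^k u^7, which dominates the 2 u^6 of the other terms. *)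
Lemma lac_deriv_lower k (z : C) : (0 < k)%N -> cabs z <= rad k -> rad k / 2 <= cabs z ->
  (2 ^+ (4 ^ k)) ^+ 7 <= rad k * cabs (lac_deriv (odd k) z).
Proof.
move=> k0 zr rz; have h1 := le_trans (@lac_deriv_near (odd k) k z zr) (off_size_le k0).
set t : C := (dcoef _ _ _)%:C * _ in h1.
have r0 := rad_gt0 k.
have h3 : rad k * cabs t <= rad k * cabs (lac_deriv (odd k) z - t) + rad k * cabs (lac_deriv (odd k) z).
  rewrite -mulrDr ler_pM2l // cabsBC; apply: le_trans (cabsD _ _); by rewrite subrK.
have h2 : 4 * (2 ^+ (4 ^ k)) ^+ 7 <= rad k * cabs t.
  have d0 : 0 <= dcoef (lac_coef (odd k)) lac_exp k by rewrite mulr_ge0 ?lac_coef_ge0 ?ler0n.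
  rewrite /t cabsM cabs_real ger0_norm // cabsX /dexp (mulrC 4).
  apply: (@le_trans _ _ (dcoef (lac_coef (odd k)) lac_exp k * cabs z ^+ lac_exp k)); last first.
    have gk : lac_exp k = (lac_exp k).-1.+1 by rewrite prednK // expn_gt0.
    by rewrite {1}gk exprS mulrCA ler_wpM2r // mulr_ge0 // exprn_ge0 // cabs_ge0.
  apply: (@le_trans _ _ (dcoef (lac_coef (odd k)) lac_exp k * (rad k / 2) ^+ lac_exp k)); last first.
    rewrite ler_wpM2l //; apply: lerXn2r; rewrite ?nnegrE ?cabs_ge0 //.
    by rewrite divr_ge0 // ltW.
  have -> : dcoef (lac_coef (odd k)) lac_exp k * (rad k / 2) ^+ lac_exp k =
      (4 ^ k)%:R * (rho ^+ (4 ^ k) / 2 ^+ (4 ^ k)).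
    rewrite /dcoef lac_coef_diag expr_div_n /lac_exp /rad -(exprM rho) (mulSn k) (exprD rho).
    have r1 := rhoX_neq0 (k * 4 ^ k); set r := rho ^+ (k * _) in r1 *.
    set x := rho ^+ _; set y := 2 ^+ _; set w := (4 ^ k)%:R.
    rewrite (_ : _ * _ = r^-1 * r * (w * (x / y))); last by ring.
    by rewrite mulVf // mul1r.
  rewrite mulrC; apply: ler_pM; rewrite ?ler_nat ?exprn_ge0 //.
    by rewrite -[X in (X <= _)%N](expn1 4) leq_exp2l.
  rewrite ler_pdivlMr ?exprn_gt0 // rho_exp e16 -(exprM 2 4) -(exprM 2 _ 7) -exprD.
  by apply: ler_weXn2l; rewrite ?ler1n //; lia.
set u := 2 ^+ (4 ^ k) in h1 h2 *.
have u1 : 1 <= u by rewrite exprn_ege1 // ler1n.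
have u6 : u ^+ 6 <= u ^+ 7 by apply: ler_weXn2l.
have u7 : 0 <= u ^+ 7 by apply: exprn_ge0; lra.
lra.
Qed.
End Lacunary.

(** * Polydiscs as neighbourhoods in C^2 *)

Section RowNorm.
Context {R : realType}.
Local Notation C := (Cplx R).
Local Notation V := 'rV[C]_2.

Lemma rV_norm_le m n (v : 'M[C]_(m, n)) (e : R) : 0 <= e ->
  (forall i j, cabs (v i j) <= e) -> `|v| <= e%:C.
Proof.
move=> e0 h; have ec : 0 <= (e%:C : C) by rewrite -[0]/((0 : R)%:C) leC_real.
rewrite /Num.norm /= mx_normE.
elim/big_ind : _ => //= [x y hx hy|i _].
  by rewrite /Order.max; case: ifP.
by rewrite normCE leC_real.
Qed.

(** A ball for the sup norm with a real radius. *)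
Definition polydisc (w : V) (e : R) : set V :=
  [set v | forall i j, cabs (w i j - v i j) < e].

Lemma nbhs_polydisc (w : V) (A : set V) :
  nbhs w A <-> exists2 e : R, 0 < e & polydisc w e `<=` A.
Proof.
split=> [/nbhs_ballP [e /= e0 h]|[e e0 h]].
  have [d d0 de] := gt0_real e0; exists d => // v vd; apply: h.
  by split=> // i j; rewrite /ball /= de normCE ltC_real; exact: vd.
apply/nbhs_ballP; exists e%:C => /=; first by rewrite -[0]/((0 : R)%:C) ltC_real.
move=> v [_ vd]; apply: h => i j; have := vd i j.
by rewrite /ball /= normCE ltC_real.
Qed.

Lemma cvgV (T : Type) (F : set_system T) {FF : Filter F} (f : T -> V) (l : V) :
  (f @ F --> l) <-> forall i j, (fun t => f t i j) @ F --> l i j.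
Proof.
split=> [fl i j|h].
  apply/cvgC0/cvgrPdist_lt => e e0.
  have : nbhs l (polydisc l e) by apply/nbhs_polydisc; exists e.
  move=> /fl; rewrite /fmap /nbhs /=; apply: filterS => t /= ht.
  by rewrite sub0r normrN ger0_norm ?cabs_ge0 // cabsBC.
move=> A /nbhs_polydisc [e e0 eA].
rewrite /fmap /nbhs /=; apply: (filterS (P := [set t | forall i j, cabs (l i j - f t i j) < e])).
  by move=> t ht; apply: eA.
apply: filter_forall => i; apply: filter_forall => j.
have /cvgC0/cvgrPdist_lt := h i j => /(_ _ e0); apply: filterS => t.
by rewrite sub0r normrN ger0_norm ?cabs_ge0 // cabsBC.
Qed.

Lemma polydisc_center (w : V) (e : R) : 0 < e -> polydisc w e w.
Proof. by move=> e0 i j; rewrite subrr cabs0. Qed.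

Lemma polydisc_open (w : V) (e : R) : open (polydisc w e).
Proof.
rewrite openE => v hv; apply/nbhs_polydisc.
have [d d0 hd] : exists2 d : R, 0 < d & forall i j, cabs (w i j - v i j) + d <= e.
  exists (\big[Num.min/1]_(p : 'I_1 * 'I_2) (e - cabs (w p.1 p.2 - v p.1 p.2))).
    by elim/big_ind : _ => // [x y x0 y0|p _]; [rewrite lt_min x0 | rewrite subr_gt0; exact: hv].
  move=> i j; rewrite addrC -lerBrDr.
  exact: (@bigmin_le _ _ _ _ (i, j)).
exists d => // u hu i j; apply: lt_le_trans (hd i j).
rewrite -{1}(subrK (v i j) (w i j)) -addrA; apply: le_lt_trans (cabsD _ _) _.
by rewrite ltrD2l.
Qed.

(** The eps-delta form of differentiability, together with the value of the
    differential. *)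
Lemma is_diff_by_estimate (U W : normedModType C) (f : U -> W) (df : {linear U -> W}) (x : U) :
  continuous df ->
  (forall eps : C, 0 < eps -> \forall h \near (0 : U), `|f (h + x) - f x - df h| <= eps * `|h|) ->
  differentiable f x /\ 'd f x = df :> (U -> W).
Proof.
move=> cdf est.
have e : f \o shift x = cst (f x) + df +o_ (0 : U) id.
  apply/eqaddoP => eps e0; apply: filterS (est _ e0) => h /=.
  by rewrite /cst opprD addrA.
have ed := diff_unique cdf e.
split=> //; apply/diff_locallyP; split; first by rewrite ed.
by rewrite ed.
Qed.
End RowNorm.

(** * The quotient of C^2 by the Gaussian lattice *)

Section Torus.
Context {R : realType}.
Local Notation C := (Cplx R).
Local Notation V := 'rV[C]_2.

Definition gaussian_floor (z : C) : C := (Num.floor (Re z))%:~R +i* (Num.floor (Im z))%:~R.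
Definition gaussian (z : C) : Prop := exists m n : int, z = (m%:~R : R) +i* (n%:~R : R).

Lemma gaussian_floor_gaussian z : gaussian (gaussian_floor z).
Proof. by exists (Num.floor (Re z)), (Num.floor (Im z)). Qed.

Lemma gaussianD z w : gaussian z -> gaussian w -> gaussian (z + w).
Proof.
by move=> [m [n ->]] [p [q ->]]; exists (m + p), (n + q); rewrite !intrD.
Qed.
Lemma gaussianN z : gaussian z -> gaussian (- z).
Proof. by move=> [m [n ->]]; exists (- m), (- n); rewrite !mulrNz. Qed.

Lemma floorDint (x : R) (m : int) : Num.floor (x + m%:~R) = Num.floor x + m.
Proof. by rewrite floorDrz ?intrKfloor // intr_int. Qed.

Lemma gaussian_floorD z l : gaussian l -> gaussian_floor (z + l) = gaussian_floor z + l.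
Proof.
move=> [m [n ->]]; rewrite /gaussian_floor ReD ImD /= !floorDint !intrD.
by apply: C_ext; rewrite ?ReD ?ImD.
Qed.

Definition lattice (l : V) : Prop := forall i j, gaussian (l i j).

Lemma latticeD l m : lattice l -> lattice m -> lattice (l + m).
Proof. by move=> hl hm i j; rewrite mxE; exact: gaussianD. Qed.
Lemma latticeN l : lattice l -> lattice (- l).
Proof. by move=> hl i j; rewrite mxE; exact: gaussianN. Qed.
Lemma latticeB l m : lattice l -> lattice m -> lattice (l - m).
Proof. by move=> hl hm; apply: latticeD => //; exact: latticeN. Qed.
Lemma lattice0 : lattice 0.
Proof. by move=> i j; rewrite mxE; exists 0, 0. Qed.

Definition vec_floor (w : V) : V := map_mx gaussian_floor w.
Definition vec_frac (w : V) : V := w - vec_floor w.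

Lemma vec_floor_lattice w : lattice (vec_floor w).
Proof. by move=> i j; rewrite mxE; exact: gaussian_floor_gaussian. Qed.
Lemma vec_floorD w l : lattice l -> vec_floor (w + l) = vec_floor w + l.
Proof. by move=> hl; apply/matrixP => i j; rewrite !mxE gaussian_floorD. Qed.
Lemma vec_fracD w l : lattice l -> vec_frac (w + l) = vec_frac w.
Proof. by move=> hl; rewrite /vec_frac vec_floorD // opprD addrACA subrr addr0. Qed.
Lemma vec_frac_idem w : vec_frac (vec_frac w) == vec_frac w.
Proof. by rewrite {2}/vec_frac vec_fracD //; apply: latticeN; exact: vec_floor_lattice. Qed.
Lemma vec_frac_eq w v : vec_frac w = vec_frac v -> lattice (w - v).
Proof.
move=> /eqP; rewrite /vec_frac subr_eq addrAC -subr_eq opprK => h.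
have -> : w - v = vec_floor w - vec_floor v.
  by rewrite -{1}[w](addrK (vec_floor v)) (eqP h) -[_ + vec_floor w - _]addrA [LHS]addrC addKr.
by apply: latticeB; exact: vec_floor_lattice.
Qed.

(** A point of the torus is its representative in the fundamental box. This makes
    the quotient a choice type without quotienting, while the topology below is the
    quotient topology and not the one induced by C^2. *)
Record torus := Torus { torus_rep : V; _ : vec_frac torus_rep == torus_rep }.
HB.instance Definition _ := [isSub for torus_rep].
HB.instance Definition _ := [Choice of torus by <:].

Definition tproj (w : V) : torus := Torus (vec_frac_idem w).

Lemma torus_repK (x : torus) : tproj (torus_rep x) = x.
Proof. by apply: val_inj => /=; case: x => w /= /eqP. Qed.
Lemma tprojD w l : lattice l -> tproj (w + l) = tproj w.
Proof. by move=> hl; apply: val_inj => /=; rewrite vec_fracD. Qed.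
Lemma tproj_eq w v : tproj w = tproj v -> lattice (w - v).
Proof. by move=> /(congr1 torus_rep) /= /vec_frac_eq. Qed.
Lemma tproj_rep w : exists2 l, lattice l & torus_rep (tproj w) = w + l.
Proof. by exists (- vec_floor w) => //; apply: latticeN; exact: vec_floor_lattice. Qed.

Definition topen (U : set torus) : Prop := open (tproj @^-1` U).
Lemma topenT : topen setT.
Proof. by rewrite /topen preimage_setT; exact: openT. Qed.
Lemma topenI : setI_closed topen.
Proof. by move=> A B; exact: openI. Qed.
Lemma topen_bigU (I : Type) (f : I -> set torus) :
  (forall i, topen (f i)) -> topen (\bigcup_i f i).
Proof. by move=> h; rewrite /topen preimage_bigcup; apply: bigcup_open => i _; exact: h. Qed.
HB.instance Definition _ := isOpenTopological.Build torus topenT topenI topen_bigU.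

Lemma tproj_continuous : continuous tproj.
Proof. by apply/continuousP => A. Qed.

(** The projection is open: the saturation of an open set is a union of
    translates, so neighbourhoods on the torus can be computed upstairs. *)
Lemma nbhs_tproj (w : V) (A : set torus) : nbhs (tproj w) A <-> nbhs w (tproj @^-1` A).
Proof.
split; first exact: tproj_continuous.
move=> h; pose U := interior (tproj @^-1` A).
have Uper v l : lattice l -> U v -> U (v + l).
  move=> hl /nbhs_polydisc [e e0 he]; apply/nbhs_polydisc; exists e => // u hu.
  rewrite /= -(tprojD u (latticeN hl)); apply: he => i j.
  by have := hu i j; rewrite !mxE opprB addrA.
have tU : tproj @^-1` (tproj @` U) = U.
  rewrite eqEsubset; split=> v; last by move=> hv; exists v.
  move=> [u hu /esym/tproj_eq hl]; rewrite -(subrK u v) addrC; exact: Uper.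
rewrite nbhsE; exists (tproj @` U).
  split; last by exists w.
  by rewrite /open /= /topen tU; exact: open_interior.
by move=> _ [v hv <-]; exact: (interior_subset hv).
Qed.

Lemma not_int_dist (t : R) : (forall m : int, t != m%:~R) ->
  exists2 d : R, 0 < d & forall m : int, d <= `|t - m%:~R|.
Proof.
move=> ht; have /andP[h1 h2] := floor_itv t; set n := Num.floor t in h1 h2.
have h3 : n%:~R < t by rewrite lt_neqAle eq_sym ht.
exists (Num.min (t - n%:~R) ((n + 1)%:~R - t)); first by rewrite lt_min !subr_gt0 h3 h2.
move=> m; rewrite ge_min; have [mn|nm] := leP m n.
  apply/orP; left; rewrite ger0_norm ?subr_ge0.
    by rewrite lerD2l lerN2 ler_int.
  by apply: le_trans h1; rewrite ler_int.
apply/orP; right; rewrite distrC ger0_norm ?subr_ge0.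
  by rewrite lerD2r ler_int -ltzD1 ltrD2r.
by apply: ltW; apply: lt_le_trans h2 _; rewrite ler_int -ltzD1 ltrD2r.
Qed.

(** This separates two points of the torus: if the difference of representatives is
    at distance d from the lattice, the polydiscs of radius d / 2 around them have
    disjoint images. *)
Lemma not_lattice_dist (w : V) : ~ lattice w ->
  exists2 d : R, 0 < d & forall l, lattice l -> exists i j, d <= cabs (w i j - l i j).
Proof.
move=> /existsNP [i /existsNP [j hij]].
have [hr|/existsNP[m /negP hr]] := pselect (forall m : int, Re (w i j) != m%:~R).
  have [d d0 hd] := not_int_dist hr; exists d => // l hl; exists i, j.
  have [m [n ->]] := hl i j; apply: le_trans (hd m) _.
  by have := Re_le_cabs (w i j - (m%:~R +i* n%:~R)); rewrite ReB.
have [hi|/existsNP[n /negP hi]] := pselect (forall m : int, Im (w i j) != m%:~R).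
  have [d d0 hd] := not_int_dist hi; exists d => // l hl; exists i, j.
  have [p [n ->]] := hl i j; apply: le_trans (hd n) _.
  by have := Im_le_cabs (w i j - (p%:~R +i* n%:~R)); rewrite ImB.
exfalso; apply: hij; exists m, n; move: hr hi; rewrite !negbK => /eqP <- /eqP <-.
by case: (w i j).
Qed.

Lemma torus_hausdorff : hausdorff_space torus.
Proof.
rewrite open_hausdorff => x y xy.
have nl : ~ lattice (torus_rep x - torus_rep y).
  move=> hl; move: xy; rewrite -(torus_repK x) -(torus_repK y) -(subrK (torus_rep y) (torus_rep x)).
  by rewrite addrC tprojD ?eqxx.
have [d d0 hd] := not_lattice_dist nl.
have d2 : 0 < d / 2 by rewrite divr_gt0.
have opn (w : V) : open (tproj @` polydisc w (d / 2)).
  rewrite openE => _ [v hv <-]; apply/nbhs_tproj.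
  have := @polydisc_open R w (d / 2); rewrite openE => /(_ _ hv); apply: filterS => u hu.
  by exists u.
exists (tproj @` polydisc (torus_rep x) (d / 2), tproj @` polydisc (torus_rep y) (d / 2)).
  by split; rewrite inE /=; [exists (torus_rep x) | exists (torus_rep y)];
    (exact: polydisc_center || exact: torus_repK).
split => /=.
- exact: opn.
- exact: opn.
apply/eqP; rewrite -subset0 => z [[u hu <-] [v hv /tproj_eq hl]].
have [i [j]] := hd _ (latticeN hl); rewrite !mxE opprB.
have e : torus_rep x i j - torus_rep y i j - (u i j - v i j) = (torus_rep x i j - u i j) - (torus_rep y i j - v i j).
  by ring.
rewrite {}e leNgt => /negP; apply; apply: le_lt_trans (cabsD _ _) _; rewrite cabsN.
by have := hu i j; have := hv i j; lra.
Qed.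

Definition unit_square : set C := [set z | 0 <= Re z <= 1 /\ 0 <= Im z <= 1].
(** The closed unit box: it contains a representative of every point, and it is
    compact, hence so is the torus. *)
Definition unit_box : set V := [set w | forall j, unit_square (w ord0 j)].

Lemma square_compact (a b : R) : compact [set z : C | a <= Re z <= b /\ a <= Im z <= b].
Proof.
have -> : [set z : C | a <= Re z <= b /\ a <= Im z <= b] =
    (fun p : R * R => (p.1 +i* p.2 : C)) @` (`[a, b] `*` `[a, b]).
  rewrite eqEsubset; split=> z.
    by case: z => x y /= [h1 h2]; exists (x, y) => //=; split=> /=; rewrite in_itv.
  by move=> [[x y]] /= [h1 h2] <- /=; rewrite !in_itv /= in h1 h2.
apply: continuous_compact.
  by apply: continuous_subspaceT; exact: continuous_mkC.
by apply: compact_setX; exact: segment_compact.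
Qed.

Lemma unit_box_compact : compact unit_box.
Proof. by apply: (@rV_compact C 2 (fun=> unit_square)) => _; exact: square_compact. Qed.

Lemma vec_frac_unit_box w : unit_box (vec_frac w).
Proof.
move=> j; rewrite /unit_square /vec_frac !mxE /= ReB ImB /=.
have h (x : R) : 0 <= x - (Num.floor x)%:~R <= 1.
  have /andP[h1 h2] := floor_itv x; rewrite intrD in h2.
  by rewrite subr_ge0 h1 lerBlDl ltW.
by split; exact: h.
Qed.

Lemma torus_compact : compact [set: torus].
Proof.
have -> : [set: torus] = tproj @` unit_box.
  rewrite eqEsubset; split=> // x _; exists (vec_frac (torus_rep x)); first exact: vec_frac_unit_box.
  by rewrite /vec_frac tprojD ?torus_repK //; apply: latticeN; exact: vec_floor_lattice.
apply: continuous_compact; last exact: unit_box_compact.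
by apply: continuous_subspaceT; exact: tproj_continuous.
Qed.
End Torus.

(** * Charts of the torus *)

Section TorusManifold.
Context {R : realType}.
Local Notation C := (Cplx R).
Local Notation V := 'rV[C]_2.

Definition half_vec : V := const_mx (2^-1 +i* 2^-1).
(** The representative of [u] modulo the lattice that lies nearest to 0. *)
Definition centered (u : V) : V := u - vec_floor (u + half_vec).

Lemma centered_lattice u : exists2 l, lattice l & centered u = u + l.
Proof. by exists (- vec_floor (u + half_vec)) => //; apply: latticeN; exact: vec_floor_lattice. Qed.

Lemma centeredD (u l : V) : lattice l -> centered (u + l) = centered u.
Proof.
move=> hl; rewrite /centered (addrAC u l half_vec).
rewrite (vec_floorD (u + half_vec) hl).
 by rewrite opprD addrACA subrr addr0.
Qed.

Lemma centered_small (u : V) : (forall i j, cabs (u i j) < 1 / 2) -> centered u = u.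
Proof.
move=> h; rewrite /centered (_ : vec_floor _ = 0) ?subr0 //.
apply/matrixP => i j; rewrite !mxE /gaussian_floor ReD ImD /=.
have hu := h i j; have hr := Re_le_cabs (u i j); have hi := Im_le_cabs (u i j).
have h1 (x : R) : `|x| <= cabs (u i j) -> Num.floor (x + 2^-1) = 0.
  move=> hx; apply: floor_def; have := le_lt_trans hx hu.
  by rewrite ltr_norml => /andP[h1 h2]; rewrite add0r; apply/andP; split; lra.
by rewrite !h1.
Qed.

(** The chart centred at [c] sends a point to its representative nearest to [c];
    it is restricted to the points where that representative lies in the polydisc
    of radius 1/4, so that transition maps are locally translations. *)
Definition tchart (c : V) (x : torus) : V := c + centered (torus_rep x - c).
Definition tdom (c : V) : set torus := [set x | polydisc c (1 / 4) (tchart c x)].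

Lemma tchart_proj c w : tchart c (tproj w) = c + centered (w - c).
Proof.
rewrite /tchart; have [l hl ->] := tproj_rep w.
by rewrite (addrAC w l) (centeredD _ hl).
Qed.

Lemma tchartK c x : tproj (tchart c x) = x.
Proof.
rewrite /tchart; have [l hl ->] := centered_lattice (torus_rep x - c).
by rewrite (_ : _ + _ = torus_rep x + l) ?tprojD ?torus_repK // addrA (addrC c) subrK.
Qed.

Lemma tchart_in c w l : lattice l -> polydisc c (1 / 4) (w + l) -> tchart c (tproj w) = w + l.
Proof.
move=> hl hw; rewrite tchart_proj -(centeredD (w - c) hl) centered_small.
  by rewrite addrAC addrCA subrr addr0.
move=> i j; have := hw i j; rewrite !mxE cabsBC addrAC => h.
by apply: lt_trans h _; lra.
Qed.

Lemma tdom_proj c w : tdom c (tproj w) <-> exists2 l, lattice l & polydisc c (1 / 4) (w + l).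
Proof.
split=> [|[l hl h]]; last by rewrite /tdom /= (tchart_in hl).
rewrite /tdom /= tchart_proj; have [l hl e] := centered_lattice (w - c).
rewrite e => h; exists l => //; move: h; congr (polydisc _ _ _).
by rewrite addrAC addrCA subrr addr0.
Qed.

Lemma tchart_img c : tchart c @` tdom c = polydisc c (1 / 4).
Proof.
rewrite eqEsubset; split=> w; first by move=> [x hx <-].
move=> hw; have hw0 : polydisc c (1 / 4) (w + 0) by rewrite addr0.
exists (tproj w); last by rewrite (tchart_in lattice0) ?addr0.
by apply/tdom_proj; exists 0 => //; exact: lattice0.
Qed.

Lemma cvg_translation (w l : V) : (fun v : V => v + l) @ nbhs w --> w + l.
Proof.
move=> A /nbhs_polydisc [e e0 he]; apply/nbhs_polydisc; exists e => // v hv.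
apply: he => i j; have := hv i j; rewrite !mxE.
by rewrite opprD addrACA subrr addr0.
Qed.

Lemma tchart_near c w : tdom c (tproj w) ->
  exists2 l, lattice l & \forall v \near w, polydisc c (1 / 4) (v + l) /\ tchart c (tproj v) = v + l.
Proof.
move=> /tdom_proj [l hl hw]; exists l => //.
have ct := @cvg_translation w l.
have := @polydisc_open R c (1 / 4); rewrite openE => /(_ _ hw) /ct h.
have {}h : nbhs w ((fun v => v + l) @^-1` polydisc c (1 / 4)) := h.
apply: filterS h => v hv; split => //; exact: tchart_in.
Qed.

(** Transition maps have the identity as differential: the charts trivialize the
    tangent bundle, which is why forms become periodic functions. *)
Lemma differentiable_near_translation (f : V -> V) (l w : V) :
  (\forall v \near w, f v = v + l) ->
  differentiable f w /\ 'd f w = idfun :> (V -> V).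
Proof.
move=> h; apply: (@is_diff_by_estimate R V V f idfun w); first by move=> v; exact: cvg_id.
move=> eps e0; have fw := nbhs_singleton h.
have ct := @cvg_translation 0 w; rewrite add0r in ct.
have {}h : nbhs (0 : V) ((fun v => v + w) @^-1` [set v | f v = v + l]) := ct _ h.
apply: filterS h => v /= ->; rewrite fw /=.
by rewrite -(addrA v w l) addrK subrr normr0 mulr_ge0 // ltW.
Qed.

Lemma tdom_open c : open (tdom c).
Proof.
rewrite openE => x; rewrite -{1}(torus_repK x) => /tchart_near [l hl h].
rewrite -(torus_repK x); apply/nbhs_tproj; apply: filterS h => v [h _].
by apply/tdom_proj; exists l.
Qed.

Lemma tchart_continuous c x : tdom c x -> {for x, continuous (tchart c)}.
Proof.
rewrite -{1}(torus_repK x) => /tchart_near [l hl h].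
have ct := @cvg_translation (torus_rep x) l.
have e : tchart c x = torus_rep x + l.
  by rewrite -{1}(torus_repK x); exact: (nbhs_singleton h).2.
rewrite /prop_for /continuous_at /= => A; rewrite e => /ct hA.
have {}hA : nbhs (torus_rep x) ((fun v => v + l) @^-1` A) := hA.
rewrite -(torus_repK x); apply/nbhs_tproj.
apply: filterS (filterI h hA) => v [[_ e'] hv].
by rewrite /= e'.
Qed.

Lemma ttransition_near (c c' : V) w : (tchart c @` (tdom c `&` tdom c')) w ->
  exists2 l, lattice l & \forall v \near w, tchart c' (tproj v) = v + l.
Proof.
move=> [x [hx hx'] <-]; have := hx'; rewrite -{1}(tchartK c x) => /tchart_near [l hl h].
by exists l => //; apply: filterS h => v [].
Qed.

Lemma ttransition_differentiable c c' w : (tchart c @` (tdom c `&` tdom c')) w ->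
  differentiable (tchart c' \o tproj) w.
Proof. by move=> /ttransition_near [l hl h]; exact: (differentiable_near_translation h).1. Qed.

Lemma tdom_self x : tdom (torus_rep x) x.
Proof.
have : tdom (torus_rep x) (tproj (torus_rep x)); last by rewrite torus_repK.
apply/tdom_proj; exists 0; first exact: lattice0.
by rewrite addr0; apply: polydisc_center; lra.
Qed.

Lemma tchart_img_open c : open (tchart c @` tdom c).
Proof. by rewrite tchart_img; exact: polydisc_open. Qed.

(** One chart for each point of C^2, with the projection as common inverse. *)
Definition torus2 : compactComplexManifold R 2 :=
  @CompactComplexManifold R 2 torus V tdom tchart (fun=> tproj) torus_rep
    torus_hausdorff torus_compact tdom_self tdom_open tchart_img_open
    (fun c x _ => tchartK c x) tchart_continuous (fun c w _ => @tproj_continuous R w)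
    ttransition_differentiable.
End TorusManifold.

(** * Forms on the torus as periodic forms on C^2 *)

Section LiftForms.
Context {R : realType}.
Local Notation C := (Cplx R).
Local Notation V := 'rV[C]_2.
Local Notation X := (@torus2 R).

(** The pull-back of a form to C^2, read at [w] in the chart centred at [w]. *)
Definition lift_form k (eta : preform X k) (w : V) (v : 'I_k -> V) : C := eta w w v.

(** Two charts differ by a translation, whose differential is the identity, so the
    coefficients of a form do not change from one chart to another. *)
Lemma form_change k (eta : preform X k) (i j z l : V) v : is_form eta -> lattice l ->
  polydisc i (1 / 4) z -> polydisc j (1 / 4) (z + l) -> eta i z v = eta j (z + l) v.
Proof.
move=> [_ _ compat] hl hi hj.
have di : tdom i (tproj z) by apply/tdom_proj; exists 0; [exact: lattice0 | rewrite addr0].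
have dj : tdom j (tproj z) by apply/tdom_proj; exists l.
have ez : tchart i (tproj z) = z by rewrite (tchart_in lattice0) ?addr0.
have im : (tchart i @` (tdom i `&` tdom j)) z by exists (tproj z).
have [m hm hn] := ttransition_near im.
have [dd de] := differentiable_near_translation hn.
rewrite (compat i j z v im) /transition /= (tchart_in hl hj); congr (eta _ _ _).
by apply/funext => a; rewrite de.
Qed.

Lemma form_lift k (eta : preform X k) (i z : V) v : is_form eta ->
  polydisc i (1 / 4) z -> eta i z v = lift_form eta z v.
Proof.
move=> fe hi; rewrite /lift_form.
have hz : polydisc z (1 / 4) (z + 0) by rewrite addr0; apply: polydisc_center; lra.
by rewrite (form_change v fe lattice0 hi hz) addr0.
Qed.

Lemma lift_periodic k (eta : preform X k) (z l : V) v : is_form eta -> lattice l ->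
  lift_form eta (z + l) v = lift_form eta z v.
Proof.
move=> fe hl; rewrite /lift_form; apply/esym; apply: form_change => //;
  by apply: polydisc_center; lra.
Qed.

Lemma lift_near k (eta : preform X k) (i : V) v : is_form eta ->
  \forall z \near i, eta i z v = lift_form eta z v.
Proof.
move=> fe; apply/nbhs_polydisc; exists (1 / 4); first by lra.
by move=> z hz; exact: form_lift.
Qed.

Lemma cvg_affine (a b : R) : (fun t : R => t * a + b) @ nbhs (0 : R) --> b.
Proof.
have h : (fun t : R => t * a + b) @ nbhs (0 : R) --> 0 * a + b.
  by apply: cvgD; [apply: cvgM; [exact: cvg_id | exact: cvg_cst] | exact: cvg_cst].
by rewrite mul0r add0r in h.
Qed.

Lemma cvg_line (v z : V) : (fun h : R => (h%:C : C) *: v + z) @ nbhs (0 : R) --> z.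
Proof.
apply/cvgV => i j; apply/cvgC; split.
  rewrite (_ : (fun t : R => _) = (fun t : R => t * Re (v i j) + Re (z i j))).
    exact: cvg_affine.
  by apply/funext => t; rewrite !mxE ReD ReZ.
rewrite (_ : (fun t : R => _) = (fun t : R => t * Im (v i j) + Im (z i j))).
  exact: cvg_affine.
by apply/funext => t; rewrite !mxE ImD ImZ.
Qed.

Lemma diffquot_near (g g' : V -> C) (z v : V) : (\forall w \near z, g w = g' w) ->
  \forall h \near (0 : R)^', real_diffquot g z v h = real_diffquot g' z v h.
Proof.
move=> h; have e := nbhs_singleton h.
have {}h : nbhs (0 : R) ((fun h : R => (h%:C : C) *: v + z) @^-1` [set w | g w = g' w]) :=
  @cvg_line v z _ h.
apply: (@nbhs_dnbhs R 0); apply: filterS h => t ht; rewrite /real_diffquot.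
by rewrite e ht.
Qed.

Lemma derive_near_eq (g g' : V -> C) (z v : V) : (\forall w \near z, g w = g' w) ->
  real_derive v g z = real_derive v g' z.
Proof.
move=> /(diffquot_near v) h; rewrite /real_derive; congr (lim _).
by rewrite eqEsubset; split; apply: near_eq_cvg; apply: filterS h.
Qed.

Lemma cvg_diffquot_near (g g' : V -> C) (z v : V) : (\forall w \near z, g w = g' w) ->
  cvg (real_diffquot g z v h @[h --> 0^']) -> cvg (real_diffquot g' z v h @[h --> 0^']).
Proof.
move=> /(diffquot_near v) h c; apply: cvgP (cvg_trans _ c).
by apply: near_eq_cvg; apply: filterS h.
Qed.

Definition C1 (g : V -> C) : Prop :=
  [/\ continuous g, forall v z, cvg (real_diffquot g z v h @[h --> 0^']) &
      forall v, continuous (real_derive v g)].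

Lemma continuous_near_eq (g g' : V -> C) (z : V) : (\forall w \near z, g w = g' w) ->
  {for z, continuous g} -> {for z, continuous g'}.
Proof.
rewrite /prop_for /continuous_at => h c; rewrite -(nbhs_singleton h).
exact: (cvg_trans (near_eq_cvg h) c).
Qed.

Lemma lift_C1 k (eta : preform X k) v : is_form eta -> C1 (fun w => lift_form eta w v).
Proof.
move=> fe; have [_ sm _] := fe.
have im (w : V) : chart_img (X := X) w w.
  have -> : chart_img (X := X) w = polydisc w (1 / 4) by exact: tchart_img.
  by apply: polydisc_center; lra.
split.
- by move=> w; apply: continuous_near_eq (lift_near w v fe) _; exact: (sm w v [::] w (im w)).1.
- move=> u z; apply: cvg_diffquot_near (lift_near z v fe) _.
  exact: (sm z v [::] z (im z)).2.
- move=> u w; apply: continuous_near_eq (sm w v [:: u] w (im w)).1.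
  have h := nbhs_interior (lift_near w v fe).
  by apply: filterS h => z hz; exact: derive_near_eq.
Qed.

Lemma lift_ext_deriv k (alpha : preform X k) (w : V) v : is_form alpha ->
  lift_form (ext_deriv alpha) w v =
  \sum_(a < k.+1) (-1) ^+ a * real_derive (v a) (fun z => lift_form alpha z (v \o lift a)) w.
Proof.
move=> fe; rewrite /lift_form /ext_deriv; apply: eq_bigr => a _; congr (_ * _).
exact: derive_near_eq (lift_near w (v \o lift a) fe).
Qed.

Definition vec1 (u : V) : 'I_1 -> V := fun=> u.

Lemma lift_ext_deriv1 (alpha : preform X 1) (w u v : V) : is_form alpha ->
  lift_form (ext_deriv alpha) w (vec2 u v) =
  real_derive u (fun z => lift_form alpha z (vec1 v)) w
  - real_derive v (fun z => lift_form alpha z (vec1 u)) w.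
Proof.
move=> fe; rewrite lift_ext_deriv // big_ord_recl big_ord1 /= expr0 mul1r expr1 mulN1r.
have -> : vec2 u v \o lift ord0 = vec1 v by apply/funext => a; rewrite ord1.
have -> : vec2 u v \o lift (lift ord0 ord0) = vec1 u.
  by apply/funext => a; rewrite /= (ord1 a).
by [].
Qed.

Definition periodic_form k (eta : preform X k) : Prop :=
  forall w l v, lattice l -> lift_form eta (w + l) v = lift_form eta w v.

Lemma is_form_periodic k (eta : preform X k) : is_form eta -> periodic_form eta.
Proof. by move=> fe w l v; exact: lift_periodic. Qed.

(** Differentiation commutes with translations, so periodicity passes from the
    coefficients of [alpha] to those of its exterior derivative. *)
Lemma ext_deriv_periodic (alpha : preform X 1) : is_form alpha -> periodic_form (ext_deriv alpha).
Proof.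
move=> fa w l v hl; rewrite !lift_ext_deriv //; apply: eq_bigr => a _; congr (_ * _).
rewrite /real_derive.
set g := fun z => lift_form alpha z (v \o lift a).
have -> : real_diffquot g (w + l) (v a) = real_diffquot g w (v a).
  apply/funext => h; rewrite /real_diffquot /g (addrA _ w l).
  by rewrite !(lift_periodic _ _ fa hl).
by [].
Qed.
End LiftForms.

(** * Curves on the torus that lift to C^2 *)

Section Curves.
Context {R : realType}.
Local Notation C := (Cplx R).
Local Notation V := 'rV[C]_2.
Local Notation X := (@torus2 R).

(** Complex differentiability with a second order remainder; [P'] is the
    derivative of [P]. *)
Definition taylor (P P' : C -> C) : Prop := forall z, exists2 M : R, 0 <= M &
  forall h : C, cabs h <= 1 -> cabs (P (z + h) - P z - h * P' z) <= M * cabs h ^+ 2.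

Lemma near0_cabs (d : R) : 0 < d -> \forall h \near (0 : C), cabs h < d.
Proof.
move=> d0; apply/nbhs_ballP; exists d%:C => /=; first by rewrite -[0]/((0 : R)%:C) ltC_real.
by move=> h; rewrite /ball /= sub0r normrN normCE ltC_real.
Qed.

Definition vecf (Q : 'I_2 -> C -> C) (z : C) : V := \row_j Q j z.

Variables (P P' : 'I_2 -> C -> C).
Hypothesis PT : forall j, taylor (P j) (P' j).

Definition curve (z : C) : X := tproj (vecf P z).

Lemma vecf_taylor z : exists2 M : R, 0 <= M & forall h : C, cabs h <= 1 ->
  `|vecf P (z + h) - vecf P z - h *: vecf P' z| <= (M * cabs h ^+ 2)%:C.
Proof.
have [M0 m0 h0] := PT ord0 z; have [M1 m1 h1] := PT (lift ord0 ord0) z.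
exists (M0 + M1); first exact: addr_ge0.
move=> h hh; apply: rV_norm_le; first by rewrite mulr_ge0 ?addr_ge0 // sqr_ge0.
move=> i j; rewrite !mxE.
have q := sqr_ge0 (cabs h).
case: (unliftP ord0 j) => [j' -> |->]; rewrite ?(ord1 j').
  by apply: le_trans (h1 _ hh) _; rewrite ler_wpM2r // lerDr.
by apply: le_trans (h0 _ hh) _; rewrite ler_wpM2r // lerDl.
Qed.

Lemma vecf_diff z : differentiable (vecf P) z /\ 'd (vecf P) z = ( *:%R^~ (vecf P' z)) :> (C -> V).
Proof.
pose d (h : C) : V := h *: vecf P' z.
have lin_scal : linear d by move=> ? ? ?; rewrite /d scalerDl scalerA.
pose scallM := GRing.isLinear.Build _ _ _ _ _ lin_scal.
pose scalL : {linear _ -> _} := HB.pack d scallM.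
rewrite -/d -[d]/(scalL : _ -> _).
apply: is_diff_by_estimate; first exact: scalel_continuous.
move=> eps e0; have [M m0 hM] := vecf_taylor z; have [e ee ->] := gt0_real e0.
have d1 : 0 < e / (M + 1) by rewrite divr_gt0 //; lra.
apply: filterS (filterI (near0_cabs ltr01) (near0_cabs d1)) => h [h1 h2] /=.
rewrite (addrC h z); apply: le_trans (hM _ (ltW h1)) _.
rewrite normCE -[_%:C * _]rmorphM leC_real expr2 mulrA.
apply: ler_wpM2r; first exact: cabs_ge0.
rewrite ltr_pdivlMr in h2; last by lra.
by have := cabs_ge0 h; nra.
Qed.

Lemma vecf_continuous : continuous (vecf P).
Proof. by move=> z; apply: differentiable_continuous; exact: (vecf_diff z).1. Qed.

Lemma vecf_derive z : 'D_1 (vecf P) z = vecf P' z.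
Proof. by have [d e] := vecf_diff z; rewrite deriveE // e scale1r. Qed.

Lemma curve_continuous : continuous curve.
Proof. by move=> z; apply: continuous_comp; [exact: vecf_continuous | exact: tproj_continuous]. Qed.

Lemma curve_near (c : V) z : tdom c (curve z) ->
  exists l : V, \forall z' \near z, tchart c (curve z') = vecf P z' + l.
Proof.
move=> /tchart_near [l hl h]; exists l.
have h' : nbhs z (vecf P @^-1` [set v | polydisc c (1 / 4) (v + l) /\ tchart c (tproj v) = v + l]).
  exact: (vecf_continuous h).
by apply: filterS h' => z' [].
Qed.

Lemma vecf_shift_diff (l : V) z : differentiable (fun z => vecf P z + l) z.
Proof.
by apply: differentiableD; [exact: (vecf_diff z).1 | exact: differentiable_cst].
Qed.

Lemma chart_curve_derive (c : V) z : tdom c (curve z) ->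
  differentiable (tchart c \o curve) z /\ 'D_1 (tchart c \o curve) z = vecf P' z.
Proof.
move=> /curve_near [l hl].
have hl' : \forall z' \near z, (vecf P + cst l) z' = (tchart c \o curve) z'.
  by apply: filterS hl => z' /= ->.
have d1 : differentiable (vecf P) z := (vecf_diff z).1.
have d2 : differentiable (vecf P + cst l) z by exact: vecf_shift_diff.
have d3 : derivable (vecf P + cst l) z 1 by exact: diff_derivable.
have dv := near_eq_derivable hl' d3.
split; first by apply/derivable1_diffP.
rewrite -(near_eq_derive _ hl') deriveD.
- by rewrite vecf_derive derive_cst addr0.
- exact: diff_derivable.
- exact: derivable_cst.
Qed.

Lemma curve_holomorphic : holomorphic_curve curve.
Proof.
split; first exact: curve_continuous.
by move=> i z hz; exact: (chart_curve_derive hz).1.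
Qed.

(** Near each point a chart of the torus composed with the curve is the lift plus a
    constant. *)
Lemma curve_velocity z : velocity curve z = vecf P' z.
Proof. exact: (chart_curve_derive (@tdom_self R (curve z))).2. Qed.

Lemma eval2_curve (eta : preform X 2) z u v : periodic_form eta ->
  eval2 eta (curve z) u v = lift_form eta (vecf P z) (vec2 u v).
Proof.
move=> fe; rewrite /eval2 /=.
have [l hl e] := tproj_rep (vecf P z).
have -> : tchart (torus_rep (curve z)) (curve z) = torus_rep (curve z).
  by rewrite /tchart subrr centered_small ?addr0 // => i j; rewrite mxE cabs0; lra.
by rewrite -[LHS]/(lift_form eta (torus_rep (tproj (vecf P z))) _) e fe.
Qed.

Lemma pullback2_curve (eta : preform X 2) z : periodic_form eta ->
  pullback2 curve eta z = lift_form eta (vecf P z) (vec2 (vecf P' z) (iC *: vecf P' z)).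
Proof. by move=> fe; rewrite /pullback2 curve_velocity eval2_curve. Qed.
End Curves.

(** * Integration over discs of the plane *)

Section Plane.
Context {R : realType}.
Local Notation mu := (@lebesgue_measure R).
Local Notation mR := (measurableTypeR R).

Definition qrect (U : set (R * R)) (q : (rat * rat) * (rat * rat)) : set (R * R) :=
  let S := `]ratr q.1.1 : R, ratr q.1.2[%classic `*` `]ratr q.2.1 : R, ratr q.2.2[%classic in
  if `[< S `<=` U >] then S else set0.

(** The product sigma-algebra contains the open sets of the plane because each of
    them is a countable union of rectangles with rational corners. *)
Lemma open_qrect (U : set (R * R)) : open U -> U = \bigcup_q qrect U q.
Proof.
move=> oU; rewrite eqEsubset; split; last first.
  by move=> p [q _]; rewrite /qrect; case: ifPn => // /asboolP; apply.
move=> [x y] Uxy; move: oU; rewrite openE => /(_ _ Uxy) /nbhs_ballP [e /= e0 he].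
have rb (t : R) : exists a b : rat, [/\ (ratr a : R) < t, t < ratr b,
    t - e < ratr a & (ratr b : R) < t + e].
  have [a] := @rat_in_itvoo R (t - e) t (ltac:(lra)); rewrite in_itv /= => /andP[a1 a2].
  have [b] := @rat_in_itvoo R t (t + e) (ltac:(lra)); rewrite in_itv /= => /andP[b1 b2].
  by exists a, b.
have [a [b [a1 b1 a2 b2]]] := rb x; have [c [d [c1 d1 c2 d2]]] := rb y.
exists ((a, b), (c, d)) => //; rewrite /qrect /=.
case: ifPn => [_|/asboolP]; first by split; rewrite /= in_itv /= ?a1 ?b1 ?c1 ?d1.
case=> -[u v] /= []; rewrite !in_itv /= => /andP[u1 u2] /andP[v1 v2].
apply: he; split => /=; rewrite /ball /= ltr_norml; apply/andP; split; lra.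
Qed.

Lemma open_measurable2 (U : set (R * R)) : open U -> measurable (U : set (mR * mR)).
Proof.
move=> /open_qrect ->; apply: countable_bigcupT_measurable; first exact: countableP.
move=> q; rewrite /qrect; case: ifP => _ //.
by apply: measurableX; exact: measurable_itv.
Qed.

Lemma continuous_measurable2 (g : R * R -> R) : continuous g -> measurable_fun setT (g : mR * mR -> R).
Proof.
move=> /continuousP cg; apply: (measurability _ (measurable_realfun.RGenOpens.measurableE R)).
move=> _ [_ [a [b ->] <-]]; rewrite setTI; apply: open_measurable2.
exact/cg/interval_open.
Qed.

Lemma disc_open (r : R) : open (disc r).
Proof.
have -> : disc r = (fun p : R * R => p.1 ^+ 2 + p.2 ^+ 2) @^-1` [set x | x < r ^+ 2] by [].
apply: open_comp; last exact: open_lt.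
move=> p _.
have h : (fun q : R * R => q.1 * q.1 + q.2 * q.2) @ nbhs p --> p.1 * p.1 + p.2 * p.2.
  by apply: cvgD; apply: cvgM; (exact: cvg_fst || exact: cvg_snd).
exact: h.
Qed.

Lemma disc_measurable (r : R) : measurable (disc r : set (mR * mR)).
Proof. by apply: open_measurable2; exact: disc_open. Qed.

Definition rect (a b c d : R) : set (R * R) := `[a, b]%classic `*` `[c, d]%classic.

Lemma rect_measurable a b c d : measurable (rect a b c d : set (mR * mR)).
Proof. by apply: measurableX; exact: measurable_itv. Qed.

Lemma rect_area a b c d : a <= b -> c <= d -> leb2 (rect a b c d) = ((b - a) * (d - c))%:E.
Proof.
move=> ab cd; rewrite /leb2 product_measure1E //; try exact: measurable_itv.
have h (x y : R) : x <= y -> mu `[x, y]%classic = (y - x)%:E.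
  move=> xy; rewrite lebesgue_measure_itv /= lte_fin; case: ltP => // yx.
  have -> : x = y by apply/eqP; rewrite eq_le xy yx.
  by rewrite subrr.
by rewrite [X in (X * _)%E]h // [X in (_ * X)%E]h.
Qed.

Lemma disc_sub_rect (r : R) : 0 < r -> disc r `<=` rect (- r) r (- r) r.
Proof.
move=> r0 [x y]; rewrite /disc /rect /= => h; split; rewrite in_itv /=; apply/andP; split; nra.
Qed.

(** The area of the circumscribed square; the value of the constant is immaterial. *)
Lemma disc_area (r : R) : 0 < r -> (leb2 (disc r) <= (4 * r ^+ 2)%:E)%E.
Proof.
move=> r0; have -> : 4 * r ^+ 2 = (r - - r) * (r - - r) by ring.
rewrite -rect_area; [|lra|lra].
apply: le_measure; rewrite ?inE; [exact: disc_measurable|exact: rect_measurable|exact: disc_sub_rect].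
Qed.

Lemma disc_finite (r : R) : 0 < r -> (leb2 (disc r) < +oo)%E.
Proof. by move=> r0; apply: le_lt_trans (disc_area r0) _; rewrite ltry. Qed.

Lemma disc_integrable (r M : R) (g : R * R -> R) : 0 < r -> measurable_fun setT (g : mR * mR -> R) ->
  (forall p, disc r p -> `|g p| <= M) -> leb2.-integrable (disc r) (EFin \o g).
Proof.
move=> r0 mg gM; apply: measurable_bounded_integrable.
- exact: disc_measurable.
- exact: disc_finite.
- exact: measurable_funTS.
exists M; split; first exact: num_real.
by move=> x Mx p /gM /le_trans; apply; exact: ltW.
Qed.

Lemma disc_int_le (r M : R) (g : R * R -> R) : 0 < r -> measurable_fun setT (g : mR * mR -> R) ->
  (forall p, disc r p -> `|g p| <= M) ->
  `|\int[leb2]_(p in disc r) g p| <= M * (4 * r ^+ 2).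
Proof.
move=> r0 mg gM; have ig := disc_integrable r0 mg gM.
have p0 : disc r (0, 0) by rewrite /disc /= expr0n addr0 exprn_gt0.
have M0 : 0 <= M by apply: le_trans (gM _ p0).
apply: le_trans (le_normr_Rintegral (disc_measurable r) ig) _.
apply: (@le_trans _ _ (\int[leb2]_(p in disc r) M)).
  apply: le_Rintegral.
  - exact: disc_measurable.
  - apply: (@disc_integrable r M) => //; first exact: measurableT_comp.
    by move=> p hp; rewrite normr_id; exact: gM.
  - apply: (@disc_integrable r M) => //.
    by move=> p hp; rewrite ger0_norm.
  - by move=> p hp; exact: gM.
rewrite Rintegral_cst; last exact: disc_measurable.
rewrite ler_wpM2l // -lee_fin fineK; first exact: disc_area.
by rewrite ge0_fin_numE ?measure_ge0 // disc_finite.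
Qed.

Lemma continuous_disc_bounded (r : R) (g : R * R -> R) : continuous g -> exists2 M : R, 0 <= M &
  forall p, rect (- r) r (- r) r p -> `|g p| <= M.
Proof.
move=> cg.
have cK : compact (rect (- r) r (- r) r) by apply: compact_setX; exact: segment_compact.
have := @continuous_compact _ _ g _ (continuous_subspaceT cg) cK.
move=> /compact_bounded [M [_ hM]]; exists `|M + 1|; first by [].
move=> p hp; apply: (hM `|M + 1|).
  by apply: lt_le_trans (ler_norm _); rewrite ltrDl.
by exists p.
Qed.

Lemma continuous_disc_integrable (r : R) (g : R * R -> R) : 0 < r -> continuous g ->
  leb2.-integrable (disc r) (EFin \o g).
Proof.
move=> r0 cg; have [M M0 hM] := continuous_disc_bounded r cg.
apply: (@disc_integrable r M) => //; first exact: continuous_measurable2.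
by move=> p /(disc_sub_rect r0); exact: hM.
Qed.
End Plane.

(** * Integrals of partial derivatives over a disc *)

Section Green.
Context {R : realType}.
Local Notation mu := (@lebesgue_measure R).
Local Notation mR := (measurableTypeR R).

Lemma integral_derivative_bound (u du : R -> R) (s M : R) : 0 < s -> continuous du ->
  (forall x : R, is_derive x (1 : R) u (du x)) -> `|u s| <= M -> `|u (- s)| <= M ->
  (`|\int[mu]_(x in (`](- s), s[%classic : set R)%R) (du x)%:E| <= (2 * M)%:E)%E.
Proof.
move=> s0 cdu hd us uns.
have mdu (D : set mR) : measurable_fun D (fun x : mR => (du x)%:E).
  by apply/measurable_EFinP; apply: measurable_funTS; exact: continuous_measurable_fun.
rewrite integral_itv_obnd_cbnd; last exact: mdu.
rewrite integral_itv_bndo_bndc; last exact: mdu.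
have cu : continuous u.
  by move=> x; apply: differentiable_continuous; apply/derivable1_diffP; case: (hd x).
rewrite (@continuous_FTC2 R du u); first last.
- by move=> x _; rewrite derive1E; case: (hd x) => _ ->.
- split; first by move=> x _; case: (hd x).
  + by apply: cvg_at_right_filter; exact: cu.
  + by apply: cvg_at_left_filter; exact: cu.
- exact: continuous_subspaceT.
- lra.
rewrite -EFinB /= lee_fin; apply: le_trans (ler_normB _ _) _; lra.
Qed.

(** The chord of the disc at height [y]; the square root vanishes when the line
    misses the disc, and the chord is then empty. *)
Lemma disc_section (r x y : R) :
  (x ^+ 2 + y ^+ 2 < r ^+ 2) = (- Num.sqrt (r ^+ 2 - y ^+ 2) < x < Num.sqrt (r ^+ 2 - y ^+ 2)).
Proof.
have [h|h] := leP (r ^+ 2 - y ^+ 2) 0.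
  rewrite ler0_sqrtr // oppr0.
  have -> : (x ^+ 2 + y ^+ 2 < r ^+ 2) = false by apply/negbTE; rewrite -leNgt; nra.
  by apply/esym/negbTE/negP => /andP[]; lra.
have s2 := sqr_sqrtr (ltW h); have s0 : 0 < Num.sqrt (r ^+ 2 - y ^+ 2) by rewrite sqrtr_gt0.
set s := Num.sqrt _ in s2 s0 *.
apply/idP/idP => [h1|/andP[h1 h2]]; last by nra.
by apply/andP; split; nra.
Qed.

(** On a chord the integral of the derivative is the difference of two boundary
    values, by the fundamental theorem of calculus. The bound is written as a
    function supported by [-r, r], ready to be integrated in [y]. *)
Lemma green_section (r M y : R) (q dq : R -> R) : 0 < r -> 0 <= M -> continuous dq ->
  (forall x : R, is_derive x (1 : R) q (dq x)) ->
  (forall x, x ^+ 2 + y ^+ 2 <= r ^+ 2 -> `|q x| <= M) ->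
  (`|\int[mu]_x ((EFin \o dq) \_ [set t : R | (t ^+ 2 + y ^+ 2 < r ^+ 2)%R]) x| <=
   (cst (2 * M)%:E \_ (`[(- r), r]%classic : set R)%R) y)%E.
Proof.
move=> r0 M0 cdq hd hM.
rewrite -integral_mkcond.
set s := Num.sqrt (r ^+ 2 - y ^+ 2).
have -> : [set x | x ^+ 2 + y ^+ 2 < r ^+ 2] = `](- s), s[%classic.
  by apply/seteqP; split=> x /=; rewrite in_itv /= disc_section.
have [h|h] := leP (r ^+ 2 - y ^+ 2) 0.
  have -> : s = 0 by rewrite /s ler0_sqrtr.
  rewrite oppr0 set_itvoo0 integral_set0 abse0 patchE; case: ifP => // _.
  by rewrite lee_fin mulr_ge0.
have s2 := sqr_sqrtr (ltW h); have s0 : 0 < s by rewrite sqrtr_gt0.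
rewrite -/s in s2.
rewrite patchE mem_set; last by rewrite /= in_itv /=; apply/andP; split; nra.
by apply: integral_derivative_bound => //; apply: hM; nra.
Qed.

Lemma integral_strip (r M : R) : 0 < r -> 0 <= M ->
  (\int[mu]_y (cst (2 * M)%:E \_ (`[(- r), r]%classic : set R)%R) y = (4 * r * M)%:E)%E.
Proof.
move=> r0 M0; rewrite -integral_mkcond integral_cst; last exact: measurable_itv.
have e : mu `[(- r), r]%classic = (r - - r)%:E.
  by rewrite lebesgue_measure_itv /= lte_fin gtrN // -EFinB.
rewrite [X in (_ * X)%E]e -EFinM; congr EFin; ring.
Qed.

Lemma strip_measurable (r M : R) : measurable_fun setT (cst (2 * M)%:E \_ `[- r, r]%classic : mR -> \bar R).
Proof.
apply/(measurable_restrictT _ _).1; first exact: measurable_itv.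
exact: measurable_cst.
Qed.

Lemma fubini_bound (r M : R) (g : mR -> \bar R) : 0 < r -> 0 <= M -> measurable_fun setT g ->
  (forall y, `|g y| <= (cst (2 * M)%:E \_ (`[(- r), r]%classic : set R)%R) y)%E ->
  (`|\int[mu]_y g y| <= (4 * r * M)%:E)%E.
Proof.
move=> r0 M0 mg hg; apply: le_trans (le_abse_integral _ measurableT mg) _.
rewrite -integral_strip //; apply: ge0_le_integral => //.
- exact: measurableT_comp.
- exact: strip_measurable.
Qed.

Lemma disc_patch_integrable (r : R) (dq : R * R -> R) : 0 < r -> continuous dq ->
  leb2.-integrable setT ((EFin \o dq) \_ (disc r)).
Proof.
move=> r0 cdq; apply/(integrable_mkcond _ _).1; first exact: disc_measurable.
exact: continuous_disc_integrable.
Qed.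

Lemma abs_fine_le (x : \bar R) (M : R) : (`|x| <= M%:E)%E -> `|fine x| <= M.
Proof. by case: x => [x| |] //=; rewrite ?lee_fin // leye_eq. Qed.

Lemma pair_l_continuous (y : R) : continuous (fun t : R => (t, y)).
Proof.
move=> x A /nbhs_ballP [e e0 he]; apply/nbhs_ballP; exists e => // t ht.
by apply: he; split => //; exact: ballxx.
Qed.

Lemma pair_r_continuous (x : R) : continuous (fun t : R => (x, t)).
Proof.
move=> y A /nbhs_ballP [e e0 he]; apply/nbhs_ballP; exists e => // t ht.
by apply: he; split => //; exact: ballxx.
Qed.

(** The divergence theorem on the disc, as an inequality: integrating first along
    the chords avoids any parametrization of the boundary circle. *)
Lemma green_x (r M : R) (q dq : R * R -> R) : 0 < r -> continuous dq ->
  (forall x y : R, is_derive x (1 : R) (fun t => q (t, y)) (dq (x, y))) ->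
  (forall p, p.1 ^+ 2 + p.2 ^+ 2 <= r ^+ 2 -> `|q p| <= M) ->
  `|\int[leb2]_(p in disc r) dq p| <= 4 * r * M.
Proof.
move=> r0 cdq hd hM.
have M0 : 0 <= M.
  by apply: le_trans (hM (0, 0) _); rewrite //= expr0n addr0 sqr_ge0.
apply: abs_fine_le; rewrite integral_mkcond.
have ig := disc_patch_integrable r0 cdq.
rewrite -integral21_prod_meas1 //; apply: fubini_bound => //.
  exact: (measurable_fubini_G ig).
move=> y; rewrite /fubini_G.
have := @green_section r M y (fun t => q (t, y)) (fun t => dq (t, y)) r0 M0.
apply; last by move=> x hx; exact: (hM (x, y)).
  move=> x; apply: (@continuous_comp _ _ _ (fun t : R => (t, y)) dq); last exact: cdq.
  exact: pair_l_continuous.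
Qed.

Lemma green_y (r M : R) (q dq : R * R -> R) : 0 < r -> continuous dq ->
  (forall x y : R, is_derive y (1 : R) (fun t => q (x, t)) (dq (x, y))) ->
  (forall p, p.1 ^+ 2 + p.2 ^+ 2 <= r ^+ 2 -> `|q p| <= M) ->
  `|\int[leb2]_(p in disc r) dq p| <= 4 * r * M.
Proof.
move=> r0 cdq hd hM.
have M0 : 0 <= M.
  by apply: le_trans (hM (0, 0) _); rewrite //= expr0n addr0 sqr_ge0.
apply: abs_fine_le; rewrite integral_mkcond.
have ig := disc_patch_integrable r0 cdq.
rewrite -integral12_prod_meas1 //; apply: fubini_bound => //.
  exact: (measurable_fubini_F ig).
move=> x; rewrite /fubini_F.
have := @green_section r M x (fun t => q (x, t)) (fun t => dq (x, t)) r0 M0.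
have -> : [set t : R | t ^+ 2 + x ^+ 2 < r ^+ 2] = [set t | x ^+ 2 + t ^+ 2 < r ^+ 2].
  by apply/seteqP; split=> t /=; rewrite addrC.
apply; last by move=> y hy; apply: (hM (x, y)); rewrite addrC.
  move=> y; apply: (@continuous_comp _ _ _ (fun t : R => (x, t)) dq); last exact: cdq.
  exact: pair_r_continuous.
Qed.
End Green.

(** * The chain rule along real curves *)

Section Chain.
Context {R : realType}.
Local Notation C := (Cplx R).
Local Notation V := 'rV[C]_2.

Lemma is_derive_quotP (f : R -> R) (t df : R) :
  is_derive t (1 : R) f df <-> ((fun h => h^-1 * (f (h + t) - f t)) @ 0^' --> df).
Proof.
have e : (fun h : R => h^-1 *: (f (h *: (1 : R) + t) - f t)) = (fun h => h^-1 * (f (h + t) - f t)).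
  by apply/funext => h; rewrite /GRing.scale /= mulr1.
split=> [[hd <-]|h].
  by rewrite /derive -e; exact: hd.
have hd : derivable f t (1 : R) by rewrite /derivable e; apply/cvg_ex; exists df.
by apply: DeriveDef => //; rewrite /derive e; exact: cvg_lim.
Qed.

(** Real-valued functions with continuous directional derivatives, [dG v] being the
    derivative along [v]; linearity in [v] is a consequence ([dG_linear]). *)
Definition real_C1 (G : V -> R) (dG : V -> V -> R) : Prop :=
  (forall v, continuous (dG v)) /\
  forall v z, (fun h : R => h^-1 * (G ((h%:C : C) *: v + z) - G z)) @ 0^' --> dG v z.

Lemma C1_Re (g : V -> C) : C1 g -> real_C1 (fun z => Re (g z)) (fun v z => Re (real_derive v g z)).
Proof.
move=> [_ cv cd]; split=> [v z|v z].
  by have [h _] := (cvgC _ _).1 (cd v z); exact: h.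
have [h _] := (cvgC _ _).1 (cv v z).
rewrite (_ : (fun h => _) = (fun h => Re (real_diffquot g z v h))) //.
by apply/funext => t; rewrite /real_diffquot ReZ ReB.
Qed.

Lemma C1_Im (g : V -> C) : C1 g -> real_C1 (fun z => Im (g z)) (fun v z => Im (real_derive v g z)).
Proof.
move=> [_ cv cd]; split=> [v z|v z].
  by have [_ h] := (cvgC _ _).1 (cd v z); exact: h.
have [_ h] := (cvgC _ _).1 (cv v z).
rewrite (_ : (fun h => _) = (fun h => Im (real_diffquot g z v h))) //.
by apply/funext => t; rewrite /real_diffquot ImZ ImB.
Qed.

Variables (G : V -> R) (dG : V -> V -> R).
Hypothesis HG : real_C1 G dG.

Lemma line_derive (v z : V) (t : R) :
  is_derive t (1 : R) (fun s : R => G ((s%:C : C) *: v + z)) (dG v ((t%:C : C) *: v + z)).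
Proof.
apply/is_derive_quotP; have := HG.2 v ((t%:C : C) *: v + z).
rewrite (_ : (fun h : R => h^-1 * _) =
  (fun h : R => h^-1 * (G (((h + t)%:C : C) *: v + z) - G ((t%:C : C) *: v + z)))) //.
by apply/funext => h; rewrite addrA -scalerDl -rmorphD.
Qed.

(** The mean value theorem in one direction, the only tool needed to pass from
    continuous directional derivatives to the chain rule. *)
Lemma mvt_line (v z : V) (c : R) : exists2 th : R, `|th| <= `|c| &
  G ((c%:C : C) *: v + z) - G z = c * dG v ((th%:C : C) *: v + z).
Proof.
pose f (s : R) := G ((s%:C : C) *: v + z).
have f0 : f 0 = G z by rewrite /f scale0r add0r.
have cf : continuous f.
  move=> x; apply: differentiable_continuous; apply/derivable1_diffP.
  by case: (line_derive v z x).
have hd (a b x : R) : x \in `]a, b[ -> is_derive x (1 : R) f (dG v ((x%:C : C) *: v + z)).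
  by move=> _; exact: line_derive.
rewrite -f0 -/(f c).
have [c0|c0|->] := ltgtP c 0.
- have [x] := MVT c0 (@hd c 0) (continuous_subspaceT cf).
  rewrite in_itv /= => /andP[x1 x2] e; exists x.
    by rewrite !ler0_norm ?lerN2 ltW.
  by rewrite -opprB e sub0r mulrN opprK mulrC.
- have [x] := MVT c0 (@hd 0 c) (continuous_subspaceT cf).
  rewrite in_itv /= => /andP[x1 x2] e; exists x.
    by rewrite !ger0_norm ?ltW.
  by rewrite e subr0 mulrC.
- by exists 0 => //; rewrite mul0r subrr.
Qed.

Lemma cvg_scale_add (T : Type) (F : set_system T) {FF : Filter F} (c : T -> R) (w : T -> V)
  (v w0 : V) : (c @ F --> (0 : R)) -> (w @ F --> w0) ->
  (fun t => ((c t)%:C : C) *: v + w t) @ F --> w0.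
Proof.
move=> hc /cvgV hw; apply/cvgV => i j; have /cvgC[hr hi] := hw i j.
apply/cvgC; split.
  rewrite (_ : (fun t => _) = (fun t => c t * Re (v i j) + Re (w t i j))); last first.
    by apply/funext => t; rewrite !mxE ReD ReZ.
  rewrite -[Re (w0 i j)]add0r -(mul0r (Re (v i j))).
  by apply: cvgD => //; apply: cvgM => //; exact: cvg_cst.
rewrite (_ : (fun t => _) = (fun t => c t * Im (v i j) + Im (w t i j))); last first.
  by apply/funext => t; rewrite !mxE ImD ImZ.
rewrite -[Im (w0 i j)]add0r -(mul0r (Im (v i j))).
by apply: cvgD => //; apply: cvgM => //; exact: cvg_cst.
Qed.

(** One displacement along a fixed direction [v], from a base point that moves with
    [h]: the mean value theorem and the continuity of [dG v] give the limit. *)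
Lemma chain_step (w : R -> V) (w0 v : V) (c : R -> R) (c' : R) :
  (w @ 0^' --> w0) -> (c @ 0^' --> (0 : R)) -> ((fun h => h^-1 * c h) @ 0^' --> c') ->
  (fun h => h^-1 * (G (((c h)%:C : C) *: v + w h) - G (w h))) @ 0^' --> c' * dG v w0.
Proof.
move=> hw hc hq.
have [th hth] : {th : R -> R & forall h, `|th h| <= `|c h| /\
    G (((c h)%:C : C) *: v + w h) - G (w h) = c h * dG v (((th h)%:C : C) *: v + w h)}.
  apply: (@choice R R (fun h x => `|x| <= `|c h| /\
    G (((c h)%:C : C) *: v + w h) - G (w h) = c h * dG v (((x)%:C : C) *: v + w h))) => h.
  by have [x x1 x2] := mvt_line v (w h) (c h); exists x.
have th0 : th @ 0^' --> (0 : R).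
  apply/cvgrPdist_lt => e e0; move: (hc) => /cvgrPdist_lt /(_ _ e0).
  apply: filterS => h; rewrite !sub0r !normrN; apply: le_lt_trans; exact: (hth h).1.
have hd : (fun h => dG v (((th h)%:C : C) *: v + w h)) @ 0^' --> dG v w0.
  by apply: (cvg_comp _ _ (cvg_scale_add v th0 hw)); exact: HG.1.
rewrite (_ : (fun h => _) = (fun h => h^-1 * c h * dG v (((th h)%:C : C) *: v + w h))).
  by apply: cvgM.
by apply/funext => h; rewrite (hth h).2 mulrA.
Qed.

(** The point reached from [w0] by successive displacements c(h) v, the data being
    triples (v, c, c') with c' the derivative of c at 0. *)
Fixpoint shift_by (s : seq (V * (R -> R) * R)) (w0 : V) (h : R) : V :=
  if s is (v, c, _) :: s' then ((c h)%:C : C) *: v + shift_by s' w0 h else w0.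

Fixpoint good_shifts (s : seq (V * (R -> R) * R)) : Prop :=
  if s is (_, c, c') :: s' then
    [/\ c @ 0^' --> (0 : R), (fun h : R => h^-1 * c h) @ 0^' --> c' & good_shifts s']
  else True.

(** The increment of [G] is telescoped over the successive displacements. *)
Lemma chain_list (s : seq (V * (R -> R) * R)) (w0 : V) :
  good_shifts s ->
  (shift_by s w0 @ 0^' --> w0) /\
  ((fun h => h^-1 * (G (shift_by s w0 h) - G w0)) @ 0^' --> \sum_(x <- s) x.2 * dG x.1.1 w0).
Proof.
elim: s => [|[[v c] c'] s IH] /=.
  move=> _; split; first by apply/cvgV => i j; exact: cvg_cst.
  rewrite big_nil (_ : (fun h => _) = cst 0); first exact: cvg_cst.
  by apply/funext => h; rewrite subrr mulr0.
move=> [hc hq /IH[h1 h2]]; split; first exact: cvg_scale_add.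
rewrite big_cons /=.
rewrite (_ : (fun h => _) = (fun h =>
  h^-1 * (G (((c h)%:C : C) *: v + shift_by s w0 h) - G (shift_by s w0 h)) +
  h^-1 * (G (shift_by s w0 h) - G w0))).
  by apply: cvgD => //; exact: chain_step.
by apply/funext => h; rewrite -mulrDr addrA subrK.
Qed.

Definition e_ (j : 'I_2) : V := \row_k (k == j)%:R.

Lemma row2_ext (u v : V) : u ord0 ord0 = v ord0 ord0 ->
  u ord0 (lift ord0 ord0) = v ord0 (lift ord0 ord0) -> u = v.
Proof.
move=> h0 h1; apply/rowP => j; case: (unliftP ord0 j) => [j' ->|->] //.
by rewrite (ord1 j').
Qed.

(** The four real directions of C^2, each with its coordinate function. *)
Definition real_basis : seq (V * (V -> R)) :=
  [:: (e_ ord0, fun v : V => Re (v ord0 ord0)); (iC *: e_ ord0, fun v : V => Im (v ord0 ord0));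
      (e_ (lift ord0 ord0), fun v : V => Re (v ord0 (lift ord0 ord0)));
      (iC *: e_ (lift ord0 ord0), fun v : V => Im (v ord0 (lift ord0 ord0)))].

Lemma real_basisE (v : V) : v = \sum_(a <- real_basis) ((a.2 v)%:C : C) *: a.1.
Proof.
rewrite /real_basis !big_cons big_nil /= addr0.
apply: row2_ext; rewrite !mxE /= ?mulr1 ?mulr0 ?addr0 ?add0r;
  by apply: C_ext; rewrite ?ReD ?ImD ?ReZ ?ImZ /= ?mulr0 ?mulr1 ?addr0 ?add0r.
Qed.

Lemma coord_shift (c : R -> R) (t c' : R) : is_derive t (1 : R) c c' ->
  ((fun h => c (h + t) - c t) @ 0^' --> (0 : R)) /\
  ((fun h : R => h^-1 * (c (h + t) - c t)) @ 0^' --> c').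
Proof.
move=> /is_derive_quotP h; split => //.
have h1 : (fun x : R => x * (x^-1 * (c (x + t) - c t))) @ 0^' --> (0 * c' : R).
  by apply: cvgM => //; apply: cvg_within.
rewrite mul0r in h1; apply: cvg_trans h1; apply: near_eq_cvg.
apply: (filterS _ (nbhs_dnbhs_neq (0 : R))) => x x0 /=.
by rewrite mulrA mulfV ?mul1r.
Qed.

Lemma real_basisB (u v : V) :
  u - v = \sum_(a <- real_basis) ((a.2 u - a.2 v)%:C : C) *: a.1.
Proof.
rewrite {1}(real_basisE (u - v)) /real_basis !big_cons !big_nil /=.
have hR j : Re ((u - v) ord0 j) = Re (u ord0 j) - Re (v ord0 j) by rewrite !mxE ReB.
have hI j : Im ((u - v) ord0 j) = Im (u ord0 j) - Im (v ord0 j) by rewrite !mxE ImB.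
by rewrite !hR !hI.
Qed.

Lemma shift_by_coords (L : seq (V * (V -> R))) (g : R -> V) (t h : R) (g' w : V) :
  shift_by [seq (a.1, (fun h => a.2 (g (h + t)) - a.2 (g t)), a.2 g') | a <- L] w h =
  \sum_(a <- L) ((a.2 (g (h + t)) - a.2 (g t))%:C : C) *: a.1 + w.
Proof.
elim: L => [|a L IH] /=; first by rewrite big_nil add0r.
by rewrite big_cons IH addrA.
Qed.

Lemma chain_curve_aux (g : R -> V) (g' : V) (t : R) :
  (forall j, is_derive t (1 : R) (fun s => Re (g s ord0 j)) (Re (g' ord0 j))) ->
  (forall j, is_derive t (1 : R) (fun s => Im (g s ord0 j)) (Im (g' ord0 j))) ->
  is_derive t (1 : R) (G \o g) (\sum_(a <- real_basis) a.2 g' * dG a.1 (g t)).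
Proof.
move=> hr hi; apply/is_derive_quotP.
pose s := [seq (a.1, (fun h => a.2 (g (h + t)) - a.2 (g t)), a.2 g') | a <- real_basis].
have gs : good_shifts s.
  rewrite /s /= /real_basis /=.
  by repeat split; first [exact: (coord_shift (hr _)).1 | exact: (coord_shift (hr _)).2 |
    exact: (coord_shift (hi _)).1 | exact: (coord_shift (hi _)).2 | idtac].
have [_ h] := chain_list (g t) gs.
rewrite big_map in h.
rewrite (_ : (fun h => _) = (fun h => h^-1 * (G (shift_by s (g t) h) - G (g t)))) //.
apply/funext => x; congr (_ * (G _ - _)).
by rewrite /s shift_by_coords -real_basisB subrK.
Qed.

(** The chain rule applied to a straight line: the derivative along [v] is computed
    once directly and once along the coordinate directions. *)
Lemma dG_linear (v w : V) : dG v w = \sum_(a <- real_basis) a.2 v * dG a.1 w.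
Proof.
pose g (s : R) : V := (s%:C : C) *: v + w.
have g0 : g 0 = w by rewrite /g scale0r add0r.
have h1 : is_derive (0 : R) (1 : R) (G \o g) (dG v w).
  by have := line_derive v w 0; rewrite scale0r add0r.
have aff (a b : R) : is_derive (0 : R) (1 : R) (fun s : R => s * a + b) a.
  apply/is_derive_quotP.
  have h : (fun=> a) @ (0 : R)^' --> a by exact: cvg_cst.
  apply: cvg_trans h.
  apply: near_eq_cvg; apply: (filterS _ (nbhs_dnbhs_neq (0 : R))) => x x0 /=.
  by rewrite addr0 mul0r add0r addrK mulKf.
have h2 : is_derive (0 : R) (1 : R) (G \o g) (\sum_(a <- real_basis) a.2 v * dG a.1 (g 0)).
  apply: chain_curve_aux => j.
    rewrite (_ : (fun s => _) = (fun s : R => s * Re (v ord0 j) + Re (w ord0 j))).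
      exact: aff.
    by apply/funext => s; rewrite !mxE ReD ReZ.
  rewrite (_ : (fun s => _) = (fun s : R => s * Im (v ord0 j) + Im (w ord0 j))).
    exact: aff.
  by apply/funext => s; rewrite !mxE ImD ImZ.
by rewrite g0 in h2; case: h1 => _ <-; case: h2 => _ <-.
Qed.

Lemma chain_curve (g : R -> V) (g' : V) (t : R) :
  (forall j, is_derive t (1 : R) (fun s => Re (g s ord0 j)) (Re (g' ord0 j))) ->
  (forall j, is_derive t (1 : R) (fun s => Im (g s ord0 j)) (Im (g' ord0 j))) ->
  is_derive t (1 : R) (G \o g) (dG g' (g t)).
Proof. by move=> hr hi; rewrite dG_linear; exact: chain_curve_aux. Qed.
End Chain.

(** * The Stokes estimate for one coordinate *)

Section Stokes.
Context {R : realType}.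
Local Notation C := (Cplx R).
Local Notation V := 'rV[C]_2.
Local Notation X := (@torus2 R).

(** Divide the second order expansion by the real increment. *)
Lemma taylor_dir (Q Q' : C -> C) (z xi : C) : taylor Q Q' -> cabs xi <= 1 ->
  ((fun h : R => h^-1 * (Re (Q (z + (h%:C : C) * xi)) - Re (Q z))) @ 0^' --> Re (xi * Q' z)) /\
  ((fun h : R => h^-1 * (Im (Q (z + (h%:C : C) * xi)) - Im (Q z))) @ 0^' --> Im (xi * Q' z)).
Proof.
move=> /(_ z) [M M0 hM] xi1.
have est (h : R) : h != 0 -> `|h| < 1 ->
    cabs (xi * Q' z - ((h^-1)%:C : C) * (Q (z + (h%:C : C) * xi) - Q z)) <= M * `|h|.
  move=> h0 h1.
  have hc : ((h%:C : C) * ((h^-1)%:C)) = 1 by rewrite -[LHS]rmorphM mulfV.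
  have hx : cabs ((h%:C : C) * xi) <= `|h|.
    by rewrite cabsM cabs_real -[leRHS]mulr1; apply: ler_pM; rewrite ?cabs_ge0.
  have := hM ((h%:C : C) * xi) (le_trans hx (ltW h1)).
  set D := Q _ - Q z => hD.
  have -> : xi * Q' z - ((h^-1)%:C : C) * D = - (((h^-1)%:C : C) * (D - (h%:C : C) * xi * Q' z)).
    rewrite -[X in X - _ = _]mul1r -hc; ring.
  rewrite cabsN cabsM cabs_real normfV ler_pdivrMl ?normr_gt0 //.
  apply: le_trans hD _; rewrite [leRHS]mulrCA ler_wpM2l // -expr2.
  by apply: lerXn2r; rewrite ?nnegrE ?cabs_ge0.
have main (k : C -> R) (q : R -> R) : (forall w, `|k w| <= cabs w) ->
    (forall h : R, k (xi * Q' z) - q h =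
      k (xi * Q' z - ((h^-1)%:C : C) * (Q (z + (h%:C : C) * xi) - Q z))) ->
    q @ 0^' --> k (xi * Q' z).
  move=> hk hq; apply/cvgrPdist_le => e e0.
  have d0 : 0 < Num.min 1 (e / (M + 1)) by rewrite lt_min ltr01 /= divr_gt0 //; lra.
  have n1 : \forall h \near (0 : R)^', `|h| < Num.min 1 (e / (M + 1)).
    apply: nbhs_dnbhs; apply/nbhs_ballP; exists (Num.min 1 (e / (M + 1))) => //= h.
    by rewrite /ball /= sub0r normrN.
  apply: (filterS _ (filterI n1 (nbhs_dnbhs_neq (0 : R)))) => h [h1 h0].
  rewrite hq; apply: le_trans (hk _) _; move: h1; rewrite lt_min => /andP[h1 h2].
  apply: le_trans (est _ h0 h1) _; rewrite ltr_pdivlMr in h2; last by lra.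
  by have := normr_ge0 h; nra.
split; apply: main => [w|h].
- exact: Re_le_cabs.
- by rewrite [RHS]ReB ReZ ReB.
- exact: Im_le_cabs.
- by rewrite [RHS]ImB ImZ ImB.
Qed.

Lemma taylor_x (Q Q' : C -> C) (x y : R) : taylor Q Q' ->
  is_derive x (1 : R) (fun t => Re (Q (t +i* y))) (Re (Q' (x +i* y))) /\
  is_derive x (1 : R) (fun t => Im (Q (t +i* y))) (Im (Q' (x +i* y))).
Proof.
move=> T; have c1 : cabs (1 : C) <= 1 by rewrite (cabs_real 1) normr1.
have := taylor_dir (x +i* y) T c1; rewrite mul1r.
have e (h : R) : (x +i* y : C) + (h%:C : C) * 1 = (h + x) +i* y.
  by rewrite mulr1; apply: C_ext; rewrite ?ReD ?ImD /= ?addr0 // addrC.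
by move=> [h1 h2]; split; apply/is_derive_quotP;
  [move: h1|move: h2]; under eq_fun do rewrite e.
Qed.

Lemma taylor_y (Q Q' : C -> C) (x y : R) : taylor Q Q' ->
  is_derive y (1 : R) (fun t => Re (Q (x +i* t))) (Re (iC * Q' (x +i* y))) /\
  is_derive y (1 : R) (fun t => Im (Q (x +i* t))) (Im (iC * Q' (x +i* y))).
Proof.
move=> T; have c1 : cabs (iC : C) <= 1 by rewrite /cabs /= expr0n expr1n add0r sqrtr1.
have := taylor_dir (x +i* y) T c1.
have e (h : R) : (x +i* y : C) + (h%:C : C) * iC = x +i* (h + y).
  by apply: C_ext; rewrite ?ReD ?ImD ?ReZ ?ImZ /= ?mulr0 ?mulr1 ?addr0 // addrC.
by move=> [h1 h2]; split; apply/is_derive_quotP;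
  [move: h1|move: h2]; under eq_fun do rewrite e.
Qed.

Definition plane_C (p : R * R) : C := p.1 +i* p.2.

Lemma taylor_continuous (Q Q' : C -> C) : taylor Q Q' -> continuous Q.
Proof.
move=> T z; have h := vecf_continuous (fun _ : 'I_2 => T) (x := z).
move: h => /cvgV /(_ ord0 ord0); rewrite mxE.
rewrite (_ : (fun t => _) = Q); first exact.
by apply/funext => t; rewrite mxE.
Qed.

Lemma continuous_plane_C (Q : C -> C) : continuous Q ->
  continuous (fun p => Re (Q (plane_C p))) /\ continuous (fun p => Im (Q (plane_C p))).
Proof.
move=> cQ; split=> p.
- apply: (@continuous_comp _ _ _ (fun p => Q (plane_C p)) (@complex.Re R : C -> R)).
    by apply: continuous_comp; [exact: continuous_mkC | exact: cQ].
  exact: continuous_Re.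
- apply: (@continuous_comp _ _ _ (fun p => Q (plane_C p)) (@complex.Im R : C -> R)).
    by apply: continuous_comp; [exact: continuous_mkC | exact: cQ].
  exact: continuous_Im.
Qed.

Definition is_coord (k : V -> R) : Prop :=
  exists j, k = (fun v => Re (v ord0 j)) \/ k = (fun v => Im (v ord0 j)).

Lemma coord_continuous (k : V -> R) (W : 'I_2 -> C -> C) : is_coord k ->
  (forall j, continuous (W j)) -> continuous (fun p => k (vecf W (plane_C p))).
Proof.
move=> [j [->|->]] cW; have [h1 h2] := continuous_plane_C (cW j).
  by rewrite (_ : (fun p => _) = (fun p => Re (W j (plane_C p)))) //; apply/funext => p; rewrite mxE.
by rewrite (_ : (fun p => _) = (fun p => Im (W j (plane_C p)))) //; apply/funext => p; rewrite mxE.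
Qed.

Lemma iC_vecf (W : 'I_2 -> C -> C) z : iC *: vecf W z = vecf (fun j w => iC * W j w) z.
Proof. by apply/matrixP => i j; rewrite !mxE. Qed.

Lemma vecf_plane_continuous (W : 'I_2 -> C -> C) : (forall j, continuous (W j)) ->
  continuous (fun p : R * R => vecf W (plane_C p)).
Proof.
move=> cW p; apply/cvgV => i j; rewrite mxE.
rewrite (_ : (fun p => _) = (fun p => W j (plane_C p))); last by apply/funext => t; rewrite mxE.
by apply: continuous_comp; [exact: continuous_mkC | exact: cW].
Qed.

Lemma iC_continuous (Q : C -> C) : continuous Q -> continuous (fun z => iC * Q z).
Proof.
move=> cQ z; apply: (@continuous_comp _ _ _ Q ( *%R (iC : C))); first exact: cQ.
exact: mulrl_continuous.
Qed.

Variables (P P' P'' : 'I_2 -> C -> C).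
Hypothesis PT : forall j, taylor (P j) (P' j).
Hypothesis PT' : forall j, taylor (P' j) (P'' j).
Hypothesis cP'' : forall j, continuous (P'' j).

Lemma coord_dx (W W' : 'I_2 -> C -> C) (k : V -> R) (x y : R) : is_coord k ->
  (forall j, taylor (W j) (W' j)) ->
  is_derive x (1 : R) (fun t => k (vecf W (t +i* y))) (k (vecf W' (x +i* y))).
Proof.
move=> [j [->|->]] T; rewrite !mxE.
  rewrite (_ : (fun t => _) = (fun t => Re (W j (t +i* y)))); first exact: (taylor_x x y (T j)).1.
  by apply/funext => t; rewrite mxE.
rewrite (_ : (fun t => _) = (fun t => Im (W j (t +i* y)))); first exact: (taylor_x x y (T j)).2.
by apply/funext => t; rewrite mxE.
Qed.

Lemma coord_dy (W W' : 'I_2 -> C -> C) (k : V -> R) (x y : R) : is_coord k ->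
  (forall j, taylor (W j) (W' j)) ->
  is_derive y (1 : R) (fun t => k (vecf W (x +i* t))) (k (iC *: vecf W' (x +i* y))).
Proof.
move=> [j [->|->]] T; rewrite !mxE.
  rewrite (_ : (fun t => _) = (fun t => Re (W j (x +i* t)))); first exact: (taylor_y x y (T j)).1.
  by apply/funext => t; rewrite mxE.
rewrite (_ : (fun t => _) = (fun t => Im (W j (x +i* t)))); first exact: (taylor_y x y (T j)).2.
by apply/funext => t; rewrite mxE.
Qed.

Variables (G : V -> R) (dG : V -> V -> R).
Hypothesis HG : real_C1 G dG.
Hypothesis cG : continuous G.

Lemma G_dx (x y : R) :
  is_derive x (1 : R) (fun t => G (vecf P (t +i* y))) (dG (vecf P' (x +i* y)) (vecf P (x +i* y))).
Proof.
apply: (chain_curve HG (g := fun t : R => vecf P (t +i* y))) => j.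
  by apply: (coord_dx (k := fun v : V => Re (v ord0 j))) => //; exists j; left.
by apply: (coord_dx (k := fun v : V => Im (v ord0 j))) => //; exists j; right.
Qed.

Lemma G_dy (x y : R) :
  is_derive y (1 : R) (fun t => G (vecf P (x +i* t))) (dG (iC *: vecf P' (x +i* y)) (vecf P (x +i* y))).
Proof.
apply: (chain_curve HG (g := fun t : R => vecf P (x +i* t))) => j.
  by apply: (coord_dy (k := fun v : V => Re (v ord0 j))) => //; exists j; left.
by apply: (coord_dy (k := fun v : V => Im (v ord0 j))) => //; exists j; right.
Qed.

Lemma dG_continuous (W : 'I_2 -> C -> C) : (forall j, continuous (W j)) ->
  continuous (fun p : R * R => dG (vecf W (plane_C p)) (vecf P (plane_C p))).
Proof.
move=> cW.
have cP : forall j, continuous (P j) by move=> j; exact: taylor_continuous (PT j).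
have c1 (v : V) : continuous (fun p : R * R => dG v (vecf P (plane_C p))).
  move=> p; apply: (@continuous_comp _ _ _ (fun p : R * R => vecf P (plane_C p)) (dG v)).
    exact: vecf_plane_continuous.
  exact: HG.1.
have c2 (k : V -> R) (v : V) : is_coord k ->
    continuous (fun p : R * R => k (vecf W (plane_C p)) * dG v (vecf P (plane_C p))).
  by move=> hk p; apply: cvgM; [exact: coord_continuous | exact: c1].
under eq_fun do rewrite (dG_linear HG) /real_basis !big_cons big_nil /= addr0.
move=> p; apply: cvgD; first by apply: (c2 (fun v : V => Re (v ord0 ord0))); eexists; left.
apply: cvgD; first by apply: (c2 (fun v : V => Im (v ord0 ord0))); eexists; right.
apply: cvgD; first by apply: (c2 (fun v : V => Re (v ord0 (lift ord0 ord0)))); eexists; left.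
by apply: (c2 (fun v : V => Im (v ord0 (lift ord0 ord0)))); eexists; right.
Qed.

(** The contribution of a term G dk of a 1-form. The pull-back of d(G dk) is
    dG(f_x) k(f_y) - dG(f_y) k(f_x), with f_x = f' and f_y = i f', and it equals
    (G k(f_y))_x - (G k(f_x))_y since the second derivatives of f cancel. The two
    functions under the derivatives are at most K B. *)
Lemma green_coord (k : V -> R) (r K B : R) : 0 < r -> is_coord k ->
  (forall w, `|G w| <= K) ->
  (forall z j, cabs z <= r -> cabs (P' j z) <= B) ->
  let g p := k (iC *: vecf P' (plane_C p)) * dG (vecf P' (plane_C p)) (vecf P (plane_C p)) -
             k (vecf P' (plane_C p)) * dG (iC *: vecf P' (plane_C p)) (vecf P (plane_C p)) in
  continuous g /\ `|\int[leb2]_(p in disc r) g p| <= 8 * r * (K * B).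
Proof.
move=> r0 hk hK hB g.
have K0 : 0 <= K by apply: le_trans (hK 0).
have kC := coord_continuous hk.
have cP : forall j, continuous (P j) by move=> j; exact: taylor_continuous (PT j).
have cP' : forall j, continuous (P' j) by move=> j; exact: taylor_continuous (PT' j).
have iP' : forall j, continuous (fun z => iC * P' j z) by move=> j; exact: iC_continuous.
have iP'' : forall j, continuous (fun z => iC * P'' j z) by move=> j; exact: iC_continuous.
have cGF : continuous (fun p : R * R => G (vecf P (plane_C p))).
  move=> p; apply: (@continuous_comp _ _ _ (fun p : R * R => vecf P (plane_C p)) G).
    exact: vecf_plane_continuous.
  exact: cG.
have kz p : p.1 ^+ 2 + p.2 ^+ 2 <= r ^+ 2 -> cabs (plane_C p) <= r.
  by move=> h; rewrite -(ger0_norm (ltW r0)) -sqrtr_sqr ler_wsqrtr.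
have ciC : cabs (iC : C) = 1 by rewrite /cabs /= expr0n expr1n add0r sqrtr1.
have kB p : p.1 ^+ 2 + p.2 ^+ 2 <= r ^+ 2 ->
    `|k (vecf P' (plane_C p))| <= B /\ `|k (iC *: vecf P' (plane_C p))| <= B.
  move=> /kz hz; case: hk => j [->|->]; rewrite !mxE; split.
  - exact: le_trans (Re_le_cabs _) (hB _ _ hz).
  - by apply: le_trans (Re_le_cabs _) _; rewrite cabsM ciC mul1r; exact: hB.
  - exact: le_trans (Im_le_cabs _) (hB _ _ hz).
  - by apply: le_trans (Im_le_cabs _) _; rewrite cabsM ciC mul1r; exact: hB.
pose q1 p := G (vecf P (plane_C p)) * k (iC *: vecf P' (plane_C p)).
pose d1 p := G (vecf P (plane_C p)) * k (iC *: vecf P'' (plane_C p)) +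
             k (iC *: vecf P' (plane_C p)) * dG (vecf P' (plane_C p)) (vecf P (plane_C p)).
pose q2 p := G (vecf P (plane_C p)) * k (vecf P' (plane_C p)).
pose d2 p := G (vecf P (plane_C p)) * k (iC *: vecf P'' (plane_C p)) +
             k (vecf P' (plane_C p)) * dG (iC *: vecf P' (plane_C p)) (vecf P (plane_C p)).
have k1 := kC _ iP'.
have k2 := kC _ iP''.
have k3 := kC _ cP'.
have D1 := dG_continuous cP'.
have D2 := dG_continuous iP'.
have cA (u v : R * R -> R) : continuous u -> continuous v -> continuous (fun p => u p + v p).
  by move=> cu cv p; apply: cvgD; [exact: cu | exact: cv].
have cM (u v : R * R -> R) : continuous u -> continuous v -> continuous (fun p => u p * v p).
  by move=> cu cv p; apply: cvgM; [exact: cu | exact: cv].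
have cd1 : continuous d1.
  have e : d1 = (fun p => G (vecf P (plane_C p)) * k (vecf (fun j z => iC * P'' j z) (plane_C p)) +
      k (vecf (fun j z => iC * P' j z) (plane_C p)) * dG (vecf P' (plane_C p)) (vecf P (plane_C p))).
    by apply/funext => p; rewrite /d1 !iC_vecf.
  by rewrite e; exact: (cA _ _ (cM _ _ cGF k2) (cM _ _ k1 D1)).
have cd2 : continuous d2.
  have e : d2 = (fun p => G (vecf P (plane_C p)) * k (vecf (fun j z => iC * P'' j z) (plane_C p)) +
      k (vecf P' (plane_C p)) * dG (vecf (fun j z => iC * P' j z) (plane_C p)) (vecf P (plane_C p))).
    by apply/funext => p; rewrite /d2 !iC_vecf.
  by rewrite e; exact: (cA _ _ (cM _ _ cGF k2) (cM _ _ k3 D2)).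
have eg : g = (fun p => d1 p - d2 p).
  by apply/funext => p; rewrite /g /d1 /d2 opprD addrACA subrr add0r.
split; first by rewrite eg => p; apply: cvgB; [exact: cd1 | exact: cd2].
have i1 : `|\int[leb2]_(p in disc r) d1 p| <= 4 * r * (K * B).
  apply: (@green_x _ r (K * B) q1) => // [x y|p hp]; last first.
    by rewrite normrM; apply: ler_pM => //; exact: (kB p hp).2.
  have T : forall j, taylor (fun z => iC * P' j z) (fun z => iC * P'' j z).
    move=> j z; have [M M0 hM] := PT' j z; exists M => // h h1.
    have -> : iC * P' j (z + h) - iC * P' j z - h * (iC * P'' j z) =
      iC * (P' j (z + h) - P' j z - h * P'' j z) by ring.
    by rewrite cabsM ciC mul1r; exact: hM.
  have h1 := G_dx x y; have h2 := coord_dx x y hk T.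
  rewrite (_ : (fun t => _) = (fun t => G (vecf P (t +i* y))) *
      (fun t => k (vecf (fun j z => iC * P' j z) (t +i* y)))); last first.
    by apply/funext => t; rewrite /q1 iC_vecf fctE.
  apply: is_derive_eq; rewrite /d1 !iC_vecf /=; congr (_ + _).
have i2 : `|\int[leb2]_(p in disc r) d2 p| <= 4 * r * (K * B).
  apply: (@green_y _ r (K * B) q2) => // [x y|p hp]; last first.
    by rewrite normrM; apply: ler_pM => //; exact: (kB p hp).1.
  have h1 := G_dy x y; have h2 := coord_dy x y hk PT'.
  rewrite (_ : (fun t => _) = (fun t => G (vecf P (x +i* t))) *
      (fun t => k (vecf P' (x +i* t)))); last first.
    by apply/funext => t; rewrite /q2 fctE.
  apply: is_derive_eq; rewrite /d2 /=; congr (_ + _).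
rewrite eg RintegralB; first last.
- exact: continuous_disc_integrable.
- exact: continuous_disc_integrable.
- exact: disc_measurable.
apply: le_trans (ler_normB _ _) _.
have -> : 8 * r * (K * B) = 4 * r * (K * B) + 4 * r * (K * B) by ring.
exact: lerD.
Qed.
End Stokes.

(** * The Stokes estimate for 1-forms *)

Section StokesForms.
Context {R : realType}.
Local Notation C := (Cplx R).
Local Notation V := 'rV[C]_2.
Local Notation X := (@torus2 R).

(** A periodic function takes all its values on the compact unit box. *)
Lemma periodic_bounded (h : V -> C) : continuous h ->
  (forall w l, lattice l -> h (w + l) = h w) -> exists2 K : R, 0 <= K & forall w, cabs (h w) <= K.
Proof.
move=> ch ph.
have cc : continuous (fun w => cabs (h w)).
  by move=> w; exact: (cvg_cabs (ch w)).
have := continuous_compact (continuous_subspaceT cc) (@unit_box_compact R).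
move=> /compact_bounded [M [_ hM]]; exists `|M + 1|; first by [].
move=> w; have -> : h w = h (vec_frac w) by rewrite ph //; apply: latticeN; exact: vec_floor_lattice.
rewrite -[leLHS]ger0_norm ?cabs_ge0 //; apply: (hM `|M + 1|).
  by apply: lt_le_trans (ler_norm _); rewrite ltrDl.
by exists (vec_frac w) => //; exact: vec_frac_unit_box.
Qed.

Lemma chart_img_self (w : V) : chart_img (X := X) w w.
Proof.
have -> : chart_img (X := X) w = polydisc w (1 / 4) by exact: tchart_img.
by apply: polydisc_center; lra.
Qed.

Lemma lift1_linear (alpha : preform X 1) (w : V) (c : R) (x y : V) : is_form alpha ->
  lift_form alpha w (vec1 ((c%:C : C) *: x + y)) =
  (c%:C : C) * lift_form alpha w (vec1 x) + lift_form alpha w (vec1 y).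
Proof.
move=> [ml _ _]; have [lin _] := ml w w (chart_img_self w).
have e (v : V) : dfwith (vec1 0) (ord0 : 'I_1) v = vec1 v.
  by apply/funext => a; rewrite (ord1 a) dfwithin.
by have := lin (vec1 0) ord0 c x y; rewrite !e.
Qed.

Lemma lift1_0 (alpha : preform X 1) (w : V) : is_form alpha -> lift_form alpha w (vec1 0) = 0.
Proof.
move=> fa; have := lift1_linear w 1 0 0 fa.
rewrite scale1r addr0 mul1r => /eqP; rewrite -[X in X == _]addr0 (inj_eq (addrI _)).
by move=> /eqP <-.
Qed.

Lemma lift1_basis (alpha : preform X 1) (w v : V) : is_form alpha ->
  lift_form alpha w (vec1 v) =
  \sum_(a <- real_basis) ((a.2 v)%:C : C) * lift_form alpha w (vec1 a.1).
Proof.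
move=> fa; rewrite {1}(real_basisE v).
elim: real_basis => [|a L IH]; first by rewrite !big_nil lift1_0.
by rewrite !big_cons lift1_linear // IH.
Qed.

Lemma real_derive_sum (L : seq (C * (V -> C))) (u w : V) :
  (forall i, (i < size L)%N -> C1 (nth (0, cst 0) L i).2) ->
  (fun h => real_diffquot (fun z => \sum_(a <- L) a.1 * a.2 z) w u h) @ 0^' -->
    \sum_(a <- L) a.1 * real_derive u a.2 w.
Proof.
elim: L => [|a L IH] hL.
  rewrite big_nil (_ : (fun h => _) = cst 0); first exact: cvg_cst.
  by apply/funext => h; rewrite /real_diffquot !big_nil subrr mulr0.
rewrite big_cons.
rewrite (_ : (fun h => _) = (fun h => a.1 * real_diffquot a.2 w u h +
    real_diffquot (fun z => \sum_(a <- L) a.1 * a.2 z) w u h)).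
  apply: cvgD; last by apply: IH => i hi; exact: (hL i.+1).
  have [_ h _] := hL 0%N isT.
  apply: (@continuous_cvg _ _ _ _ _ _ ( *%R a.1)); first exact: mulrl_continuous.
  exact: h.
by apply/funext => h; rewrite /real_diffquot !big_cons; ring.
Qed.

Lemma lift1_derive (alpha : preform X 1) (u v w : V) : is_form alpha ->
  real_derive u (fun z => lift_form alpha z (vec1 v)) w =
  \sum_(a <- real_basis) ((a.2 v)%:C : C) * real_derive u (fun z => lift_form alpha z (vec1 a.1)) w.
Proof.
move=> fa.
pose L := [seq (((a.2 v)%:C : C), (fun z => lift_form alpha z (vec1 a.1))) | a <- real_basis].
have h : (fun h => real_diffquot (fun z => \sum_(a <- L) a.1 * a.2 z) w u h) @ 0^' -->
    \sum_(a <- L) a.1 * real_derive u a.2 w.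
  apply: real_derive_sum => i; rewrite size_map => hi.
  rewrite (nth_map (0, cst 0)) //=; exact: lift_C1.
rewrite !big_map in h; rewrite /real_derive -/(real_derive _ _ _).
apply: cvg_lim; first exact: norm_hausdorff.
rewrite (_ : (fun z => _) = (fun z => \sum_(a <- L) a.1 * a.2 z)) //.
by apply/funext => z; rewrite big_map lift1_basis.
Qed.

Lemma RintegralD4 (r : R) (g1 g2 g3 g4 : R * R -> R) (M : R) : 0 < r ->
  (continuous g1 /\ `|\int[leb2]_(p in disc r) g1 p| <= M) ->
  (continuous g2 /\ `|\int[leb2]_(p in disc r) g2 p| <= M) ->
  (continuous g3 /\ `|\int[leb2]_(p in disc r) g3 p| <= M) ->
  (continuous g4 /\ `|\int[leb2]_(p in disc r) g4 p| <= M) ->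
  `|\int[leb2]_(p in disc r) (g1 p + (g2 p + (g3 p + g4 p)))| <= 4 * M.
Proof.
move=> r0 [c1 h1] [c2 h2] [c3 h3] [c4 h4].
have cA (u v : R * R -> R) : continuous u -> continuous v -> continuous (fun p => u p + v p).
  by move=> cu cv p; apply: cvgD; [exact: cu | exact: cv].
have c34 := cA _ _ c3 c4; have c234 := cA _ _ c2 c34.
have I g : continuous g -> leb2.-integrable (disc r) (EFin \o g).
  by move=> cg; exact: continuous_disc_integrable.
have mD := disc_measurable r.
rewrite (RintegralD mD (I _ c1) (I _ c234)) (RintegralD mD (I _ c2) (I _ c34)).
rewrite (RintegralD mD (I _ c3) (I _ c4)).
apply: le_trans (ler_normD _ _) _; rewrite (_ : 4 * M = M + (M + (M + M))); last by ring.
apply: lerD => //; apply: le_trans (ler_normD _ _) _; apply: lerD => //.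
by apply: le_trans (ler_normD _ _) _; exact: lerD.
Qed.

Variables (P P' P'' : 'I_2 -> C -> C).
Hypothesis PT : forall j, taylor (P j) (P' j).
Hypothesis PT' : forall j, taylor (P' j) (P'' j).
Hypothesis cP'' : forall j, continuous (P'' j).

Lemma ext_deriv_pullback (alpha : preform X 1) (z : C) : is_form alpha ->
  pullback2 (curve P) (ext_deriv alpha) z =
  \sum_(a <- real_basis)
   (((a.2 (iC *: vecf P' z))%:C : C) *
      real_derive (vecf P' z) (fun w => lift_form alpha w (vec1 a.1)) (vecf P z)
    - ((a.2 (vecf P' z))%:C : C) *
      real_derive (iC *: vecf P' z) (fun w => lift_form alpha w (vec1 a.1)) (vecf P z)).
Proof.
move=> fa; rewrite (pullback2_curve PT _ (ext_deriv_periodic fa)).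
by rewrite lift_ext_deriv1 // !(lift1_derive _ _ _ fa) sumrB.
Qed.

Lemma real_basis_sum (F : V * (V -> R) -> C) :
  \sum_(a <- real_basis) F a =
  F (nth (0, cst 0) real_basis 0) + (F (nth (0, cst 0) real_basis 1) +
  (F (nth (0, cst 0) real_basis 2) + F (nth (0, cst 0) real_basis 3))).
Proof. by rewrite /real_basis !big_cons big_nil addr0. Qed.

Lemma Re4 (a b c d : C) : Re (a + (b + (c + d))) = Re a + (Re b + (Re c + Re d)).
Proof. by rewrite !ReD. Qed.
Lemma Im4 (a b c d : C) : Im (a + (b + (c + d))) = Im a + (Im b + (Im c + Im d)).
Proof. by rewrite !ImD. Qed.
Lemma Re_sub_scale (x y : R) (c d : C) :
  Re ((x%:C : C) * c - (y%:C : C) * d) = x * Re c - y * Re d.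
Proof. by rewrite ReB !ReZ. Qed.
Lemma Im_sub_scale (x y : R) (c d : C) :
  Im ((x%:C : C) * c - (y%:C : C) * d) = x * Im c - y * Im d.
Proof. by rewrite ImB !ImZ. Qed.

(** Writing alpha as a combination of the four coordinate differentials reduces
    the estimate to [green_coord]; the constant K bounds the coefficients of alpha,
    which are periodic. *)
Lemma stokes_bound (alpha : preform X 1) : is_form alpha -> exists2 K : R, 0 <= K &
  forall r B, 0 < r -> (forall z j, cabs z <= r -> cabs (P' j z) <= B) ->
  `|Re (disc_current (curve P) r (ext_deriv alpha))| <= 4 * (8 * r * (K * B)) /\
  `|Im (disc_current (curve P) r (ext_deriv alpha))| <= 4 * (8 * r * (K * B)).
Proof.
move=> fa.
have bnd (v : V) : exists2 K : R, 0 <= K & forall w, cabs (lift_form alpha w (vec1 v)) <= K.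
  have [cl _ _] := lift_C1 (vec1 v) fa.
  by apply: periodic_bounded => // w l; exact: is_form_periodic.
have [K K0 hK] : exists2 K : R, 0 <= K & forall i, (i < 4)%N -> forall w,
    cabs (lift_form alpha w (vec1 (nth (0, cst 0) real_basis i).1)) <= K.
  have [k0 p0 h0] := bnd (nth (0, cst 0) real_basis 0).1.
  have [k1 p1 h1] := bnd (nth (0, cst 0) real_basis 1).1.
  have [k2 p2 h2] := bnd (nth (0, cst 0) real_basis 2).1.
  have [k3 p3 h3] := bnd (nth (0, cst 0) real_basis 3).1.
  exists (k0 + k1 + k2 + k3); first by rewrite !addr_ge0.
  by move=> [|[|[|[|i]]]] // _ w; [have := h0 w|have := h1 w|have := h2 w|have := h3 w]; lra.
exists K => // r B r0 hB.
have crd i : (i < 4)%N -> is_coord (nth (0 : V, cst 0 : V -> R) real_basis i).2.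
  by move: i => [|[|[|[|i]]]] // _; eexists; [left|right|left|right].
have cl i := lift_C1 (vec1 (nth (0 : V, cst 0 : V -> R) real_basis i).1) fa.
have cRe (h : V -> C) : C1 h -> continuous (fun w => Re (h w)).
  by move=> [ch _ _] w; have [q _] := (cvgC _ _).1 (ch w).
have cIm (h : V -> C) : C1 h -> continuous (fun w => Im (h w)).
  by move=> [ch _ _] w; have [_ q] := (cvgC _ _).1 (ch w).
have GR i (hi : (i < 4)%N) := green_coord PT PT' cP'' (C1_Re (cl i)) (cRe _ (cl i)) r0
  (crd i hi) (fun w => le_trans (Re_le_cabs _) (hK i hi w)) hB.
have GI i (hi : (i < 4)%N) := green_coord PT PT' cP'' (C1_Im (cl i)) (cIm _ (cl i)) r0
  (crd i hi) (fun w => le_trans (Im_le_cabs _) (hK i hi w)) hB.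
split.
  rewrite /disc_current [Re _]/=.
  have := RintegralD4 r0 (GR 0%N isT) (GR 1%N isT) (GR 2%N isT) (GR 3%N isT).
  congr (`| _ | <= _); apply: eq_Rintegral => p _.
  rewrite (ext_deriv_pullback _ fa) real_basis_sum Re4.
  by congr (_ + (_ + (_ + _))); symmetry; apply: Re_sub_scale.
rewrite /disc_current [Im _]/=.
have := RintegralD4 r0 (GI 0%N isT) (GI 1%N isT) (GI 2%N isT) (GI 3%N isT).
congr (`| _ | <= _); apply: eq_Rintegral => p _.
rewrite (ext_deriv_pullback _ fa) real_basis_sum Im4.
by congr (_ + (_ + (_ + _))); symmetry; apply: Im_sub_scale.
Qed.
End StokesForms.

(** * Extraction of subsequences *)

Section Diagonal.
Context {R : realType}.

(** An ultrafilter finer than the filter at infinity makes all the sequences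
    converge at once. The subsequence is then built one index at a time: step k
    picks an index at which the sequences of code at most k are within 1/(k + 1) of their
    limits, so no nested subsequences are needed. *)
Lemma diagonal_extraction (I : countType) (u : I -> nat -> R) (B : I -> R) :
  (forall i m, `|u i m| <= B i) ->
  exists2 phi : nat -> nat, (forall m, (phi m < phi m.+1)%N) &
    forall i, cvgn (fun m => u i (phi m)).
Proof.
move=> uB; have [U [UU Uoo]] := ultraFilterLemma (@eventually_filter).
have [l hl] : {l : I -> R & forall i, u i @ U --> l i}.
  apply: (@choice I R (fun i x => u i @ U --> x)) => i.
  have FU : U (u i @^-1` `[- B i, B i]).
    apply: (@filterS _ U _ setT) => [m _|]; last exact: filterT.
    by rewrite /= in_itv /=; have := uB i m; rewrite ler_norml.
  have [x [_ clx]] := @segment_compact R (- B i) (B i) (u i @ U) _ FU.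
  exists x => A nA; have [//|hA] := in_ultra_setVsetC (u i @^-1` A) UU.
  by have [y []] := clx (~` A) A hA nA.
have step (k n : nat) : exists m, (n < m)%N /\
    forall i, (pickle i <= k)%N -> `|l i - u i m| < k.+1%:R^-1.
  have h1 : U [set m | (n < m)%N].
    by apply: Uoo; exists n.+1.
  have h2 : U [set m | forall j : 'I_k.+1, forall i, pickle_inv j = Some i -> `|l i - u i m| < k.+1%:R^-1].
    apply: filter_forall => j.
    case: (pickle_inv j) => [i|]; last by apply: (@filterS _ U _ setT) => //; exact: filterT.
    have e0 : 0 < k.+1%:R^-1 :> R by rewrite invr_gt0.
    move: (hl i) => /cvgrPdist_lt /(_ _ e0) h.
    by apply: filterS h => m hm i' [<-].
  have [m [m1 m2]] := filter_ex (filterI h1 h2).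
  exists m; split => // i ik; rewrite -ltnS in ik.
  by apply: (m2 (Ordinal ik)); rewrite /= pickleK_inv.
have [g hg] : {g : nat * nat -> nat & forall x, (x.2 < g x)%N /\
    forall i, (pickle i <= x.1)%N -> `|l i - u i (g x)| < x.1.+1%:R^-1}.
  by apply: (@choice (nat * nat) nat (fun x m => (x.2 < m)%N /\
    forall i, (pickle i <= x.1)%N -> `|l i - u i m| < x.1.+1%:R^-1)) => -[k n]; exact: step.
pose phi := fix phi m := if m is m'.+1 then g (m, phi m') else g (0%N, 0%N).
have phi_near m i : (pickle i <= m)%N -> `|l i - u i (phi m)| < m.+1%:R^-1.
  by case: m => [|m]; [exact: (hg (0%N, 0%N)).2 | exact: (hg (m.+1, phi m)).2].
exists phi => [m|i]; first exact: (hg (m.+1, phi m)).1.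
apply/cvg_ex; exists (l i); apply/cvgrPdist_lt => e e0.
exists (maxn (pickle i) (Num.truncn e^-1)) => // m /=; rewrite geq_max => /andP[m1 m2].
apply: lt_le_trans (phi_near m i m1) _.
rewrite invf_ple ?posrE //; apply: ltW; apply: lt_le_trans (truncnS_gt _) _.
by rewrite ler_nat ltnS.
Qed.

Lemma cvg_by_uniform_approximation (v : nat -> R) :
  (forall e : R, 0 < e -> exists2 s : nat -> R, cvgn s & forall m, `|v m - s m| <= e) -> cvgn v.
Proof.
move=> h; apply: R_complete; apply: cauchy_exP => e e0.
have e3 : 0 < e / 3 by rewrite divr_gt0.
have [s /cvg_ex [l sl] hs] := h _ e3.
exists l; move: sl => /cvgrPdist_lt /(_ _ e3); apply: filterS => m hm.
rewrite /ball /= -(subrK (s m) l) -addrA; apply: le_lt_trans (ler_normD _ _) _.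
by have := hs m; rewrite distrC; lra.
Qed.
End Diagonal.

(** * A grid on the torus *)

Section Cells.
Context {R : realType}.
Local Notation C := (Cplx R).
Local Notation V := 'rV[C]_2.
Local Notation mR := (measurableTypeR R).

(** Position of the fractional part of [x] among N + 1 equal intervals. *)
Definition cell_index (N : nat) (x : R) : nat := Num.truncn ((x - (Num.floor x)%:~R) * N.+1%:R).

Lemma frac_itv (x : R) : 0 <= x - (Num.floor x)%:~R < 1.
Proof.
have /andP[h1 h2] := floor_itv x; rewrite intrD in h2.
by rewrite subr_ge0 h1 ltrBlDl.
Qed.

Lemma cell_index_itv N x :
  (cell_index N x)%:R <= (x - (Num.floor x)%:~R) * N.+1%:R < (cell_index N x).+1%:R.
Proof.
by apply: truncn_itv; rewrite mulr_ge0 //; have /andP[] := frac_itv x.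
Qed.

Lemma cell_index_lt N x : (cell_index N x < N.+1)%N.
Proof.
have /andP[h _] := cell_index_itv N x; have /andP[_ f1] := frac_itv x.
by rewrite -(ltr_nat R); apply: le_lt_trans h _; rewrite gtr_pMl.
Qed.

Lemma cell_index_near N x :
  `|x - (Num.floor x)%:~R - (cell_index N x)%:R / N.+1%:R| <= N.+1%:R^-1.
Proof.
have /andP[h1 h2] := cell_index_itv N x; set y := x - _ in h1 h2 *.
have n0 : 0 < N.+1%:R :> R by [].
have a1 : (cell_index N x)%:R / N.+1%:R <= y by rewrite ler_pdivrMr.
have a2 : y <= (cell_index N x)%:R / N.+1%:R + N.+1%:R^-1.
  by rewrite -[X in _ + X]mul1r -mulrDl ler_pdivlMr // natr1 ltW.
have a3 : 0 < N.+1%:R^-1 :> R by rewrite invr_gt0.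
move: a1 a2 a3; set c := (cell_index N x)%:R / _; set d := _^-1 => a1 a2 a3.
rewrite ler_norml; apply/andP; split; lra.
Qed.

Lemma cell_index_measurable N j : measurable ([set x : R | cell_index N x = j] : set mR).
Proof.
have -> : [set x : R | cell_index N x = j] =
  \bigcup_(n : int) (`[n%:~R + j%:R / N.+1%:R, n%:~R + j.+1%:R / N.+1%:R[%classic `&`
    `[n%:~R, (n + 1)%:~R[%classic).
  have n0 : 0 < N.+1%:R :> R by [].
  rewrite eqEsubset; split=> x /=.
    move=> <-; exists (Num.floor x) => //; have /andP[h1 h2] := cell_index_itv N x.
    split; rewrite /= in_itv /=; last exact: floor_itv.
    rewrite -lerBrDl -ltrBlDl ler_pdivrMr // h1 /=.
    by rewrite ltr_pdivlMr.
  move=> [n _ [/=]]; rewrite !in_itv /= => /andP[h1 h2] /floor_def fx.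
  rewrite /cell_index fx; apply: truncn_def.
  by rewrite -ler_pdivrMr // lerBrDl h1 /= -ltr_pdivlMr // ltrBlDl.
apply: countable_bigcupT_measurable; first exact: countableP.
by move=> n; apply: measurableI; exact: measurable_itv.
Qed.

Definition rcoord (a : 'I_2 * bool) (w : V) : R :=
  if a.2 then Im (w ord0 a.1) else Re (w ord0 a.1).

Definition cell N (w : V) : {ffun 'I_2 * bool -> 'I_N.+1} :=
  [ffun a => inord (cell_index N (rcoord a w))].

Definition cell_rep N (q : {ffun 'I_2 * bool -> 'I_N.+1}) : V :=
  \row_j (((q (j, false))%:R / N.+1%:R) +i* ((q (j, true))%:R / N.+1%:R)).

Lemma cell_rep_near N (w : V) : polydisc (vec_frac w) (3 / N.+1%:R) (cell_rep (cell N w)).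
Proof.
move=> i j; rewrite !mxE (ord1 i) /= !ffunE /rcoord /= !inordK ?cell_index_lt //.
have h1 := cell_index_near N (Re (w ord0 j)); have h2 := cell_index_near N (Im (w ord0 j)).
apply: le_lt_trans (cabs_le _) _; rewrite !ReB !ImB /=.
have n0 : 0 < N.+1%:R^-1 :> R by rewrite invr_gt0.
rewrite (_ : 3 / _ = N.+1%:R^-1 + N.+1%:R^-1 + N.+1%:R^-1); last by ring.
by apply: le_lt_trans (lerD h1 h2) _; rewrite ltrDl.
Qed.

Lemma unit_box_uniform (h : V -> R) (e : R) : continuous h -> 0 < e ->
  \forall N \near \oo, forall w, unit_box w -> forall v, polydisc w (3 / N.+1%:R) v -> `|h w - h v| <= e.
Proof.
move=> ch e0.
have := @unit_box_compact R; rewrite compact_near_coveringP => nc.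
apply: (nc nat \oo (fun N w => forall v, polydisc w (3 / N.+1%:R) v -> `|h w - h v| <= e)).
move=> x _; have e2 : 0 < e / 2 by rewrite divr_gt0.
have := ch x => /cvgrPdist_lt /(_ _ e2) /nbhs_polydisc [d d0 hd].
have n1 : nbhs x (polydisc x (d / 2)) by apply/nbhs_polydisc; exists (d / 2) => //; rewrite divr_gt0.
have n2 : \forall N \near \oo, 3 / N.+1%:R < d / 2.
  exists (Num.truncn (3 / (d / 2))) => // N /= hN.
  rewrite ltr_pdivrMr // mulrC -ltr_pdivrMr ?divr_gt0 //.
  by apply: lt_le_trans (truncnS_gt _) _; rewrite ler_nat ltnS.
exists (polydisc x (d / 2), [set N | 3 / N.+1%:R < d / 2]); first by split.
move=> [w N] /= [hw hN] v hv.
have h1 : `|h x - h w| < e / 2.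
  by apply: hd => i j; apply: lt_trans (hw i j) _; lra.
have h2 : `|h x - h v| < e / 2.
  apply: hd => i j; rewrite -(subrK (w i j) (x i j)) -addrA.
  apply: le_lt_trans (cabsD _ _) _; have := hw i j; have := lt_trans (hv i j) hN; clear; lra.
rewrite -(subrK (h x) (h w)) -addrA; apply: le_trans (ler_normD _ _) _.
rewrite distrC; lra.
Qed.

(** A continuous periodic function is uniformly continuous, by compactness of the
    unit box, so it is nearly constant on the cells of a fine grid. *)
Lemma cell_approx (h : V -> R) (e : R) : continuous h ->
  (forall w l, lattice l -> h (w + l) = h w) -> 0 < e ->
  exists N, forall w, `|h w - h (cell_rep (cell N w))| <= e.
Proof.
move=> ch ph e0; have [N hN] := filter_ex (unit_box_uniform ch e0).
exists N => w; have -> : h w = h (vec_frac w).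
  by rewrite ph //; apply: latticeN; exact: vec_floor_lattice.
by apply: hN; [exact: vec_frac_unit_box | exact: cell_rep_near].
Qed.

Lemma cell_measurable N (F : R * R -> V) (q : {ffun 'I_2 * bool -> 'I_N.+1}) : continuous F ->
  measurable ([set p | cell N (F p) = q] : set (mR * mR)).
Proof.
move=> cF.
have -> : [set p | cell N (F p) = q] =
  \bigcap_(a in [set: 'I_2 * bool]) [set p | cell_index N (rcoord a (F p)) = q a].
  rewrite eqEsubset; split=> p /=.
    by move=> <- a _; rewrite ffunE inordK ?cell_index_lt.
  by move=> hp; apply/ffunP => a; rewrite ffunE; apply: val_inj; rewrite /= inordK ?cell_index_lt ?hp.
apply: fin_bigcap_measurable; first exact: finite_finset.
move=> a _.
have ca : continuous (fun p => rcoord a (F p)).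
  move=> p; have /cvgV /(_ ord0 a.1) /cvgC [h1 h2] := cF p.
  by rewrite /rcoord; case: (a.2).
have := continuous_measurable2 ca measurableT (cell_index_measurable N (q a)).
by rewrite setTI.
Qed.
End Cells.

(** * Weak compactness of measures carried by the discs *)

Section WeakLimit.
Context {R : realType}.
Local Notation C := (Cplx R).
Local Notation V := 'rV[C]_2.
Local Notation mR := (measurableTypeR R).

Lemma Rintegral_linear_sum (r : R) (I : eqType) (s : seq I) (c : I -> R) (g : I -> R * R -> R) : 0 < r ->
  (forall i, leb2.-integrable (disc r) (EFin \o g i)) ->
  leb2.-integrable (disc r) (EFin \o (fun p => \sum_(i <- s) c i * g i p)) /\
  \int[leb2]_(p in disc r) (\sum_(i <- s) c i * g i p) =
  \sum_(i <- s) c i * \int[leb2]_(p in disc r) g i p.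
Proof.
move=> r0 ig; have mD := disc_measurable r.
elim: s => [|i s [IH1 IH2]].
  split.
    rewrite (_ : EFin \o _ = cst 0%E); first exact: integrable0.
    by apply/funext => p /=; rewrite big_nil.
  rewrite big_nil; under eq_Rintegral do rewrite big_nil.
  by rewrite Rintegral_cst // mul0r.
have e : (fun p => \sum_(j <- i :: s) c j * g j p) = (fun p => c i * g i p + \sum_(j <- s) c j * g j p).
  by apply/funext => p; rewrite big_cons.
have ii : leb2.-integrable (disc r) (EFin \o (fun p => c i * g i p)).
  by have := integrableZl mD (c i) (ig i).
rewrite e; split.
  by have := integrableD mD ii IH1.
by rewrite (RintegralD mD ii IH1) IH2 big_cons RintegralZl.
Qed.

Variable e : R * R -> R.
Hypothesis ce : continuous e.

Lemma integral_dominated (r c : R) (g : R * R -> R) : 0 < r -> 0 <= c ->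
  measurable_fun setT (g : mR * mR -> R) -> (forall p, `|g p| <= c * e p) ->
  leb2.-integrable (disc r) (EFin \o g) /\
  `|\int[leb2]_(p in disc r) g p| <= c * \int[leb2]_(p in disc r) e p.
Proof.
move=> r0 c0 mg hg; have mD := disc_measurable r.
have [M M0 hM] := continuous_disc_bounded r ce.
have bd p : disc r p -> `|g p| <= c * M.
  move=> /(disc_sub_rect r0) /hM h; apply: le_trans (hg p) _.
  by apply: ler_wpM2l => //; apply: le_trans (ler_norm _) h.
have ig := disc_integrable r0 mg bd.
split => //; apply: le_trans (le_normr_Rintegral mD ig) _.
have ie := continuous_disc_integrable r0 ce.
rewrite -RintegralZl //; apply: le_Rintegral => //.
- apply: (@disc_integrable _ r (c * M)) => //; first exact: measurableT_comp.
  by move=> p hp; rewrite normr_id; exact: bd.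
- by have := integrableZl mD c ie.
Qed.

Variables (F : R * R -> V) (K : finType) (d : K -> R * R -> R) (rr : nat -> R).
Hypothesis cF : continuous F.
Hypothesis cd : forall k, continuous (d k).
Hypothesis de : forall k p, `|d k p| <= e p.
Hypothesis rr0 : forall m, 0 < rr m.
Let A m := \int[leb2]_(p in disc (rr m)) e p.
Hypothesis A0 : forall m, 0 < A m.

Let cellset N (q : {ffun 'I_2 * bool -> 'I_N.+1}) : set (R * R) := [set p | cell N (F p) = q].

(** The measures d_k(p) dp / A(m), pushed forward to the torus by [F], have mass at
    most 1. The extraction makes the mass of every cell of every grid converge, and
    approximation by step functions on the cells does the rest. Cells need to be
    measurable only, so their boundaries cause no trouble. *)
Lemma weak_limit : exists2 phi : nat -> nat, (forall m, (phi m < phi m.+1)%N) &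
  forall k (h : V -> R), continuous h -> (forall w l, lattice l -> h (w + l) = h w) ->
  cvgn (fun m => (\int[leb2]_(p in disc (rr (phi m))) (h (F p) * d k p)) / A (phi m)).
Proof.
(* The countable index set: a mesh N, a cell of that mesh, and a density. *)
pose I : countType := ({N : nat & {ffun 'I_2 * bool -> 'I_N.+1}} * K)%type.
pose g (x : I) (p : R * R) : R := \1_(cellset (tagged x.1)) p * d x.2 p.
have mg x : measurable_fun setT (g x : mR * mR -> R).
  apply: measurable_funM; last exact: continuous_measurable2.
  by apply: measurable_indic; exact: cell_measurable.
have gle x p : `|g x p| <= 1 * e p.
  rewrite mul1r; apply: le_trans (de x.2 p); rewrite /g indicE normrM.
  by case: (_ \in _); rewrite ?normr1 ?mul1r // normr0 mul0r.
pose u (x : I) m := (\int[leb2]_(p in disc (rr m)) g x p) / A m.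
have ub x m : `|u x m| <= 1.
  rewrite /u normrM normfV (gtr0_norm (A0 m)) ler_pdivrMr // .
  exact: (integral_dominated (rr0 m) ler01 (mg x) (gle x)).2.
have [phi hphi cphi] := diagonal_extraction ub.
exists phi => // k h ch ph; apply: cvg_by_uniform_approximation => eps eps0.
have [N hN] := cell_approx ch ph eps0.
pose T := {ffun 'I_2 * bool -> 'I_N.+1}.
pose x (q : T) : I := (Tagged (fun N => {ffun 'I_2 * bool -> 'I_N.+1}) q, k).
exists (fun m => \sum_(q <- enum T) h (cell_rep q) * u (x q) (phi m)).
  elim: (enum T) => [|q s IH].
    by under eq_fun do rewrite big_nil; exact: is_cvg_cst.
  rewrite (_ : (fun m => _) = (fun m => h (cell_rep q) * u (x q) (phi m) +
      \sum_(q <- s) h (cell_rep q) * u (x q) (phi m))).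
    by apply: is_cvgD => //; apply: is_cvgM; [exact: is_cvg_cst | exact: cphi].
  by apply/funext => m; rewrite big_cons.
move=> m; set n := phi m.
have r0 := rr0 n; have mD := disc_measurable (rr n).
have ig q := (integral_dominated r0 ler01 (mg (x q)) (gle (x q))).1.
have [is1 is2] := Rintegral_linear_sum (enum T) (fun q => h (cell_rep q)) r0 ig.
have ih : leb2.-integrable (disc (rr n)) (EFin \o (fun p => h (F p) * d k p)).
  apply: continuous_disc_integrable => // p; apply: cvgM; last exact: cd.
  by apply: (@continuous_comp _ _ _ F h); [exact: cF | exact: ch].
have -> : \sum_(q <- enum T) h (cell_rep q) * u (x q) n =
    (\int[leb2]_(p in disc (rr n)) \sum_(q <- enum T) h (cell_rep q) * g (x q) p) / A n.
  by rewrite is2 mulr_suml; apply: eq_bigr => q _; rewrite /u mulrA.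
rewrite -mulrBl -RintegralB // normrM normfV (gtr0_norm (A0 n)) ler_pdivrMr //.
have bound p : `|h (F p) * d k p - \sum_(q <- enum T) h (cell_rep q) * g (x q) p| <= eps * e p.
  have -> : \sum_(q <- enum T) h (cell_rep q) * g (x q) p = h (cell_rep (cell N (F p))) * d k p.
    rewrite (bigD1_seq (cell N (F p))) ?mem_enum ?enum_uniq //= big1 ?addr0.
      by rewrite /g indicE mem_set // mul1r.
    move=> q hq; rewrite /g indicE memNset ?mul0r ?mulr0 // => /= hq'.
    by move: hq; rewrite hq' eqxx.
  by rewrite -mulrBl normrM; apply: ler_pM.
apply: (integral_dominated r0 (ltW eps0) _ bound).2.
apply: measurable_funB.
  apply: continuous_measurable2 => p; apply: cvgM; last exact: cd.
  by apply: (@continuous_comp _ _ _ F h); [exact: cF | exact: ch].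
elim: (enum T) => [|q s IH].
  by under eq_fun do rewrite big_nil; exact: measurable_cst.
rewrite (_ : (fun p => _) = (fun p => h (cell_rep q) * g (x q) p +
    \sum_(q <- s) h (cell_rep q) * g (x q) p)).
  apply: measurable_funD => //; apply: measurable_funM => //.
by apply/funext => p; rewrite big_cons.
Qed.
End WeakLimit.

(** * Forms with constant coefficients *)

Section ConstForm.
Context {R : realType}.
Local Notation C := (Cplx R).
Local Notation V := 'rV[C]_2.
Local Notation X := (@torus2 R).

(** The area form dx /\ dy of C, on the real vectors [u] and [v]. *)
Definition real_area (u v : C) : R := Re u * Im v - Im u * Re v.
Definition j1 : 'I_2 := lift ord0 ord0.

(** c0 dx_0 /\ dy_0 + c1 dx_1 /\ dy_1. *)
Definition const_form (c0 c1 : R) : preform X 2 := fun _ _ v =>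
  (c0 * real_area (v ord0 ord0 ord0) (v j1 ord0 ord0) +
   c1 * real_area (v ord0 ord0 j1) (v j1 ord0 j1))%:C.

Lemma real_derive_cst (c : C) (v : V) : real_derive v (cst c : V -> C) = cst 0.
Proof.
apply/funext => z; rewrite /real_derive (_ : real_diffquot _ z v = cst 0).
  by apply: cvg_lim; [exact: norm_hausdorff | exact: cvg_cst].
by apply/funext => h; rewrite /real_diffquot /cst subrr mulr0.
Qed.

Lemma real_derives_cst (ds : seq V) (c : C) : exists c', real_derives ds (cst c : V -> C) = cst c'.
Proof.
elim: ds => [|v ds [c' IH]]; first by exists c.
by exists 0; rewrite /= IH real_derive_cst.
Qed.

Lemma smooth_on_cst (U : set V) (c : C) : smooth_on U (cst c).
Proof.
move=> ds z _; have [c' ->] := real_derives_cst ds c; split.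
  exact: cst_continuous.
move=> v; apply/cvg_ex; exists 0.
rewrite (_ : real_diffquot _ z v = cst 0); first exact: cvg_cst.
by apply/funext => h; rewrite /real_diffquot /cst subrr mulr0.
Qed.

Lemma ord2P (P : 'I_2 -> Prop) : P ord0 -> P j1 -> forall j, P j.
Proof. by move=> h0 h1 j; case: (unliftP ord0 j) => [j' ->|->] //; rewrite (ord1 j'). Qed.

Lemma const_form_is_form c0 c1 : is_form (const_form c0 c1).
Proof.
split.
- move=> i z _; split.
    move=> v a c x y; move: a; apply: ord2P; rewrite /const_form.
      rewrite !dfwithin !dfwithout //.
      apply: C_ext; rewrite ?ReD ?ImD ?ReZ ?ImZ /= ?mulr0 ?addr0 //.
      by rewrite /real_area !mxE !ReD !ImD !ReZ !ImZ; ring.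
    rewrite !dfwithin !dfwithout //.
    apply: C_ext; rewrite ?ReD ?ImD ?ReZ ?ImZ /= ?mulr0 ?addr0 //.
    by rewrite /real_area !mxE !ReD !ImD !ReZ !ImZ; ring.
  move=> v a b ab vab.
  have e : v ord0 = v j1.
    by move: a b ab vab; apply: ord2P; apply: ord2P.
  rewrite /const_form e; apply: C_ext => //=; rewrite /real_area; ring.
- by move=> i v; exact: smooth_on_cst.
- move=> i j z v im; have [l hl h] := ttransition_near im.
  have [_ de] := differentiable_near_translation h.
  by rewrite /const_form de.
Qed.

Lemma const_form_bidegree c0 c1 : of_bidegree 1 1 (const_form c0 c1).
Proof.
move=> i z v lam _; rewrite !expr1 /const_form.
apply: C_ext.
  rewrite Re_mulc Re_mulc Im_mulc /= mulr0 subr0 /real_area !mxE !Re_mulc !Im_mulc.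
  by case: lam => a b /=; ring.
rewrite Im_mulc Re_mulc Im_mulc /= mulr0 add0r.
by case: lam => a b /=; ring.
Qed.

Lemma const_form_ext_deriv c0 c1 : ext_deriv (const_form c0 c1) = (fun _ _ _ => 0).
Proof.
apply/funext => i; apply/funext => z; apply/funext => v.
rewrite /ext_deriv big1 // => a _.
rewrite (_ : (fun z' => _) = cst (const_form c0 c1 i 0 (v \o lift a))) //.
by rewrite real_derive_cst mulr0.
Qed.

Lemma real_area_iC (u : C) : real_area u (iC * u) = cabs u ^+ 2.
Proof. by rewrite cabs_sqr /real_area Re_mulc Im_mulc /=; ring. Qed.

(** On a complex line the form gives a weighted sum of squares, hence positivity. *)
Lemma const_form_diag c0 c1 i z (v : V) :
  const_form c0 c1 i z (vec2 v (iC *: v)) =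
  (c0 * cabs (v ord0 ord0) ^+ 2 + c1 * cabs (v ord0 j1) ^+ 2)%:C.
Proof. by rewrite /const_form /vec2 /= !mxE !real_area_iC. Qed.

Definition omega0 : preform X 2 := const_form 1 1.

Lemma omega0_area : area_form omega0.
Proof.
split; [exact: const_form_is_form | exact: const_form_bidegree |].
move=> i z v _ v0; rewrite /omega0 const_form_diag !mul1r -[0]/((0 : R)%:C) ltC_real.
rewrite lt_neqAle addr_ge0 ?sqr_ge0 // andbT eq_sym.
apply: contra v0; rewrite paddr_eq0 ?sqr_ge0 // !sqrf_eq0 !cabs_eq0 => /andP[/eqP h0 /eqP h1].
apply/eqP/matrixP => i' j; rewrite (ord1 i') mxE; move: j; exact: ord2P.
Qed.
End ConstForm.

(** * Currents of integration in coordinates *)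

Section Currents.
Context {R : realType}.
Local Notation C := (Cplx R).
Local Notation V := 'rV[C]_2.
Local Notation X := (@torus2 R).

Variables (P P' P'' : 'I_2 -> C -> C).
Hypothesis PT : forall j, taylor (P j) (P' j).
Hypothesis PT' : forall j, taylor (P' j) (P'' j).

(** |f'|^2, the density of the area of the curve. *)
Definition energy (p : R * R) : R := cabs (P' ord0 (plane_C p)) ^+ 2 + cabs (P' j1 (plane_C p)) ^+ 2.

Let cP j : continuous (P j). Proof. exact: taylor_continuous (PT j). Qed.
Let cP' j : continuous (P' j). Proof. exact: taylor_continuous (PT' j). Qed.

Lemma continuous_sqr_cabs (Q : C -> C) : continuous Q -> continuous (fun p : R * R => cabs (Q (plane_C p)) ^+ 2).
Proof.
move=> cQ; have [h1 h2] := continuous_plane_C cQ.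
rewrite (_ : (fun p => _) = (fun p => Re (Q (plane_C p)) * Re (Q (plane_C p)) + Im (Q (plane_C p)) * Im (Q (plane_C p)))).
  by move=> p; apply: cvgD; apply: cvgM; (exact: h1 || exact: h2).
by apply/funext => p; rewrite cabs_sqr.
Qed.

Lemma energy_continuous : continuous energy.
Proof. by move=> p; apply: cvgD; exact: continuous_sqr_cabs. Qed.

Definition basis_at (i : nat) : V * (V -> R) := nth (0, cst 0) real_basis i.

Lemma real_basis_ord (F : V * (V -> R) -> C) :
  \sum_(a <- real_basis) F a = \sum_(i < 4) F (basis_at i).
Proof. by rewrite (big_nth (0, cst 0)) big_mkord. Qed.

Lemma lift2_linear (eta : preform X 2) (w : V) : is_form eta ->
  (forall y (c : R) x x', lift_form eta w (vec2 ((c%:C : C) *: x + x') y) =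
    (c%:C : C) * lift_form eta w (vec2 x y) + lift_form eta w (vec2 x' y)) /\
  (forall y (c : R) x x', lift_form eta w (vec2 y ((c%:C : C) *: x + x')) =
    (c%:C : C) * lift_form eta w (vec2 y x) + lift_form eta w (vec2 y x')).
Proof.
move=> [ml _ _]; have [lin _] := ml w w (chart_img_self w).
have d0 (x y z : V) : dfwith (vec2 x y) (ord0 : 'I_2) z = vec2 z y.
  by apply/funext; apply: ord2P; rewrite ?dfwithin ?dfwithout.
have d1 (x y z : V) : dfwith (vec2 x y) j1 z = vec2 x z.
  by apply/funext; apply: ord2P; rewrite ?dfwithin ?dfwithout.
split=> y c x x'.
  by have := lin (vec2 0 y) ord0 c x x'; rewrite !d0.
by have := lin (vec2 y 0) j1 c x x'; rewrite !d1.
Qed.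

Lemma lift2_antisym (eta : preform X 2) (w x y : V) : is_form eta ->
  lift_form eta w (vec2 y x) = - lift_form eta w (vec2 x y).
Proof.
move=> fe; have [L0 L1] := lift2_linear w fe; have [ml _ _] := fe.
have [_ alt] := ml w w (chart_img_self w).
have alt0 (v : V) : lift_form eta w (vec2 v v) = 0 by exact: (alt (vec2 v v) ord0 j1).
have := alt0 (1 *: x + y); rewrite (L0 _ 1) !(L1 _ 1) !mul1r !alt0 add0r addr0.
by move/eqP; rewrite addr_eq0 => /eqP ->; rewrite opprK.
Qed.

Lemma lift2_basis (eta : preform X 2) (w u v : V) : is_form eta ->
  lift_form eta w (vec2 u v) =
  \sum_(k : 'I_4 * 'I_4) (((basis_at k.1).2 u * (basis_at k.2).2 v)%:C : C) *
     lift_form eta w (vec2 (basis_at k.1).1 (basis_at k.2).1).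
Proof.
move=> fe; have [L0 L1] := lift2_linear w fe.
have additive0 (f : V -> C) : (forall (c : R) (x x' : V), f ((c%:C : C) *: x + x') = (c%:C : C) * f x + f x') ->
    f 0 = 0.
  move=> hf; have := hf 1 0 0; rewrite scale1r addr0 mul1r => /eqP.
  by rewrite -[X in X == _]addr0 (inj_eq (addrI _)) => /eqP <-.
have exp (f : V -> C) x : (forall (c : R) (x x' : V), f ((c%:C : C) *: x + x') = (c%:C : C) * f x + f x') ->
    f x = \sum_(i < 4) (((basis_at i).2 x)%:C : C) * f (basis_at i).1.
  move=> hf; rewrite {1}(real_basisE x) -(real_basis_ord (fun a => ((a.2 x)%:C : C) * f a.1)).
  elim: real_basis => [|a L IH]; first by rewrite !big_nil additive0.
  by rewrite !big_cons hf IH.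
rewrite (exp (fun x => lift_form eta w (vec2 x v))) //.
under eq_bigr do rewrite (exp (fun y => lift_form eta w (vec2 _ y)) v (L1 _)) mulr_sumr.
rewrite pair_big; apply: eq_bigr => -[i j] _ /=.
by rewrite mulrA rmorphM.
Qed.

(** The coefficients of a 2-form in the real basis. All sixteen pairs are kept,
    which avoids antisymmetrization at the price of redundancy. *)
Definition form_coef (eta : preform X 2) (k : 'I_4 * 'I_4) (w : V) : C :=
  lift_form eta w (vec2 (basis_at k.1).1 (basis_at k.2).1).

(** The coefficient on dx /\ dy of the pull-back of the product of two coordinate
    functions; like every quadratic expression in f' it is bounded by the energy. *)
Definition density (k : 'I_4 * 'I_4) (p : R * R) : R :=
  (basis_at k.1).2 (vecf P' (plane_C p)) * (basis_at k.2).2 (iC *: vecf P' (plane_C p)).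

Lemma basis_at_coord (i : 'I_4) : is_coord (basis_at i).2.
Proof. by case: i => -[|[|[|[|i]]]] //= _; eexists; [left|right|left|right]. Qed.

Lemma pullback_sum (eta : preform X 2) (p : R * R) : is_form eta ->
  pullback2 (curve P) eta (plane_C p) = \sum_k ((density k p)%:C : C) * form_coef eta k (vecf P (plane_C p)).
Proof. by move=> fe; rewrite (pullback2_curve PT _ (is_form_periodic fe)) lift2_basis. Qed.

Lemma density_continuous k : continuous (density k).
Proof.
have iP' : forall j, continuous (fun z => iC * P' j z) by move=> j; exact: iC_continuous.
have h1 := coord_continuous (basis_at_coord k.1) cP'.
have h2 := coord_continuous (basis_at_coord k.2) iP'.
have e : density k = (fun p => (basis_at k.1).2 (vecf P' (plane_C p)) * (basis_at k.2).2 (vecf (fun j z => iC * P' j z) (plane_C p))).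
  by apply/funext => p; rewrite /density iC_vecf.
by rewrite e => p; apply: cvgM; [exact: h1 | exact: h2].
Qed.

Lemma coord_sqr_le (k : V -> R) (p : R * R) : is_coord k ->
  k (vecf P' (plane_C p)) ^+ 2 <= energy p /\ k (iC *: vecf P' (plane_C p)) ^+ 2 <= energy p.
Proof.
have q (z : C) : Re z ^+ 2 <= cabs z ^+ 2 /\ Im z ^+ 2 <= cabs z ^+ 2.
  by rewrite cabs_sqr lerDl lerDr !sqr_ge0.
have ci (z : C) : cabs (iC * z) = cabs z.
  by rewrite cabsM /cabs /= expr0n expr1n add0r sqrtr1 mul1r.
have le_e j : cabs (P' j (plane_C p)) ^+ 2 <= energy p.
  by move: j; apply: ord2P; rewrite /energy ?lerDl ?lerDr sqr_ge0.
move=> [j [->|->]]; rewrite !mxE; split.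
- exact: le_trans (q _).1 (le_e j).
- by apply: le_trans (q _).1 _; rewrite ci; exact: le_e.
- exact: le_trans (q _).2 (le_e j).
- by apply: le_trans (q _).2 _; rewrite ci; exact: le_e.
Qed.

Lemma density_le k p : `|density k p| <= energy p.
Proof.
have [h1 _] := coord_sqr_le p (basis_at_coord k.1); have [_ h2] := coord_sqr_le p (basis_at_coord k.2).
rewrite /density ler_norml; apply/andP; split; nra.
Qed.

Lemma form_coef_continuous (eta : preform X 2) k : is_form eta -> continuous (form_coef eta k).
Proof. by move=> fe; have [] := lift_C1 (vec2 (basis_at k.1).1 (basis_at k.2).1) fe. Qed.

Lemma form_coef_periodic (eta : preform X 2) k w l : is_form eta -> lattice l ->
  form_coef eta k (w + l) = form_coef eta k w.
Proof. by move=> fe hl; exact: lift_periodic. Qed.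

Lemma form_coef_Re_continuous eta k : is_form eta -> continuous (fun w => Re (form_coef eta k w)).
Proof. by move=> fe w; have /cvgC[] := @form_coef_continuous eta k fe w. Qed.
Lemma form_coef_Im_continuous eta k : is_form eta -> continuous (fun w => Im (form_coef eta k w)).
Proof. by move=> fe w; have /cvgC[] := @form_coef_continuous eta k fe w. Qed.

Lemma RIm_scale_sum (K : finType) (d : K -> R) (h : K -> C) :
  Re (\sum_k ((d k)%:C : C) * h k) = \sum_k 1 * (Re (h k) * d k) /\
  Im (\sum_k ((d k)%:C : C) * h k) = \sum_k 1 * (Im (h k) * d k).
Proof.
rewrite Re_sum Im_sum; split; apply: eq_bigr => k _; rewrite mul1r.
  by rewrite ReZ mulrC.
by rewrite ImZ mulrC.
Qed.

Lemma weighted_integrable (r : R) (h : V -> R) k : 0 < r -> continuous h ->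
  leb2.-integrable (disc r) (EFin \o (fun p => h (vecf P (plane_C p)) * density k p)).
Proof.
move=> r0 ch; apply: continuous_disc_integrable => // p; apply: cvgM; last exact: density_continuous.
by apply: (@continuous_comp _ _ _ (fun p : R * R => vecf P (plane_C p)) h);
  [exact: vecf_plane_continuous | exact: ch].
Qed.

Lemma disc_current_sum (eta : preform X 2) (r : R) : 0 < r -> is_form eta ->
  Re (disc_current (curve P) r eta) =
    \sum_k \int[leb2]_(p in disc r) (Re (form_coef eta k (vecf P (plane_C p))) * density k p) /\
  Im (disc_current (curve P) r eta) =
    \sum_k \int[leb2]_(p in disc r) (Im (form_coef eta k (vecf P (plane_C p))) * density k p).
Proof.
move=> r0 fe.
have iR k := @weighted_integrable r _ k r0 (@form_coef_Re_continuous eta k fe).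
have iI k := @weighted_integrable r _ k r0 (@form_coef_Im_continuous eta k fe).
have [_ sR] := Rintegral_linear_sum (index_enum ('I_4 * 'I_4)%type) (fun=> 1) r0 iR.
have [_ sI] := Rintegral_linear_sum (index_enum ('I_4 * 'I_4)%type) (fun=> 1) r0 iI.
have e1 (f : 'I_4 * 'I_4 -> R) : \sum_k 1 * f k = \sum_k f k.
  by apply: eq_bigr => k _; rewrite mul1r.
rewrite [in RHS]e1 in sR; rewrite [in RHS]e1 in sI.
split.
  rewrite /disc_current [LHS]/= -sR; apply: eq_Rintegral => p _.
  by rewrite -[p.1 +i* p.2]/(plane_C p) (pullback_sum p fe) (RIm_scale_sum _ _).1.
rewrite /disc_current [LHS]/= -sI; apply: eq_Rintegral => p _.
by rewrite -[p.1 +i* p.2]/(plane_C p) (pullback_sum p fe) (RIm_scale_sum _ _).2.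
Qed.

Lemma pullback_continuous (eta : preform X 2) : is_form eta ->
  continuous (fun p => Re (pullback2 (curve P) eta (plane_C p))) /\
  continuous (fun p => Im (pullback2 (curve P) eta (plane_C p))).
Proof.
move=> fe.
have cs (h : 'I_4 * 'I_4 -> V -> R) : (forall k, continuous (h k)) ->
    continuous (fun p => \sum_k 1 * (h k (vecf P (plane_C p)) * density k p)).
  move=> ch; elim: (index_enum _) => [|k s IH].
    by rewrite (_ : (fun p => _) = cst 0); [exact: cst_continuous | apply/funext => p; rewrite big_nil].
  rewrite (_ : (fun p => _) = (fun p => h k (vecf P (plane_C p)) * density k p +
     \sum_(k <- s) 1 * (h k (vecf P (plane_C p)) * density k p))).
    move=> p; apply: cvgD; last exact: IH.
    apply: cvgM; last exact: density_continuous.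
    by apply: (@continuous_comp _ _ _ (fun p : R * R => vecf P (plane_C p)) (h k));
      [exact: vecf_plane_continuous | exact: ch].
  by apply/funext => p; rewrite big_cons mul1r.
split.
  rewrite (_ : (fun p => _) = (fun p => \sum_k 1 * (Re (form_coef eta k (vecf P (plane_C p))) * density k p))).
    by apply: (cs (fun k w => Re (form_coef eta k w))) => k; exact: form_coef_Re_continuous.
  by apply/funext => p; rewrite (pullback_sum p fe) (RIm_scale_sum _ _).1.
rewrite (_ : (fun p => _) = (fun p => \sum_k 1 * (Im (form_coef eta k (vecf P (plane_C p))) * density k p))).
  by apply: (cs (fun k w => Im (form_coef eta k w))) => k; exact: form_coef_Im_continuous.
by apply/funext => p; rewrite (pullback_sum p fe) (RIm_scale_sum _ _).2.
Qed.
End Currents.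

(** * Area and boundary length *)

Section AreaLength.
Context {R : realType}.
Local Notation C := (Cplx R).
Local Notation V := 'rV[C]_2.
Local Notation X := (@torus2 R).

Variables (P P' P'' : 'I_2 -> C -> C).
Hypothesis PT : forall j, taylor (P j) (P' j).
Hypothesis PT' : forall j, taylor (P' j) (P'' j).

Let cP' j : continuous (P' j). Proof. exact: taylor_continuous (PT' j). Qed.

Definition total_energy (r : R) : R := \int[leb2]_(p in disc r) energy P' p.

(** The current of integration has order 0, and its mass is at most a constant times
    the area, the constant being the same for all radii. *)
Lemma disc_current_bound (eta : preform X 2) (r eps : R) : 0 < r -> 0 <= eps -> is_form eta ->
  (forall k w, cabs (form_coef eta k w) <= eps) ->
  `|Re (disc_current (curve P) r eta)| <= 16 * (eps * total_energy r) /\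
  `|Im (disc_current (curve P) r eta)| <= 16 * (eps * total_energy r).
Proof.
move=> r0 e0 fe hb; have [-> ->] := disc_current_sum PT PT' r0 fe.
have ce := energy_continuous PT'.
have main (h : 'I_4 * 'I_4 -> V -> R) : (forall k, continuous (h k)) -> (forall k w, `|h k w| <= eps) ->
    `|\sum_k \int[leb2]_(p in disc r) (h k (vecf P (plane_C p)) * density P' k p)| <= 16 * (eps * total_energy r).
  move=> ch hh; apply: le_trans (ler_norm_sum _ _ _) _.
  apply: (@le_trans _ _ (\sum_(k : 'I_4 * 'I_4) eps * total_energy r)).
    apply: ler_sum => k _.
    apply: (integral_dominated ce r0 e0 _ _).2.
      apply: continuous_measurable2 => p; apply: cvgM; last exact: (density_continuous PT').
      apply: (@continuous_comp _ _ _ (fun p : R * R => vecf P (plane_C p)) (h k)); last exact: ch.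
      by apply: vecf_plane_continuous => j; exact: taylor_continuous (PT j).
    by move=> p; rewrite normrM; apply: ler_pM => //; exact: density_le.
  by rewrite sumr_const card_prod card_ord -[leLHS]mulr_natl.
split.
  apply: (main (fun k w => Re (form_coef eta k w))) => k; first exact: form_coef_Re_continuous.
  by move=> w; exact: le_trans (Re_le_cabs _) (hb k w).
apply: (main (fun k w => Im (form_coef eta k w))) => k; first exact: form_coef_Im_continuous.
by move=> w; exact: le_trans (Im_le_cabs _) (hb k w).
Qed.

Lemma pullback2_scale_add (c : C) (eta theta : preform X 2) z :
  pullback2 (curve P) (c *: eta + theta) z = c * pullback2 (curve P) eta z + pullback2 (curve P) theta z.
Proof. by []. Qed.

Lemma disc_current_linear (c : C) (eta theta : preform X 2) (r : R) : 0 < r ->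
  is_form eta -> is_form theta ->
  disc_current (curve P) r (c *: eta + theta) =
  c * disc_current (curve P) r eta + disc_current (curve P) r theta.
Proof.
move=> r0 fe ft.
have [ceR ceI] := pullback_continuous PT PT' fe.
have [ctR ctI] := pullback_continuous PT PT' ft.
have I := fun g cg => @continuous_disc_integrable R r g r0 cg.
have mD := disc_measurable r.
have main (g1 g2 g3 : R * R -> R) (a b : R) : continuous g1 -> continuous g2 -> continuous g3 ->
    \int[leb2]_(p in disc r) (a * g1 p + b * g2 p + g3 p) =
    a * \int[leb2]_(p in disc r) g1 p + b * \int[leb2]_(p in disc r) g2 p +
    \int[leb2]_(p in disc r) g3 p.
  move=> c1 c2 c3.
  have ca : continuous (fun p => a * g1 p).
    by move=> p; apply: cvgM; [exact: cvg_cst | exact: c1].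
  have cb : continuous (fun p => b * g2 p).
    by move=> p; apply: cvgM; [exact: cvg_cst | exact: c2].
  have cab : continuous (fun p => a * g1 p + b * g2 p).
    by move=> p; apply: cvgD; [exact: ca | exact: cb].
  rewrite (RintegralD mD (I _ cab) (I _ c3)) (RintegralD mD (I _ ca) (I _ cb)).
  by rewrite (RintegralZl _ mD (I _ c1)) (RintegralZl _ mD (I _ c2)).
rewrite /disc_current; apply: C_ext; rewrite ?ReD ?ImD ?Re_mulc ?Im_mulc [RHS]/= [LHS]/=.
  rewrite -mulNr -main //; apply: eq_Rintegral => p _.
  by rewrite pullback2_scale_add ReD Re_mulc mulNr.
rewrite -main //; apply: eq_Rintegral => p _.
by rewrite pullback2_scale_add ImD Im_mulc.
Qed.

Lemma pullback_const_form c0 c1 (z : C) : pullback2 (curve P) (const_form c0 c1) z =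
  (c0 * cabs (P' ord0 z) ^+ 2 + c1 * cabs (P' j1 z) ^+ 2)%:C.
Proof.
rewrite (pullback2_curve PT _ (is_form_periodic (const_form_is_form c0 c1))).
by rewrite /lift_form const_form_diag !mxE.
Qed.

Lemma disc_current_const_form c0 c1 r : disc_current (curve P) r (const_form c0 c1) =
  (\int[leb2]_(p in disc r) (c0 * cabs (P' ord0 (plane_C p)) ^+ 2 + c1 * cabs (P' j1 (plane_C p)) ^+ 2))%:C.
Proof.
have h (p : R * R) := pullback_const_form c0 c1 (p.1 +i* p.2).
rewrite /disc_current; under eq_Rintegral => p _ do rewrite h.
under [X in _ +i* X]eq_Rintegral => p _ do rewrite h.
by rewrite [X in _ +i* X]Rintegral_cst ?mul0r //; exact: disc_measurable.
Qed.

Lemma area_energy r : area (@omega0 R) (curve P) r = total_energy r.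
Proof.
rewrite /area /omega0 disc_current_const_form /=.
by apply: eq_Rintegral => p _; rewrite !mul1r.
Qed.

Definition circ (r t : R) : C := (r * cos t) +i* (r * sin t).

Lemma cabs_circ r t : 0 <= r -> cabs (circ r t) = r.
Proof.
move=> r0; rewrite /cabs /= !exprMn -mulrDr cos2Dsin2 mulr1 sqrtr_sqr ger0_norm //.
Qed.

Lemma tangent_norm_circ r t : 0 <= r ->
  tangent_norm (@omega0 R) (curve P (circ r t)) ((iC * circ r t) *: velocity (curve P) (circ r t)) =
  r * Num.sqrt (cabs (P' ord0 (circ r t)) ^+ 2 + cabs (P' j1 (circ r t)) ^+ 2).
Proof.
move=> r0; rewrite /tangent_norm /eval2 /omega0 const_form_diag /= (curve_velocity PT) !mxE !mul1r.
have ci : cabs (iC : C) = 1 by rewrite /cabs /= expr0n expr1n add0r sqrtr1.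
rewrite !cabsM ci mul1r cabs_circ // !exprMn -mulrDr sqrtrM ?sqr_ge0 // sqrtr_sqr ger0_norm //.
Qed.

Lemma circ_continuous r : continuous (circ r).
Proof.
move=> t; apply/cvgC; split => /=.
  by apply: cvgM; [exact: cvg_cst | exact: continuous_cos].
by apply: cvgM; [exact: cvg_cst | exact: continuous_sin].
Qed.

(** The speed of t |-> f(r e^(it)) is r |f'|, and each component of f' is at most
    B. *)
Lemma boundary_length_bound r B : 0 < r -> (forall z j, cabs z <= r -> cabs (P' j z) <= B) ->
  0 <= boundary_length (@omega0 R) (curve P) r <= r * (2 * B) * (2 * pi).
Proof.
move=> r0 hB.
have e : boundary_length (@omega0 R) (curve P) r =
    \int[lebesgue_measure]_(t in `[0, 2 * pi])
       (r * Num.sqrt (cabs (P' ord0 (circ r t)) ^+ 2 + cabs (P' j1 (circ r t)) ^+ 2)).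
  by apply: eq_Rintegral => t _; exact: tangent_norm_circ (ltW r0).
set g := fun t : R => r * Num.sqrt (cabs (P' ord0 (circ r t)) ^+ 2 + cabs (P' j1 (circ r t)) ^+ 2).
rewrite e -/g.
have g0 t : 0 <= g t by rewrite /g mulr_ge0 ?sqrtr_ge0 // ltW.
have B0 : 0 <= B by apply: le_trans (hB 0 ord0 _); rewrite ?cabs_ge0 // cabs0 ltW.
have gB t : g t <= r * (2 * B).
  rewrite /g ler_pM2l // -[leRHS](ger0_norm (_ : 0 <= 2 * B)) ?mulr_ge0 //.
  rewrite -sqrtr_sqr; apply: ler_wsqrtr.
  have h j : cabs (P' j (circ r t)) ^+ 2 <= B ^+ 2.
    apply: lerXn2r; rewrite ?nnegrE ?cabs_ge0 //; apply: hB.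
    by rewrite cabs_circ // ltW.
  by have := h ord0; have := h j1; have := sqr_ge0 B; rewrite exprMn; lra.
have cg : continuous g.
  have cc j : continuous (fun t => cabs (P' j (circ r t)) ^+ 2).
    move=> t.
    have h : (fun t => cabs (P' j (circ r t))) @ nbhs t --> cabs (P' j (circ r t)).
      apply: cvg_cabs.
      by apply: (@continuous_comp _ _ _ (circ r) (P' j)); [exact: circ_continuous | exact: cP'].
    exact: (cvgM h h).
  move=> t; apply: cvgM; first exact: cvg_cst.
  apply: (@continuous_comp _ _ _ (fun t => cabs (P' ord0 (circ r t)) ^+ 2 + cabs (P' j1 (circ r t)) ^+ 2) Num.sqrt).
    by apply: cvgD; exact: cc.
  exact: sqrt_continuous.
have mI : measurable (`[0, 2 * pi]%classic : set (measurableTypeR R)) by exact: measurable_itv.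
have muI : (@lebesgue_measure R `[0%R, (2 * pi)%R]%classic = (2 * pi)%:E)%E.
  rewrite lebesgue_measure_itv /= lte_fin ifT; last by rewrite mulr_gt0 // pi_gt0.
  by rewrite sube0.
have ig : (@lebesgue_measure R).-integrable `[0, 2 * pi] (EFin \o g).
  apply: measurable_bounded_integrable => //.
  - by rewrite [X in (X < _)%E]muI ltry.
  - by apply: measurable_funTS; exact: continuous_measurable_fun.
  - exists (r * (2 * B)); split; first exact: num_real.
    move=> x hx t _ /=; rewrite ger0_norm //; exact: le_trans (gB t) (ltW hx).
apply/andP; split; first by apply: fine_ge0; apply: integral_ge0 => t _; rewrite lee_fin.
apply: (@le_trans _ _ (\int[lebesgue_measure]_(t in `[0, 2 * pi]) (r * (2 * B)))).
  apply: le_Rintegral => //.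
  apply: measurable_bounded_integrable => //.
  - by rewrite [X in (X < _)%E]muI ltry.
  - exists (r * (2 * B)); split; first exact: num_real.
    move=> x hx t _ /=; rewrite ger0_norm ?mulr_ge0 ?(ltW r0) //; exact: ltW.
  by move=> t _; exact: gB.
by rewrite (Rintegral_cst _ mI) [X in fine X]muI.
Qed.
End AreaLength.

(** * Smooth convergence of forms and uniform convergence of coefficients *)

Section SmoothUniform.
Context {R : realType}.
Local Notation C := (Cplx R).
Local Notation V := 'rV[C]_2.
Local Notation X := (@torus2 R).

(** A compact neighbourhood inside a chart; convergence of forms is uniform on
    compact subsets of chart images only. *)
Definition closed_box (w : V) (d : R) : set V :=
  [set v | forall j, `|Re (v ord0 j - w ord0 j)| <= d /\ `|Im (v ord0 j - w ord0 j)| <= d].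

Lemma closed_box_compact w d : compact (closed_box w d).
Proof.
have c0 : compact [set v : V | forall j, [set z : C | - d <= Re z <= d /\ - d <= Im z <= d] (v ord0 j)].
  by apply: (@rV_compact C 2 (fun=> [set z : C | - d <= Re z <= d /\ - d <= Im z <= d])) => _;
  exact: square_compact.
suff -> : closed_box w d = (fun v : V => v + w) @`
    [set v : V | forall j, [set z : C | - d <= Re z <= d /\ - d <= Im z <= d] (v ord0 j)].
  apply: continuous_compact => //.
  by apply: continuous_subspaceT => v; exact: cvg_translation.
rewrite eqEsubset; split=> [v hv|v [u hu <-] j].
  exists (v - w); last by rewrite subrK.
  by move=> j /=; have [h1 h2] := hv j; rewrite !mxE -!ler_norml.
by have [h1 h2] := hu j; rewrite !mxE addrK !ler_norml.
Qed.

Lemma polydisc_closed_box w d : polydisc w d `<=` closed_box w d.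
Proof.
move=> v hv j; have := hv ord0 j; rewrite cabsBC => h.
by split; apply: le_trans (ltW h); rewrite ?Re_le_cabs ?Im_le_cabs.
Qed.

Lemma closed_box_sub_polydisc w d e : 0 <= d -> 2 * d < e -> closed_box w d `<=` polydisc w e.
Proof.
move=> d0 de v hv i j; rewrite (ord1 i) cabsBC.
have [h1 h2] := hv j; apply: le_lt_trans (cabs_le _) _; lra.
Qed.

Lemma uniform_eventually (K : set V) (u : nat -> V -> C) (e : R) : 0 < e ->
  {uniform K, u @ \oo --> (cst 0 : V -> C)} ->
  \forall m \near \oo, forall w, K w -> cabs (u m w) <= e.
Proof.
move=> e0 h; have ec : 0 < (e%:C : C) by rewrite -[0]/((0 : R)%:C) ltC_real.
have := h [set g | forall w, K w -> ball (0 : C) e%:C (g w)].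
move=> [|m _ hm].
  apply/uniform_nbhs; exists [set xy | ball xy.1 (PosNum ec)%:num xy.2]; split => //.
  exact: entourage_ball.
exists m => // n mn w Kw; have := hm n mn w Kw.
by rewrite -ball_normE /= sub0r normrN normCE ltC_real => /ltW.
Qed.

(** The coefficients of the forms are periodic, so local uniform convergence near
    the points of the compact unit box is uniform convergence on C^2. *)
Lemma smooth_cvg0_uniform k (u : nat -> preform X k) (v : 'I_k -> V) (e : R) : 0 < e ->
  (forall m, is_form (u m)) ->
  (forall i v, smooth_cvg0 (chart_img i) (fun m z => u m i z v)) ->
  \forall m \near \oo, forall w, cabs (lift_form (u m) w v) <= e.
Proof.
move=> e0 fu cu.
have loc (x : V) : \forall x' \near x & m \near \oo, cabs (lift_form (u m) x' v) <= e.
  have sub : closed_box x (1 / 9) `<=` chart_img (X := X) x.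
    have -> : chart_img (X := X) x = polydisc x (1 / 4) by exact: tchart_img.
    by apply: closed_box_sub_polydisc; lra.
  have := uniform_eventually e0 (cu x v [::] _ (@closed_box_compact x _) sub).
  move=> hm; exists (polydisc x (1 / 9), [set m | forall w, closed_box x (1 / 9) w -> cabs (u m x w v) <= e]).
    split=> //=; apply/nbhs_polydisc; exists (1 / 9) => //; lra.
  move=> [w m] /= [hw hu]; have wK := polydisc_closed_box hw.
  rewrite -(@form_lift R k (u m) x w v (fu m)); first exact: hu.
  by apply: closed_box_sub_polydisc wK; lra.
have /compact_near_coveringP nc := @unit_box_compact R.
have := nc _ _ (fun m w => cabs (lift_form (u m) w v) <= e) eventually_filter (fun x _ => loc x).
apply: filterS => m hm w.
rewrite -(@lift_periodic R k (u m) w (- vec_floor w) v (fu m)); last exact: latticeN (vec_floor_lattice w).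
exact: hm (vec_frac_unit_box w).
Qed.
End SmoothUniform.

(** * Limits of the normalized currents *)

Section Averages.
Context {R : realType}.
Local Notation C := (Cplx R).
Local Notation V := 'rV[C]_2.
Local Notation X := (@torus2 R).

Variables (P P' P'' : 'I_2 -> C -> C).
Hypothesis PT : forall j, taylor (P j) (P' j).
Hypothesis PT' : forall j, taylor (P' j) (P'' j).
Hypothesis cP'' : forall j, continuous (P'' j).

(** Multiplying both vectors of the pair (v, i v) by i multiplies a form of bidegree
    (2, 0) or (0, 2) by -1, yet it gives (i v, -v), on which an alternating form
    takes the same value. *)
Lemma pullback_bidegree (eta : preform X 2) z : is_form eta ->
  of_bidegree 2 0 eta \/ of_bidegree 0 2 eta -> pullback2 (curve P) eta z = 0.
Proof.
move=> fe bi; rewrite (pullback2_curve PT _ (is_form_periodic fe)).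
set w := vecf P z; set v : V := vecf P' z.
have ii : (iC : C) * iC = -1 by apply: C_ext; rewrite ?Re_mulc ?Im_mulc /=; ring.
have vE : (fun a => iC *: vec2 v (iC *: v) a) = vec2 (iC *: v) (- v).
  apply/funext; apply: ord2P => //=.
  by rewrite /vec2 /= scalerA ii scaleN1r.
have [_ L1] := lift2_linear w fe.
(* Alternation: the pair (i v, -v) has the value of (v, i v). *)
have rot : lift_form eta w (vec2 (iC *: v) (- v)) = lift_form eta w (vec2 v (iC *: v)).
  have L0 : lift_form eta w (vec2 (iC *: v) 0) = 0.
    have := L1 (iC *: v) 1 0 0; rewrite scale1r addr0 mul1r => /eqP.
    by rewrite -[X in X == _]addr0 (inj_eq (addrI _)) => /eqP <-.
  have := L1 (iC *: v) (-1) v 0; rewrite addr0 L0 addr0 [((-1)%:C)%C]rmorphN1 scaleN1r mulN1r => ->.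
  by rewrite (lift2_antisym w v (iC *: v) fe) opprK.
(* Bidegree: i^2 and (conj i)^2 are both -1. *)
have neg : lift_form eta w (vec2 (iC *: v) (- v)) = - lift_form eta w (vec2 v (iC *: v)).
  have cii : (conjc (iC : R[i]) : C) ^+ 2 = -1.
    by rewrite expr2; apply: C_ext; rewrite ?Re_mulc ?Im_mulc /=; ring.
  rewrite -vE /lift_form; case: bi => b; rewrite (b w w _ iC (chart_img_self w)).
    by rewrite expr0 mulr1 expr2 ii mulN1r.
  by rewrite expr0 mul1r cii mulN1r.
move: neg; rewrite rot => /eqP; rewrite -addr_eq0 -mulr2n mulrn_eq0 /=.
by move/eqP.
Qed.

Lemma pullback_positive (eta : preform X 2) z : positive_form eta ->
  0 <= Re (pullback2 (curve P) eta z) /\ Im (pullback2 (curve P) eta z) = 0.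
Proof.
move=> [fe _ pe]; rewrite (pullback2_curve PT _ (is_form_periodic fe)).
have := pe (vecf P z) (vecf P z) (vecf P' z) (chart_img_self _).
by rewrite -/(lift_form _ _ _) lecE /= => /andP[/eqP -> ->].
Qed.

Variable rr : nat -> R.
Hypothesis rr0 : forall m, 0 < rr m.
Hypothesis A0 : forall m, 0 < total_energy P' (rr m).

Definition normalized (m : nat) (eta : preform X 2) : C :=
  disc_current (curve P) (rr m) eta / (area (@omega0 R) (curve P) (rr m))%:C.

Lemma normalizedE m eta :
  Re (normalized m eta) = Re (disc_current (curve P) (rr m) eta) / total_energy P' (rr m) /\
  Im (normalized m eta) = Im (disc_current (curve P) (rr m) eta) / total_energy P' (rr m).
Proof.
rewrite /normalized (area_energy PT) -fmorphV Re_mulc Im_mulc /= !mulr0 subr0 add0r.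
by rewrite mulrC.
Qed.

Lemma normalized_linear m (c : C) eta theta : is_form eta -> is_form theta ->
  normalized m (c *: eta + theta) = c * normalized m eta + normalized m theta.
Proof. by move=> fe ft; rewrite /normalized (disc_current_linear PT PT') // mulrDl mulrA. Qed.

Lemma normalized_bound m eta eps : 0 <= eps -> is_form eta ->
  (forall k w, cabs (form_coef eta k w) <= eps) -> cabs (normalized m eta) <= 32 * eps.
Proof.
move=> e0 fe h; have [b1 b2] := disc_current_bound PT PT' (rr0 m) e0 fe h.
apply: le_trans (cabs_le _) _; have [-> ->] := normalizedE m eta.
rewrite !normrM !normfV !(gtr0_norm (A0 m)) -mulrDl ler_pdivrMr //; lra.
Qed.

Lemma normalized_bidegree m eta : is_form eta -> of_bidegree 2 0 eta \/ of_bidegree 0 2 eta ->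
  normalized m eta = 0.
Proof.
move=> fe bi; rewrite /normalized /disc_current.
under eq_Rintegral => p _ do rewrite (pullback_bidegree _ fe bi).
under [X in _ +i* X]eq_Rintegral => p _ do rewrite (pullback_bidegree _ fe bi).
by rewrite !Rintegral_cst ?mul0r //; exact: disc_measurable.
Qed.

Lemma normalized_positive m eta : positive_form eta -> 0 <= Re (normalized m eta) /\ Im (normalized m eta) = 0.
Proof.
move=> pe; have [-> ->] := normalizedE m eta.
split.
  apply: divr_ge0; last exact: ltW.
  by apply: Rintegral_ge0 => p _; exact: (pullback_positive _ pe).1.
rewrite /disc_current /=; under eq_Rintegral => p _ do rewrite (pullback_positive _ pe).2.
by rewrite Rintegral_cst ?mul0r //; exact: disc_measurable.
Qed.

Variable B : nat -> R.
Hypothesis hB : forall m z j, cabs z <= rr m -> cabs (P' j z) <= B m.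
Hypothesis hlim : (fun m => rr m * B m / total_energy P' (rr m)) @ \oo --> (0 : R).

Lemma ratio_cvg0 (f : nat -> R) (K : R) : (forall m, `|f m| <= K * (rr m * B m)) ->
  (fun m => f m / total_energy P' (rr m)) @ \oo --> (0 : R).
Proof.
move=> hf; have h : (fun m => K * (rr m * B m / total_energy P' (rr m))) @ \oo --> (0 : R).
  by rewrite -(mulr0 K); apply: cvgM => //; exact: cvg_cst.
apply: norm_cvg0; apply: (squeeze_cvgr _ (cvg_cst 0) h); apply: nearW => m.
by rewrite normr_ge0 normrM normfV (gtr0_norm (A0 m)) mulrA ler_pM2r ?invr_gt0 // hf.
Qed.

(** Both this limit and [length_area_cvg0] come from the hypothesis that
    r sup|f'| is negligible with respect to the area. *)
Lemma normalized_exact alpha : is_form alpha -> normalized m (ext_deriv alpha) @[m --> \oo] --> (0 : C).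
Proof.
move=> fa; have [K K0 hK] := stokes_bound PT PT' cP'' fa.
apply/cvgC; split.
  rewrite (_ : (fun m => _) = (fun m => Re (disc_current (curve P) (rr m) (ext_deriv alpha)) / total_energy P' (rr m))).
    apply: (@ratio_cvg0 _ (32 * K)) => m.
    by have := (hK _ _ (rr0 m) (@hB m)).1; rewrite (_ : 32 * K * _ = 4 * (8 * rr m * (K * B m))) //; ring.
  by apply/funext => m; rewrite (normalizedE _ _).1.
rewrite (_ : (fun m => _) = (fun m => Im (disc_current (curve P) (rr m) (ext_deriv alpha)) / total_energy P' (rr m))).
  apply: (@ratio_cvg0 _ (32 * K)) => m.
  by have := (hK _ _ (rr0 m) (@hB m)).2; rewrite (_ : 32 * K * _ = 4 * (8 * rr m * (K * B m))) //; ring.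
by apply/funext => m; rewrite (normalizedE _ _).2.
Qed.

Lemma length_area_cvg0 :
  boundary_length (@omega0 R) (curve P) (rr m) / area (@omega0 R) (curve P) (rr m)
    @[m --> \oo] --> (0 : R).
Proof.
under eq_fun do rewrite (area_energy PT).
apply: (@ratio_cvg0 _ (4 * pi)) => m.
have /andP[h1 h2] := boundary_length_bound PT PT' (rr0 m) (@hB m).
by rewrite ger0_norm //; apply: le_trans h2 _; rewrite le_eqVlt; apply/orP; left; apply/eqP; ring.
Qed.

Hypothesis normalized_cv : forall eta, is_form eta ->
  cvgn (fun m => Re (normalized m eta)) /\ cvgn (fun m => Im (normalized m eta)).

(** Defined by limits for every preform, so that its value on an exact form can be
    computed without knowing that the exterior derivative is again a form. *)
Definition limit_current : preform X 2 -> C := fun eta =>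
  limn (fun m => Re (normalized m eta)) +i* limn (fun m => Im (normalized m eta)).

Lemma limit_current_cvg eta : is_form eta -> normalized m eta @[m --> \oo] --> limit_current eta.
Proof. by move=> /normalized_cv [h1 h2]; apply/cvgC. Qed.

Lemma limit_current_eq eta l : normalized m eta @[m --> \oo] --> l -> limit_current eta = l.
Proof.
move=> /cvgC [h1 h2]; rewrite /limit_current (cvg_lim _ h1) // (cvg_lim _ h2) //.
by case: l {h1 h2}.
Qed.

(** Continuity follows from [normalized_bound], which passes to the limit because
    its constant does not depend on the radius. *)
Lemma limit_current_is_current : is_current limit_current.
Proof.
split.
  move=> c eta theta fe ft; apply: limit_current_eq.
  under eq_fun do rewrite normalized_linear //.
  apply: cvgD; last exact: limit_current_cvg.
  by apply: cvgM; [exact: cvg_cst | exact: limit_current_cvg].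
move=> u fu cu; apply/cvgC0/cvgrPdist_le => e e0.
have e1 : 0 < e / 32 by lra.
have := @filter_forall _ ('I_4 * 'I_4)%type (fun k m => forall w, cabs (form_coef (u m) k w) <= e / 32) _ eventually_filter
  (fun k => smooth_cvg0_uniform (vec2 (basis_at k.1).1 (basis_at k.2).1) e1 fu cu).
apply: filterS => m hm; rewrite sub0r normrN subr0 ger0_norm ?cabs_ge0 //.
apply: (cabs_lim_le (limit_current_cvg (fu m))) => n.
by apply: le_trans (@normalized_bound n _ _ (ltW e1) (fu m) hm) _; lra.
Qed.

Lemma limit_current_ahlfors : increasing_seq rr -> rr m @[m --> \oo] --> +oo ->
  ahlfors_current (@omega0 R) (curve P) limit_current.
Proof.
move=> inc ooo; split.
- exact: limit_current_is_current.
- move=> eta fe bi; apply: limit_current_eq.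
  by under eq_fun do rewrite normalized_bidegree //; exact: cvg_cst.
- move=> eta pe; have [fe _ _] := pe; have [h1 h2] := normalized_cv fe.
  have hI : limn (fun m => Im (normalized m eta)) = 0.
    rewrite (_ : (fun m => _) = cst 0); first by apply: cvg_lim => //; exact: cvg_cst.
    by apply/funext => m; rewrite (normalized_positive m pe).2.
  have hR : 0 <= limn (fun m => Re (normalized m eta)).
    by apply: limr_ge => //; apply: nearW => m; exact: (normalized_positive m pe).1.
  by rewrite /limit_current hI -[0]/((0 : R)%:C) leC_real.
- by move=> alpha fa; apply: limit_current_eq; exact: normalized_exact.
- exists rr; split => //; first exact: length_area_cvg0.
  by move=> eta fe; exact: limit_current_cvg.
Qed.
End Averages.

(** * Existence of Ahlfors currents *)

Section Subsequence.
Context {R : realType}.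
Local Notation C := (Cplx R).
Local Notation V := 'rV[C]_2.
Local Notation X := (@torus2 R).

Lemma subseq_cvg_oo (phi : nat -> nat) : (forall m, (phi m < phi m.+1)%N) -> phi @ \oo --> \oo.
Proof.
move=> h; have ge m : (m <= phi m)%N.
  by elim: m => // m IH; exact: leq_ltn_trans IH (h m).
move=> A [N _ hN]; exists N => // m /= Nm; apply: hN => /=; exact: leq_trans Nm (ge m).
Qed.

Lemma cvg_finite_sum (I : Type) (s : seq I) (f : I -> nat -> R) :
  (forall i, cvgn (f i)) -> cvgn (fun m => \sum_(i <- s) f i m).
Proof.
move=> cf; elim: s => [|i s IH].
  by under eq_fun do rewrite big_nil; exact: is_cvg_cst.
by under eq_fun do rewrite big_cons; exact: is_cvgD.
Qed.

(** [weak_limit] gives one subsequence for all coefficient functions; applied to the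
    real and imaginary parts of the coefficients of a form it gives convergence of
    the normalized currents on that form. *)
Lemma ahlfors_subsequence (P P' P'' : 'I_2 -> C -> C) (rr B : nat -> R) :
  (forall j, taylor (P j) (P' j)) -> (forall j, taylor (P' j) (P'' j)) ->
  (forall j, continuous (P'' j)) ->
  (forall m, 0 < rr m) -> (forall m, 0 < total_energy P' (rr m)) ->
  (forall m z j, cabs z <= rr m -> cabs (P' j z) <= B m) ->
  (fun m => rr m * B m / total_energy P' (rr m)) @ \oo --> (0 : R) ->
  increasing_seq rr -> rr m @[m --> \oo] --> +oo ->
  exists T : preform X 2 -> C, ahlfors_current (@omega0 R) (curve P) T /\
    exists2 phi : nat -> nat, phi @ \oo --> \oo &
      forall eta, is_form eta -> normalized P (rr \o phi) m eta @[m --> \oo] --> T eta.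
Proof.
move=> PT PT' cP'' rr0 A0 hB hlim inc ooo.
have cP j : continuous (P j) := taylor_continuous (PT j).
have [phi hphi cphi] := weak_limit (energy_continuous PT') (vecf_plane_continuous cP)
  (density_continuous PT') (density_le P') rr0 A0.
have poo := subseq_cvg_oo hphi.
have normalized_cv eta : is_form eta -> cvgn (fun m => Re (normalized P (rr \o phi) m eta)) /\
    cvgn (fun m => Im (normalized P (rr \o phi) m eta)).
  move=> fe; split.
    rewrite (_ : (fun m => _) = (fun m => \sum_k ((\int[leb2]_(p in disc (rr (phi m)))
        (Re (form_coef eta k (vecf P (plane_C p))) * density P' k p)) / total_energy P' (rr (phi m))))).
      apply: cvg_finite_sum => k; apply: (cphi k (fun w => Re (form_coef eta k w))).
        exact: form_coef_Re_continuous.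
      by move=> w l hl; rewrite form_coef_periodic.
    apply/funext => m; have -> := (normalizedE PT (rr \o phi) m eta).1.
    by rewrite (disc_current_sum PT PT' (rr0 _) fe).1 mulr_suml.
  rewrite (_ : (fun m => _) = (fun m => \sum_k ((\int[leb2]_(p in disc (rr (phi m)))
      (Im (form_coef eta k (vecf P (plane_C p))) * density P' k p)) / total_energy P' (rr (phi m))))).
    apply: cvg_finite_sum => k; apply: (cphi k (fun w => Im (form_coef eta k w))).
      exact: form_coef_Im_continuous.
    by move=> w l hl; rewrite form_coef_periodic.
  apply/funext => m; have -> := (normalizedE PT (rr \o phi) m eta).2.
  by rewrite (disc_current_sum PT PT' (rr0 _) fe).2 mulr_suml.
exists (limit_current P (rr \o phi)); split.
  apply: (@limit_current_ahlfors R P P' P'' PT PT' cP'' (rr \o phi) _ _ (B \o phi)) => //=.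
  - by move=> m z j; exact: hB.
  - exact: (cvg_comp _ _ poo hlim).
  - by apply/increasing_seqP => m /=; rewrite (leW_mono inc); exact: hphi.
  - exact: (cvg_comp _ _ poo ooo).
exists phi => // eta fe; exact: (limit_current_cvg normalized_cv).
Qed.
End Subsequence.

(** * The lacunary curve *)

Section Example.
Context {R : realType}.
Local Notation C := (Cplx R).
Local Notation V := 'rV[C]_2.
Local Notation X := (@torus2 R).
Local Notation mR := (measurableTypeR R).

Definition P_ex (j : 'I_2) : C -> C := lac_sum (odd j).
Definition P_ex' (j : 'I_2) : C -> C := lac_deriv (odd j).
Definition P_ex'' (j : 'I_2) : C -> C :=
  gap (dcoef (dcoef (lac_coef (odd j)) lac_exp) (dexp lac_exp)) (dexp (dexp lac_exp)).

Lemma entire_taylor (c : nat -> R) n : entire c n -> taylor (gap c n) (gap (dcoef c n) (dexp n)).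
Proof. by move=> ec z; exact: gap_taylor. Qed.

Lemma P_ex_taylor j : taylor (P_ex j) (P_ex' j).
Proof. exact: entire_taylor (lac_entire _). Qed.
Lemma P_ex'_taylor j : taylor (P_ex' j) (P_ex'' j).
Proof. exact: entire_taylor (entire_deriv (lac_entire _)). Qed.
Lemma P_ex''_continuous j : continuous (P_ex'' j).
Proof. exact: taylor_continuous (entire_taylor (entire_deriv (entire_deriv (lac_entire _)))). Qed.

(** The quantity u = 2^(4^k) in which all sizes at level k are measured. *)
Definition peak (k : nat) : R := 2 ^+ (4 ^ k).

Lemma peak_ge k : k.+1%:R <= peak k.
Proof.
rewrite /peak -natrX ler_nat; apply: leq_trans (ltn_2X _).
by elim: k => // k IH; rewrite expnS; lia.
Qed.
Lemma peak_gt0 k : 0 < peak k. Proof. by rewrite exprn_gt0. Qed.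
Lemma peak_ge2 k : 2 <= peak k.
Proof. by rewrite -[leLHS]expr1; apply: ler_weXn2l; rewrite ?ler1n // expn_gt0. Qed.
Lemma peak_ge1 k : 1 <= peak k.
Proof. by apply: le_trans (peak_ge2 k); rewrite ler1n. Qed.

Lemma P_ex'_le k z j : (0 < k)%N -> cabs z <= rad k -> cabs (P_ex' j z) <= peak k ^+ 9 / rad k.
Proof.
move=> k0 zr; rewrite ler_pdivlMr ?rad_gt0 // mulrC.
rewrite /P_ex'; have [->|/negbTE h] := eqVneq (odd j) (odd k); first exact: lac_deriv_large.
have -> : odd j = ~~ odd k by move: h; case: (odd j); case: (odd k).
apply: le_trans (lac_deriv_small k0 zr) _; rewrite -/(peak k).
rewrite -[9%N]/(3 + 6)%N exprD ler_wpM2r ?exprn_ge0 ?(ltW (peak_gt0 _)) //.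
by apply: le_trans (peak_ge2 k) _; rewrite -[leLHS]expr1; apply: ler_weXn2l => //; exact: peak_ge1.
Qed.

Definition component_energy (b : bool) (r : R) : R := \int[leb2]_(p in disc r) (cabs (lac_deriv b (plane_C p)) ^+ 2).

Lemma lac_deriv_continuous b : continuous (lac_deriv b : C -> C).
Proof. exact: taylor_continuous (entire_taylor (entire_deriv (lac_entire b))). Qed.

Lemma energy_parts r : 0 < r -> total_energy P_ex' r = component_energy false r + component_energy true r.
Proof.
move=> r0; rewrite /total_energy /component_energy -RintegralD //; first exact: disc_measurable.
  by apply: continuous_disc_integrable => //; exact: continuous_sqr_cabs (@lac_deriv_continuous _).
by apply: continuous_disc_integrable => //; exact: continuous_sqr_cabs (@lac_deriv_continuous _).
Qed.

Lemma component_energy_small k : (0 < k)%N -> component_energy (~~ odd k) (rad k) <= 16 * peak k ^+ 12.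
Proof.
move=> k0; have r0 := @rad_gt0 R k.
have h := @disc_int_le R (rad k) ((2 * peak k ^+ 6 / rad k) ^+ 2)
  (fun p => cabs (lac_deriv (~~ odd k) (plane_C p)) ^+ 2) r0
  (continuous_measurable2 (continuous_sqr_cabs (@lac_deriv_continuous _))).
apply: le_trans (ler_norm _) _; apply: le_trans (h _) _.
  move=> [x y] xy; rewrite ger0_norm ?sqr_ge0 //; apply: lerXn2r; rewrite ?nnegrE ?cabs_ge0 //.
    by rewrite divr_ge0 ?(ltW r0) // mulr_ge0 // exprn_ge0 // ltW // peak_gt0.
  rewrite ler_pdivlMr // mulrC; apply: lac_deriv_small => //.
  rewrite -(ger0_norm (ltW r0)) -sqrtr_sqr /cabs ler_wsqrtr //; exact: ltW.
rewrite le_eqVlt; apply/orP; left; apply/eqP.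
rewrite [(_ * _ / _) ^+ 2]exprMn exprMn -exprM exprVn.
by field; rewrite lt0r_neq0.
Qed.

(** The rectangle S lies in the disc and outside that of radius r / 2, and it has area
    r^2 / 16; on it |P_b'| is at least u^7 / r. *)
Lemma component_energy_large k : (0 < k)%N -> peak k ^+ 14 / 16 <= component_energy (odd k) (rad k).
Proof.
move=> k0; have r0 := @rad_gt0 R k; set r := rad k in r0 *.
pose S := rect (r / 2) (3 * r / 4) 0 (r / 4).
have mS : measurable (S : set (mR * mR)) by exact: rect_measurable.
have areaS : leb2 S = (r ^+ 2 / 16)%:E.
  by rewrite /S rect_area; [congr (_%:E); field | lra | lra].
have SD : S `<=` disc r.
  move=> [x y]; rewrite /S /rect /disc /= !in_itv /= => -[/andP[a b] /andP[c d]]; nra.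
pose g (p : R * R) := cabs (lac_deriv (odd k) (plane_C p)) ^+ 2.
have cg : continuous g := continuous_sqr_cabs (@lac_deriv_continuous _).
have ig := continuous_disc_integrable r0 cg.
have mD := disc_measurable r.
have igS : leb2.-integrable S (EFin \o g) := integrableS mD mS SD ig.
apply: (@le_trans _ _ (\int[leb2]_(p in S) g p)).
  have -> : peak k ^+ 14 / 16 = \int[leb2]_(p in S) ((peak k ^+ 7 / r) ^+ 2).
    rewrite Rintegral_cst // [X in fine X]areaS [fine _]/=; move: (peak k) => p.
    by field; rewrite lt0r_neq0.
  apply: le_Rintegral => //.
    apply: measurable_bounded_integrable => //.
    - by rewrite [X in (X < _)%E]areaS ltry.
    - exists ((peak k ^+ 7 / r) ^+ 2); split; first exact: num_real.
      by move=> x hx t _ /=; rewrite ger0_norm ?sqr_ge0 // ltW.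
  move=> [x y] xy; have := SD _ xy; rewrite /disc /= => hd.
  apply: lerXn2r; rewrite ?nnegrE ?cabs_ge0 //.
    by rewrite divr_ge0 ?(ltW r0) // exprn_ge0 // ltW // peak_gt0.
  rewrite ler_pdivrMr // mulrC; apply: lac_deriv_lower => //.
    rewrite -/r -(ger0_norm (ltW r0)) -sqrtr_sqr /cabs ler_wsqrtr //; exact: ltW.
  apply: le_trans (Re_le_cabs _) => /=; apply: le_trans (ler_norm _).
  by move: xy; rewrite /S /rect /= !in_itv /= => -[/andP[]].
rewrite /component_energy /Rintegral; apply: fine_le.
- exact: integrable_fin_num.
- exact: integrable_fin_num.
apply: ge0_subset_integral => //; first by case/integrableP: ig.
by move=> p _; rewrite lee_fin sqr_ge0.
Qed.

Lemma component_energy_ge0 b r : 0 <= component_energy b r.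
Proof. by apply: Rintegral_ge0 => p _; exact: sqr_ge0. Qed.

Lemma energy_lower k : (0 < k)%N -> peak k ^+ 14 / 16 <= total_energy P_ex' (rad k).
Proof.
move=> k0; rewrite energy_parts ?rad_gt0 //; apply: le_trans (component_energy_large k0) _.
by case: (odd k); [rewrite lerDr component_energy_ge0 | rewrite lerDl component_energy_ge0].
Qed.

Lemma energy_pos k : (0 < k)%N -> 0 < total_energy P_ex' (rad k).
Proof.
by move=> k0; apply: lt_le_trans (energy_lower k0); rewrite divr_gt0 // exprn_gt0 // peak_gt0.
Qed.

Lemma bound_over_energy k : (0 < k)%N ->
  rad k * (peak k ^+ 9 / rad k) / total_energy P_ex' (rad k) <= 16 / peak k.
Proof.
move=> k0; have p0 := peak_gt0 k; have A0 := energy_pos k0.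
rewrite mulrCA divff ?lt0r_neq0 ?rad_gt0 // mulr1 ler_pdivrMr //.
apply: (@le_trans _ _ (16 / peak k * (peak k ^+ 14 / 16))).
  have -> : 16 / peak k * (peak k ^+ 14 / 16) = peak k ^+ 13 by field; rewrite lt0r_neq0.
  by apply: ler_weXn2l => //; exact: peak_ge1.
by rewrite ler_pM2l ?divr_gt0 //; exact: energy_lower.
Qed.

Lemma component_energy_ratio k : (0 < k)%N ->
  component_energy (~~ odd k) (rad k) / total_energy P_ex' (rad k) <= 256 / peak k.
Proof.
move=> k0; have p0 := peak_gt0 k; have A0 := energy_pos k0.
rewrite ler_pdivrMr //; apply: le_trans (component_energy_small k0) _.
apply: (@le_trans _ _ (256 / peak k * (peak k ^+ 14 / 16))).
  have -> : 256 / peak k * (peak k ^+ 14 / 16) = 16 * peak k ^+ 13 by field; rewrite lt0r_neq0.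
  by rewrite ler_pM2l //; apply: ler_weXn2l => //; exact: peak_ge1.
by rewrite ler_pM2l ?divr_gt0 //; exact: energy_lower.
Qed.

(** The positive indices of parity [b]; the estimates at level k need k > 0. *)
Definition idx (b : bool) (m : nat) : nat := (m.*2 + ~~ b).+1.

Lemma odd_idx b m : odd (idx b m) = b.
Proof. by rewrite /idx /= oddD odd_double; case: b. Qed.

Lemma inv_peak_idx b m : (peak (idx b m))^-1 <= (m.+1%:R)^-1.
Proof.
rewrite lef_pV2 ?posrE ?peak_gt0 ?ltr0n //; apply: le_trans (peak_ge _).
by rewrite ler_nat /idx -addnn; lia.
Qed.

Lemma idx_cvg0 b (f : nat -> R) (K : R) : 0 <= K ->
  (forall m, 0 <= f m <= K / peak (idx b m)) -> f @ \oo --> (0 : R).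
Proof.
move=> K0 hf; have h : (fun m => K * harmonic m) @ \oo --> (0 : R).
  by rewrite -(mulr0 K); apply: cvgM; [exact: cvg_cst | exact: cvg_harmonic].
apply: (squeeze_cvgr _ (cvg_cst 0) h); apply: nearW => m.
have /andP[-> h2] := hf m; apply: le_trans h2 _.
by rewrite ler_wpM2l //; exact: inv_peak_idx.
Qed.

Lemma rad_lt k l : (k < l)%N -> rad k < rad l :> R.
Proof. by move=> kl; rewrite /rad ltr_eXn2l // /rho -natrX ltr1n. Qed.

Lemma rad_ge k : k%:R <= rad k :> R.
Proof.
apply: (@le_trans _ _ (2 ^+ k)); first by rewrite -natrX ler_nat ltnW // ltn_2X.
rewrite /rad rho_exp; apply: (@le_trans _ _ (16 ^+ k)).
  by apply: lerXn2r; rewrite ?nnegrE // ler_nat.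
by apply: ler_weXn2l; [rewrite ler1n | lia].
Qed.

(** dx_0 /\ dy_0: its integral over f(D_r) is the part of the area that comes from
    the first component. *)
Definition first_area : preform X 2 := const_form 1 0.

(** For [b = true] the indices are odd, the second component dominates and the first
    one has a vanishing share of the area; for [b = false] it is the other way
    round. *)
Lemma example_current (b : bool) : exists T : preform X 2 -> C,
  ahlfors_current (@omega0 R) (curve P_ex) T /\ T first_area = (~~ b)%:R.
Proof.
pose rr m : R := rad (idx b m).
have rr0 m : 0 < rr m by exact: rad_gt0.
have A0 m : 0 < total_energy P_ex' (rr m) by exact: energy_pos.
have [||||T [hT [phi poo hphi]]] := @ahlfors_subsequence R P_ex P_ex' P_ex'' rr
    (fun m => peak (idx b m) ^+ 9 / rr m) P_ex_taylor P_ex'_taylor P_ex''_continuous rr0 A0.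
- by move=> m z j; exact: P_ex'_le.
- apply: (@idx_cvg0 b _ 16) => // m; rewrite bound_over_energy // andbT.
  apply: divr_ge0; last exact: ltW.
  apply: mulr_ge0; first exact: ltW.
  by apply: divr_ge0; [exact/exprn_ge0/ltW/peak_gt0 | exact: ltW].
- by apply/increasing_seqP => m; apply: rad_lt; rewrite /idx doubleS; lia.
- apply/cvgryPge => x; near=> n.
  apply: le_trans (_ : n%:R <= _); first by near: n; exact: nbhs_infty_ger.
  by apply: le_trans (rad_ge _); rewrite ler_nat /idx -addnn; lia.
exists T; split => //.
have hs : (fun m => component_energy (~~ b) (rr m) / total_energy P_ex' (rr m)) @ \oo --> (0 : R).
  apply: (@idx_cvg0 b _ 256) => // m; apply/andP; split.
    by rewrite divr_ge0 ?component_energy_ge0 // ltW.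
  by rewrite -{1}(odd_idx b m); exact: component_energy_ratio.
have hf : (fun m => component_energy false (rr m) / total_energy P_ex' (rr m)) @ \oo --> ((~~ b)%:R : R).
  case: b @rr rr0 A0 hT hphi hs => rr rr0 A0 hT hphi hs /=; first exact: hs.
  rewrite (_ : (fun m => _) = (fun m => 1 - component_energy true (rr m) / total_energy P_ex' (rr m))).
    by rewrite -[X in _ --> X]subr0; apply: cvgB; [exact: cvg_cst | exact: hs].
  apply/funext => m; rewrite -[X in _ = X - _](divff (lt0r_neq0 (A0 m))) -mulrBl.
  by rewrite {2}energy_parts // addrK.
have fe1 : is_form first_area by exact: const_form_is_form.
apply: (cvgC_unique (hphi _ fe1)).
have e m : normalized P_ex (rr \o phi) m first_area =
    (component_energy false (rr (phi m)) / total_energy P_ex' (rr (phi m)))%:C.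
  rewrite /normalized (area_energy P_ex_taylor) (disc_current_const_form P_ex_taylor) -fmorphV -rmorphM.
  congr ((_ / _)%:C); apply: eq_Rintegral => p _; by rewrite mul1r mul0r addr0.
under eq_fun do rewrite e.
apply/cvgC; split => /=; last first.
  by rewrite (_ : Im _ = 0); [exact: cvg_cst | case: (b)].
rewrite (_ : Re _ = (~~ b)%:R); last by case: (b).
exact: (cvg_comp _ _ poo hf).
Unshelve. all: by end_near.
Qed.

Lemma velocity_cst (x : X) (z : C) : velocity (cst x) z = 0.
Proof. exact: (@derive_cst _ _ _ (chart (chart_at x) x) z 1). Qed.

Lemma exists_radius (r : R) : 0 < r -> exists2 z : C, cabs z <= r & r / 2 <= cabs z.
Proof.
move=> r0; exists (r%:C : C); rewrite cabs_real ger0_norm ?lexx //; first exact: ltW.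
  lra.
exact: ltW.
Qed.

(** A constant curve has zero velocity, whereas the derivative of the first component
    is not small on the annulus of index 2. *)
Lemma curve_nonconstant : exists z w : C, curve P_ex z <> curve P_ex w.
Proof.
apply: contrapT => h.
have cst_f : curve P_ex = cst (curve P_ex 0).
  by apply/funext => z; apply: contrapT => hz; apply: h; exists z, 0.
have [k k0 ko] : exists2 k, (0 < k)%N & odd k = false by exists 2%N.
have [z z1 z2] := exists_radius (@rad_gt0 R k).
have v0 : velocity (curve P_ex) z = 0 by rewrite cst_f; exact: velocity_cst.
move: v0; rewrite (curve_velocity P_ex_taylor) => /matrixP /(_ ord0 ord0).
rewrite !mxE /P_ex' /= => d0.
have := lac_deriv_lower k0 z1 z2; rewrite ko d0 cabs0 mulr0 -/(peak k).
by rewrite leNgt exprn_gt0 ?peak_gt0.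
Qed.

Lemma zero_form_is_form k : is_form ((fun _ _ _ => 0) : preform X k).
Proof.
split=> [i z _|i v|//]; last exact: smooth_on_cst.
by split=> [v a c x y|//]; rewrite mulr0 addr0.
Qed.

(** Forms with constant coefficients are closed, so T1 - T2 = dS would vanish on
    them. *)
Lemma not_cohomologous (T1 T2 : preform X 2 -> C) : T1 first_area <> T2 first_area -> ~ cohomologous T1 T2.
Proof.
move=> h [S [[lin _] hS]]; apply: h; apply/eqP; rewrite -subr_eq0 hS; last exact: const_form_is_form.
rewrite const_form_ext_deriv.
have := lin 1 _ _ (@zero_form_is_form 3) (@zero_form_is_form 3).
set z := (fun _ _ _ => 0).
have -> : 1 *: z + z = z :> preform X 3.
  by do 3 (apply/funext => ?); rewrite /z !fctE /= scaler0 addr0.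
by rewrite mul1r => /eqP; rewrite -[X in X == _]addr0 (inj_eq (addrI _)) eq_sym.
Qed.
End Example.

(** * Two Ahlfors currents in different classes *)

Theorem theorem1p3 (R : realType) :
  exists (n : nat) (X : compactComplexManifold R n)
         (omega : preform X 2) (f : Cplx R -> X)
         (T1 T2 : preform X 2 -> Cplx R),
    area_form omega /\
    holomorphic_curve f /\
    (exists z w : Cplx R, f z <> f w) /\
    ahlfors_current omega f T1 /\
    ahlfors_current omega f T2 /\
    ~ cohomologous T1 T2.
Proof.
have [T1 [hT1 e1]] := @example_current R false.
have [T2 [hT2 e2]] := @example_current R true.
exists 2, torus2, omega0, (curve P_ex), T1, T2; split; first exact: omega0_area.
split; first exact: curve_holomorphic P_ex_taylor.
split; first exact: curve_nonconstant.
split; first exact: hT1.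
split; first exact: hT2.
apply: not_cohomologous.
by rewrite e1 e2 => /eqP; rewrite oner_eq0.
Qed.
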